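(* Let $f:\mathbb{T}^2\to\mathbb{T}^2$ be a $C^\infty$ Anosov endomorphism with quasi preservation of densities along its invariant (stable and unstable) foliations, and let $A$ be its linearization. If the stable and unstable foliations of $f$ are absolutely continuous with uniformly bounded densities (i.e. have the UBD property), then $\lambda^{\sigma}_f\equiv\lambda^{\sigma}_A$ for $\sigma\in\{u,s\}$; that is, $\lambda^u_f(x)=\lambda^u_A$ and $\lambda^s_f(x)=\lambda^s_A$ for every $x\in\mathbb{T}^2$.
   Context: Anosov endomorphism: a local $C^1$ diffeomorphism $f:M\to M$ of a closed Riemannian manifold such that for every full orbit $\tilde x=(x_i)_{i\in\mathbb{Z}}$ ($f(x_i)=x_{i+1}$) there is a splitting $T_{x_i}M=E^u(x_i)\oplus E^s(x_i)$, with $Df(x_i)E^{\sigma}(x_i)=E^{\sigma}(x_{i+1})$, and constants $c>0$, $\lambda>1$ such that for all $n\ge 0$ and all $i$: $\|Df^n(x_i)v\|\ge c^{-1}\lambda^n\|v\|$ for $v\in E^u(x_i)$ and $\|Df^n(x_i)v\|\le c\lambda^{-n}\|v\|$ for $v\in E^s(x_i)$. The map need not be invertible, and the unstable direction at a point may depend on the chosen past orbit. Standing convention: $E^s$ is nontrivial (expanding maps are excluded), so on $\mathbb{T}^2$ both $E^s$ and $E^u$ are one-dimensional. The linearization $A$ of $f$ is the unique linear toral endomorphism homotopic to $f$. The Lyapunov exponents are $\lambda^{\sigma}_f(x)=\lim_{n\to\infty}\frac1n\log\|Df^n(x)v\|$ for $0\ne v\in E^\sigma$ at $x$ (for $\sigma=u$,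 $v$ in an unstable direction at $x$; the value does not depend on the choice of past orbit defining it). $\lambda^u_A$, $\lambda^s_A$ are the logarithms of the moduli of the eigenvalues of $A$ of modulus $>1$ and $<1$, respectively. A lift $F:\mathbb{R}^2\to\mathbb{R}^2$ of $f$ to the universal cover is an Anosov diffeomorphism with ($F$-invariant) stable and unstable foliations $W^s_F$, $W^u_F$ of $\mathbb{R}^2$. Properties of ''the stable/unstable foliation of $f$'' are understood for these foliations of the lift $F$ (the unstable one need not project to a foliation of $\mathbb{T}^2$). Foliated box: a set $\mathcal B$ homeomorphic to $X\times Y$, with $X$ a local leaf and $Y$ a local transversal, the sets $X\times\{y\}$ corresponding to local leaves. UBD property: a one-dimensional foliation $\mathcal F$ has the uniform bounded density property (is absolutely continuous with uniformly bounded densities) if there is $C>1$ such that, for every foliated box $\mathcal B$, the disintegration $\{m^{\mathcal B}_x\}$ of the volume normalized to $\mathcal B$ along the local leaves satisfies $C^{-1}\le \frac{d m^{\mathcal B}_x}{d\hat\lambda^{\mathcal B}_x}\le C$, where $\hat\lambda^{\mathcal B}_x$ is the normalized induced volume (length) on the connected component of $\mathcal F(x)\cap\mathcal B$ containing $x$. Quasi preservation of densities: a map $F$ quasi preserves densities along an $F$-invariant foliation if there is a constant $C>1$ such that for each local leaf $\mathcal W$ of the foliation, each $x\in\mathcal W$ and each $k\in\mathbb{N}$, $C^{-1}\le \frac{d\hat\lambda^k_{F^k(x)}}{d(F^k_*\hat\lambda^0_x)}\le C$, where $\hat\lambda^k_{F^k(x)}$ is the normalized induced volume (length probability measure) on $F^k(\mathcal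 W)$ and $\hat\lambda^0_x$ the one on $\mathcal W$. The constant $C$ depends neither on $\mathcal W$ nor on $k$. *)

(* Defs.v *)
From HB Require Import structures.
From mathcomp Require Import all_boot all_order all_algebra.
From mathcomp Require Import all_classical all_reals all_analysis.
From mathcomp Require Import measurable_realfun.

Set Implicit Arguments.
Unset Strict Implicit.
Unset Printing Implicit Defensive.
Import Order.TTheory GRing.Theory Num.Theory.
Import numFieldNormedType.Exports.
Local Open Scope classical_set_scope.
Local Open Scope quotient_scope.
Local Open Scope ring_scope.

Notation plane R := (R * R)%type.

(* The norm that the library puts on a product is the sup norm. *)
Definition enorm (R : realType) (v : plane R) : R :=
  Num.sqrt (v.1 ^+ 2 + v.2 ^+ 2).

(* For U open, Ck k U g says that g is of class C^k on U. *)
Fixpoint Ck (R : realType) (V W : normedModType R) (k : nat) (U : set V)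
    (g : V -> W) : Prop :=
  match k with
  | 0%N => forall p, U p -> {for p, continuous g}
  | k'.+1 => (forall p, U p -> differentiable g p) /\
             (forall v : V, Ck k' U ('D_v g))
  end.

Definition smooth (R : realType) (V W : normedModType R) (g : V -> W) : Prop :=
  forall k, Ck k [set: V] g.

Section Torus.
Variable R : realType.

Definition lattice_eq (p q : plane R) : bool :=
  `[< exists m n : int, p = q + (m%:~R, n%:~R) >].

Let lattice_eq_refl : reflexive lattice_eq.
Proof.
move=> p; apply/asboolP; exists 0, 0.
by case: p => x y; congr pair; rewrite /= addr0.
Qed.

Let lattice_eq_sym : symmetric lattice_eq.
Proof.
have H p q : lattice_eq p q -> lattice_eq q p.
  move=> /asboolP [m [n ->]]; apply/asboolP; exists (- m), (- n).
  by case: q => x y; congr pair; rewrite /= mulrNz addrK.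
by move=> p q; apply/idP/idP; exact: H.
Qed.

Let lattice_eq_trans : transitive lattice_eq.
Proof.
move=> q p r /asboolP [m [n ->]] /asboolP [m' [n' ->]].
apply/asboolP; exists (m' + m), (n' + n).
by case: r => x y; congr pair; rewrite /= mulrzDr addrA.
Qed.

Canonical lattice_equiv :=
  EquivRel lattice_eq lattice_eq_refl lattice_eq_sym lattice_eq_trans.

Definition torus_quot := {eq_quot lattice_equiv}.

(* The torus R^2/Z^2 with the quotient topology. *)
Definition torus := quotient_topology torus_quot.
HB.instance Definition _ := Topological.on torus.
HB.instance Definition _ := Quotient.on torus.

Definition torus_pi (p : plane R) : torus := \pi_torus p.

(* torus_pi being a local diffeomorphism, f is of class C^k iff F is. *)
Definition is_lift (f : torus -> torus) (F : plane R -> plane R) : Prop :=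
  continuous F /\ forall p, torus_pi (F p) = f (torus_pi p).

(* Df^n(x) read in the trivialization of the tangent bundle given by
   torus_pi, for f with lift F.  It does not depend on the chosen lift, nor on
   the chosen representative of x. *)
Definition tangent_iter (F : plane R -> plane R) (n : nat) (x : torus) :
  plane R -> plane R := 'd (iter n F) (repr x).

Definition mat_act (A : 'M[int]_2) (p : plane R) : plane R :=
  ((A 0 0)%:~R * p.1 + (A 0 1)%:~R * p.2,
   (A 1 0)%:~R * p.1 + (A 1 1)%:~R * p.2).

Definition toral_endo (A : 'M[int]_2) (x : torus) : torus :=
  torus_pi (mat_act A (repr x)).

Definition homotopic (f g : torus -> torus) : Prop :=
  exists H : torus * R -> torus,
    [/\ {within [set z | z.2 \in `[0, 1]], continuous H},
        forall x, H (x, 0) = f x & forall x, H (x, 1) = g x].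

Definition is_linearization (f : torus -> torus) (A : 'M[int]_2) : Prop :=
  homotopic f (toral_endo A).

(* An eigenvalue of A of modulus different from the modulus of the other one is
   real, so the real eigenvalues suffice. *)
Definition lambda_u (A : 'M[int]_2) : R :=
  ln `|xget 0 [set mu : R | eigenvalue (map_mx intr A) mu /\ 1 < `|mu|]|.

Definition lambda_s (A : 'M[int]_2) : R :=
  ln `|xget 0 [set mu : R | eigenvalue (map_mx intr A) mu /\ `|mu| < 1]|.

End Torus.

(* Hyperbolicity of a self-map f of X whose tangent spaces are identified with
   the plane; Df n x is the derivative of the n-th iterate of f at x.  It is
   used for f on the torus and for its lift on the plane. *)
Section Hyperbolicity.
Variables (R : realType) (X : Type) (f : X -> X).
Variable Df : nat -> X -> plane R -> plane R.

Definition full_orbit (x : int -> X) : Prop := forall i, f (x i) = x (i + 1).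

Definition is_line (E : set (plane R)) : Prop :=
  exists2 e, e != 0 & E = [set a *: e | a in [set: R]].

Definition direct_sum (E1 E2 : set (plane R)) : Prop :=
  (forall v, exists v1 v2, [/\ E1 v1, E2 v2 & v = v1 + v2]) /\
  E1 `&` E2 = [set 0].

Definition hyperbolic_splitting (x : int -> X) (Eu Es : int -> set (plane R)) :
  Prop :=
  [/\ forall i, [/\ is_line (Eu i), is_line (Es i) & direct_sum (Eu i) (Es i)],
      forall i, Df 1 (x i) @` Eu i = Eu (i + 1) /\
                Df 1 (x i) @` Es i = Es (i + 1) &
      exists c lam : R, [/\ 0 < c, 1 < lam &
        forall (n : nat) (i : int),
          (forall v, Eu i v -> c^-1 * lam ^+ n * enorm v <= enorm (Df n (x i) v)) /\
          (forall v, Es i v -> enorm (Df n (x i) v) <= c * lam ^- n * enorm v)]].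

Definition unstable_dir (p : X) : set (plane R) :=
  [set v | exists x Eu Es, [/\ full_orbit x, x 0 = p,
                               hyperbolic_splitting x Eu Es & Eu 0 v]].

Definition stable_dir (p : X) : set (plane R) :=
  [set v | exists x Eu Es, [/\ full_orbit x, x 0 = p,
                               hyperbolic_splitting x Eu Es & Es 0 v]].

(* l is the exponent at p of the vectors of E p. *)
Definition lyapunov_exponent (E : X -> set (plane R)) (p : X) (l : R) : Prop :=
  (exists2 v, E p v & v != 0) /\
  (forall v, E p v -> v != 0 ->
     (fun n : nat => ln (enorm (Df n p v)) / n%:R) @ \oo --> l).

End Hyperbolicity.

Section Anosov.
Variable R : realType.
Implicit Types F : plane R -> plane R.

Definition local_C1_diffeo F : Prop :=
  Ck 1 [set: plane R] F /\
  forall p, exists U (G : plane R -> plane R),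
    [/\ open U, U p, open (F @` U), Ck 1 (F @` U) G &
        forall q, U q -> G (F q) = q].

(* torus_pi being a local diffeomorphism, f is a local C^1 diffeomorphism iff
   its lift F is. *)
Definition anosov (f : torus R -> torus R) F : Prop :=
  local_C1_diffeo F /\
  forall x, full_orbit f x ->
    exists Eu Es, hyperbolic_splitting (tangent_iter F) x Eu Es.

Definition plane_iter F (n : nat) (p : plane R) : plane R -> plane R :=
  'd (iter n F) p.

End Anosov.

Section Foliation.
Variable R : realType.

(* An embedded compact C^1 arc, the image of [0, 1]; the values of the
   parametrization outside [0, 1] are irrelevant. *)
Record arc := Arc {
  arc_fun :> R -> plane R;
  arc_C1 : Ck 1 [set: R] arc_fun;
  arc_inj : {in `[0, 1] &, injective arc_fun};
  arc_reg : forall t, t \in `[0, 1] -> 'D_1 arc_fun t != 0 }.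

Definition arc_set (a : arc) : set (plane R) := a @` `[0, 1].

Lemma measurable_plane_curve (g : R -> plane R) :
  continuous g -> measurable_fun [set: R] g.
Proof.
move=> cg; apply/measurable_fun_pairP.
split; apply: (open_continuous_measurable_fun openT) => t _.
  by apply: continuous_comp; [exact: cg|exact: cvg_fst].
by apply: continuous_comp; [exact: cg|exact: cvg_snd].
Qed.

Lemma measurable_arc (a : arc) : measurable_fun [set: R] a.
Proof.
apply: measurable_plane_curve => t; apply: differentiable_continuous.
by have [da _] := arc_C1 a; exact: da.
Qed.

Lemma measurable_speed (a : arc) :
  measurable_fun [set: R] (fun t => enorm ('D_1 a t)).
Proof.
have [_ ca] := arc_C1 a.
have /measurable_fun_pairP[m1 m2] : measurable_fun [set: R] ('D_1 a : R -> plane R).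
  by apply: measurable_plane_curve => t; exact: ca.
apply: (measurableT_comp (f := @Num.sqrt R)).
  by apply: (open_continuous_measurable_fun openT) => t _; exact: sqrt_continuous.
by apply: measurable_funD; apply: measurable_funX.
Qed.

Section ArcLength.
Variable a : arc.

Definition arc_length (S : set (plane R)) : \bar R :=
  (\int[lebesgue_measure]_(t in `[0%R, 1%R] `&` a @^-1` S)
     (enorm ('D_1 a t))%:E)%E.

Let arc_length0 : arc_length set0 = 0%E.
Proof. by rewrite /arc_length preimage_set0 setI0 integral_set0. Qed.

Let arc_length_ge0 S : (0 <= arc_length S)%E.
Proof. by apply: integral_ge0 => t _; rewrite lee_fin sqrtr_ge0. Qed.

Let arc_length_sigma_additive : semi_sigma_additive arc_length.
Proof.
move=> S mS tS mUS; rewrite /arc_length preimage_bigcup setI_bigcupr.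
have mT i : measurable (`[0%R, 1%R]%classic `&` a @^-1` S i).
  apply: measurableI => //; rewrite -[X in measurable X]setTI.
  exact: measurable_arc.
rewrite ge0_integral_bigcup//=.
- by apply: is_cvg_ereal_nneg_natsum_cond => n _ _; exact: arc_length_ge0.
- by apply: measurable_funTS; apply/measurable_EFinP; exact: measurable_speed.
- by move=> t _; rewrite lee_fin sqrtr_ge0.
- apply: trivIset_setIl; apply/trivIsetP => i j _ _ ij.
  move/trivIsetP : tS => /(_ i j I I ij) Sij.
  by rewrite -preimage_setI Sij preimage_set0.
Qed.

HB.instance Definition _ := isMeasure.Build _ _ _ arc_length
  arc_length0 arc_length_ge0 arc_length_sigma_additive.

(* The total length is positive and finite, so the default is not used. *)
Definition normalized_length : probability (plane R) R :=
  mnormalize arc_length (dirac (a 0)).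

End ArcLength.

Definition plaque (W : plane R -> set (plane R)) (B : set (plane R))
  (p : plane R) : set (plane R) := connected_component (W p `&` B) p.

(* The local leaves of a box are compact arcs.  A continuous injection of the
   compact unit square is a homeomorphism onto its image. *)
Definition foliated_box (W : plane R -> set (plane R)) (B : set (plane R)) :
  Prop :=
  exists h : R * R -> plane R,
    let sq : set (R * R) := `[0, 1] `*` `[0, 1] in
    [/\ {within sq, continuous h}, {in sq &, injective h}, B = h @` sq &
        forall y, y \in `[0, 1] -> exists a : arc,
          arc_set a = h @` (`[0, 1] `*` [set y]) /\
          forall p, arc_set a p -> plaque W B p = arc_set a].

Record foliation := Foliation {
  leaf :> plane R -> set (plane R);
  leaf_refl : forall p, leaf p p;
  leaf_eq : forall p q, leaf p q -> leaf q = leaf p;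
  leaf_arc : forall p q, leaf p q -> p != q ->
    exists a : arc, [/\ arc_set a `<=` leaf p, a 0 = p & a 1 = q];
  leaf_box : forall p, exists2 B : set (plane R), B^° p & foliated_box leaf B }.

Definition tangent_foliation (W : foliation) (E : plane R -> set (plane R)) :
  Prop :=
  forall (p : plane R) (a : arc), arc_set a `<=` W p ->
    forall t, t \in `[0, 1] -> E (a t) ('D_1 a t).

Definition density_between (C : R) (mu nu : set (plane R) -> \bar R) : Prop :=
  exists g : plane R -> R,
    [/\ measurable_fun [set: plane R] g,
        forall S, measurable S -> mu S = (\int[nu]_(p in S) (g p)%:E)%E &
        {ae nu, forall p, C^-1 <= g p <= C}].

(* F^k(W) is again an arc b. *)
Definition quasi_preserves_densities (F : plane R -> plane R) (W : foliation) :
  Prop :=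
  (forall p, F @` W p = W (F p)) /\
  exists C : R, 1 < C /\
    forall (p : plane R) (a : arc), arc_set a `<=` W p ->
    forall (k : nat) (b : arc), arc_set b = iter k F @` arc_set a ->
      density_between C (normalized_length b)
        (pushforward (normalized_length a) (iter k F)).

Definition area (S : set (plane R)) : \bar R :=
  (@lebesgue_measure R \x @lebesgue_measure R)%E
    (S : set (measurableTypeR R * measurableTypeR R)).

Let area0 : area set0 = 0%E. Proof. exact: measure0. Qed.

Let area_ge0 S : (0 <= area S)%E. Proof. exact: measure_ge0. Qed.

Let area_sigma_additive : semi_sigma_additive area.
Proof.
exact: (@measure_semi_sigma_additive _ _ _
  (@lebesgue_measure R \x @lebesgue_measure R)%E).
Qed.

HB.instance Definition _ := isMeasure.Build _ _ _ area
  area0 area_ge0 area_sigma_additive.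

(* m p is the conditional measure on the local leaf of p in B.  The identity of
   the last clause is that of the disintegration of area( . \cap B) / area(B),
   multiplied by area(B). *)
Definition disintegration (W : foliation) (B : set (plane R))
    (m : R.-pker (plane R) ~> (plane R)) : Prop :=
  [/\ forall p q, B p -> plaque W B p q -> m q = m p :> (_ -> _),
      forall p, B p -> m p (plaque W B p) = 1%E &
      forall S, measurable S -> area (S `&` B) = (\int[area]_(p in B) m p S)%E].

Definition UBD (W : foliation) : Prop :=
  exists C : R, 1 < C /\
    forall B, foliated_box W B ->
      exists m : R.-pker (plane R) ~> (plane R), disintegration W B m /\
        {ae area, forall p, B p -> forall a : arc, arc_set a = plaque W B p ->
           density_between C (m p) (normalized_length a)}.

End Foliation.

(* The hyperbolic splitting being uniquely integrable, these determine W. *)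
Definition stable_foliation (R : realType) (F : plane R -> plane R)
    (W : foliation R) : Prop :=
  tangent_foliation W (stable_dir F (plane_iter F)).

Definition unstable_foliation (R : realType) (F : plane R -> plane R)
    (W : foliation R) : Prop :=
  tangent_foliation W (unstable_dir F (plane_iter F)).

(* Main.v *)
(* Let J k be the norm of the derivative of F^k on the stable or the unstable
   direction at a given point.  Quasi preservation of densities makes the norm
   of the derivative of F^k on the tangent lines of an arc of a leaf constant up
   to a factor that depends neither on k nor on the arc.  Hence the image of
   the arc by F^k, followed at speed 1 / J k, is a curve of bounded speed,
   uniformly transversal to a line field of the plane.  By a
   Poincare-Bendixson argument such a curve never comes back close to itself,
   so that its length is at most a constant times the area of a rectangle
   containing it.

   F stays at bounded distance from A.  So, if A has eigenvalues
   |mu| > 1 > |ms| > 0, the extents of the image by F^k of an arc, measured by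
   the left eigenvectors of A, are those of the arc multiplied by |mu|^k and
   |ms|^k, up to bounded errors.  Comparing them with the lengths gives
   J k ~ |mu|^k on the unstable direction and J k ~ |ms|^k on the stable one;
   there one uses arcs of length L / J k, which exist because an interior point
   of a foliated box cannot lie on an end of its plaque.  If A had no eigenvalue
   of modulus less than 1, then the preimages by F^k of stable arcs would have
   extents that grow polynomially with k, but exponentially large lengths.

   The constants of a hyperbolic splitting may depend on the orbit.  As no
   nonzero tangent vector is bounded along a full orbit, a compactness argument
   makes them uniform, and gives the continuity of the stable direction. *)
Require Import Defs.
From HB Require Import structures.
From mathcomp Require Import all_boot all_order all_algebra.
From mathcomp Require Import all_classical all_reals all_analysis.
From mathcomp Require Import measurable_realfun.
From mathcomp Require Import zify lra ring.

Set Implicit Arguments.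
Unset Strict Implicit.
Unset Printing Implicit Defensive.
Import Order.TTheory GRing.Theory Num.Theory.
Import numFieldNormedType.Exports.
Local Open Scope classical_set_scope.
Local Open Scope ring_scope.

(** * Plane geometry and continuous angles *)

(** The unstable direction of the lift need not be Z^2-periodic, so compactness gives it no uniform
    continuity. The only field used is therefore the stable one: it depends on the future alone and
    descends to the torus. Unstable leaves are compared with it, stable leaves with its normal.

    On the plane a line field has a single-valued angle. Along a transversal loop the tangent stays
    within an open half-turn of the field, so it cannot make the full turn that a simple loop
    requires. Curves that nearly return are excluded as well, by subtracting a slow drift that
    closes them; positions at integer times are then separated, and counting them by area bounds the
    length by a product of the two extents.

    On stable leaves all later images stay bounded, which bounds the extent along the expanding
    eigenvector by a constant independent of everything else. A large enough length [L] must then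
    show up in the contracting extent and exceed the error made in comparing [F] with [A]; this is
    how [L] is fixed. *)

Section ContinuityCalculus.
Context {R : realType} {T : topologicalType}.
Implicit Types f g : T -> R.

Lemma cont_cst {U : topologicalType} (c : U) : continuous (fun _ : T => c).
Proof. by move=> x; exact: cvg_cst. Qed.

Lemma cont_id : continuous (fun x : T => x).
Proof. by move=> x; exact: cvg_id. Qed.

Lemma cont_comp {U V : topologicalType} (f : U -> V) (g : T -> U) :
  continuous f -> continuous g -> continuous (fun x => f (g x)).
Proof. by move=> cf cg x; apply: continuous_comp; [exact: cg|exact: cf]. Qed.

Lemma cont_pair {U V : topologicalType} (f : T -> U) (g : T -> V) :
  continuous f -> continuous g -> continuous (fun x => (f x, g x)).
Proof. by move=> cf cg x; apply: cvg_pair; [exact: cf|exact: cg]. Qed.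

Lemma cont_fst {U V : topologicalType} (f : T -> U * V) :
  continuous f -> continuous (fun x => (f x).1).
Proof. by move=> cf; apply: (cont_comp _ cf) => x; exact: cvg_fst. Qed.

Lemma cont_snd {U V : topologicalType} (f : T -> U * V) :
  continuous f -> continuous (fun x => (f x).2).
Proof. by move=> cf; apply: (cont_comp _ cf) => x; exact: cvg_snd. Qed.

Lemma cont_add {V : normedModType R} (f g : T -> V) :
  continuous f -> continuous g -> continuous (fun x => f x + g x).
Proof. by move=> cf cg x; apply: continuousD; [exact: cf|exact: cg]. Qed.

Lemma cont_opp {V : normedModType R} (f : T -> V) :
  continuous f -> continuous (fun x => - f x).
Proof. by move=> cf x; apply: continuousN; exact: cf. Qed.

Lemma cont_mul f g :
  continuous f -> continuous g -> continuous (fun x => f x * g x).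
Proof. by move=> cf cg x; apply: continuousM; [exact: cf|exact: cg]. Qed.

Lemma cont_scale {V : normedModType R} f (g : T -> V) :
  continuous f -> continuous g -> continuous (fun x => f x *: g x).
Proof. by move=> cf cg x; apply: cvgZ; [exact: cf|exact: cg]. Qed.

Lemma cont_norm {V : normedModType R} (g : T -> V) :
  continuous g -> continuous (fun x => `|g x|).
Proof. by move=> cg; apply: (cont_comp _ cg); exact: norm_continuous. Qed.

Lemma cont_exp f n : continuous f -> continuous (fun x => f x ^+ n).
Proof.
move=> cf; elim: n => [|n IH]; first exact: cont_cst.
rewrite [X in continuous X](_ : _ = fun x => f x * f x ^+ n); last first.
  by apply/funext => x; rewrite exprS.
exact: cont_mul.
Qed.

Lemma cont_inv f : (forall x, f x != 0) -> continuous f ->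
  continuous (fun x => (f x)^-1).
Proof. by move=> f0 cf x; apply: continuousV; [exact: f0|exact: cf]. Qed.

Lemma cont_sqrt f : continuous f -> continuous (fun x => Num.sqrt (f x)).
Proof. by move=> cf; apply: (cont_comp _ cf); exact: sqrt_continuous. Qed.

Lemma cont_cos f : continuous f -> continuous (fun x => cos (f x)).
Proof. by move=> cf; apply: (cont_comp _ cf); exact: continuous_cos. Qed.

Lemma cont_sin f : continuous f -> continuous (fun x => sin (f x)).
Proof. by move=> cf; apply: (cont_comp _ cf); exact: continuous_sin. Qed.

Lemma cont_atan f : continuous f -> continuous (fun x => atan (f x)).
Proof. by move=> cf; apply: (cont_comp _ cf); exact: continuous_atan. Qed.

End ContinuityCalculus.

Ltac cont :=
  repeat match goal with
  | |- continuous (fun x => (@?f x, @?g x)) => apply: cont_pair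
  | |- continuous (fun x => (@?f x).1) => apply: cont_fst
  | |- continuous (fun x => (@?f x).2) => apply: cont_snd
  | |- continuous (fun x => - (@?f x)) => apply: cont_opp
  | |- continuous (fun x => @?f x + @?g x) => apply: cont_add
  | |- continuous (fun x => @?f x *: @?g x) => apply: cont_scale
  | |- continuous (fun x => @?f x * @?g x) => apply: cont_mul
  | |- continuous (fun x => (@?f x) ^+ _) => apply: cont_exp
  | |- continuous (fun x => `|@?f x|) => apply: cont_norm
  | |- continuous (fun x => cos (@?f x)) => apply: cont_cos
  | |- continuous (fun x => sin (@?f x)) => apply: cont_sin
  | |- continuous (pair ?a) =>
      let x := fresh in move=> x; exact: cvg_pair (cvg_cst a) cvg_id
  | |- continuous -%R => let x := fresh in move=> x; apply: oppr_continuous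
  | |- continuous (GRing.add ?a) =>
      let x := fresh in move=> x; exact: cvgD (cvg_cst a) cvg_id
  | |- continuous (GRing.mul ?a) => 
      let x := fresh in move=> x; exact: cvgM (cvg_cst a) cvg_id
  | |- continuous fst => exact: cont_fst cont_id
  | |- continuous snd => exact: cont_snd cont_id
  | |- continuous (fun x => x) => exact: cont_id
  | |- continuous (fun x => ?c) => exact: cont_cst
  | |- continuous _ => assumption
  end.

Section PlaneAlgebra.
Variable R : realType.
Implicit Types p q v w : plane R.

Definition det2 v w : R := v.1 * w.2 - v.2 * w.1.
Definition dot2 v w : R := v.1 * w.1 + v.2 * w.2.
Definition cis (t : R) : plane R := (cos t, sin t).

Lemma plane_eq p q : p.1 = q.1 -> p.2 = q.2 -> p = q.
Proof. by case: p q => [a b] [c d] /= -> ->. Qed.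

Let plane_add1 v w : (v + w).1 = v.1 + w.1. Proof. by []. Qed.
Let plane_add2 v w : (v + w).2 = v.2 + w.2. Proof. by []. Qed.
Let plane_opp1 v : (- v).1 = - v.1. Proof. by []. Qed.
Let plane_opp2 v : (- v).2 = - v.2. Proof. by []. Qed.
Let plane_scale1 (a : R) v : (a *: v).1 = a * v.1. Proof. by []. Qed.
Let plane_scale2 (a : R) v : (a *: v).2 = a * v.2. Proof. by []. Qed.
Let plane_01 : (0 : plane R).1 = 0. Proof. by []. Qed.
Let plane_02 : (0 : plane R).2 = 0. Proof. by []. Qed.
Definition planeE := (plane_add1, plane_add2, plane_opp1, plane_opp2,
  plane_scale1, plane_scale2, plane_01, plane_02).

Lemma sq_enorm v : enorm v ^+ 2 = v.1 ^+ 2 + v.2 ^+ 2.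
Proof. by rewrite /enorm sqr_sqrtr// addr_ge0// sqr_ge0. Qed.

Lemma enorm_ge0 v : 0 <= enorm v.
Proof. exact: sqrtr_ge0. Qed.

Lemma enorm_eq0 v : (enorm v == 0) = (v == 0).
Proof.
apply/idP/idP => [/eqP e0|/eqP ->]; last first.
  by rewrite /enorm /= expr0n /= addr0 sqrtr0.
have := sq_enorm v; rewrite e0 expr0n /= => /esym/eqP.
rewrite paddr_eq0 ?sqr_ge0// !sqrf_eq0 => /andP[/eqP a /eqP b].
by apply/eqP/plane_eq.
Qed.

Lemma enorm0 : enorm (0 : plane R) = 0.
Proof. by apply/eqP; rewrite enorm_eq0. Qed.

Lemma enorm_gt0 v : (0 < enorm v) = (v != 0).
Proof. by rewrite lt0r enorm_ge0 andbT enorm_eq0. Qed.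

Lemma enormZ a v : enorm (a *: v) = `|a| * enorm v.
Proof.
rewrite /enorm /= -sqrtr_sqr -sqrtrM ?sqr_ge0//; congr Num.sqrt.
by rewrite mulrDr !exprMn.
Qed.

Lemma enormN v : enorm (- v) = enorm v.
Proof. by rewrite /enorm /= !sqrrN. Qed.

Lemma lagrange v w :
  dot2 v w ^+ 2 + det2 v w ^+ 2 = enorm v ^+ 2 * enorm w ^+ 2.
Proof. by rewrite !sq_enorm /dot2 /det2; ring. Qed.

Lemma le_det2 v w : `|det2 v w| <= enorm v * enorm w.
Proof.
rewrite -(@ler_pXn2r _ 2)// ?nnegrE ?mulr_ge0 ?enorm_ge0//.
rewrite real_normK ?num_real// exprMn -lagrange; have := sqr_ge0 (dot2 v w); lra.
Qed.

Lemma le_dot2 v w : `|dot2 v w| <= enorm v * enorm w.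
Proof.
rewrite -(@ler_pXn2r _ 2)// ?nnegrE ?mulr_ge0 ?enorm_ge0//.
rewrite real_normK ?num_real// exprMn -lagrange; have := sqr_ge0 (det2 v w); lra.
Qed.

Lemma enormD v w : enorm (v + w) <= enorm v + enorm w.
Proof.
rewrite -(@ler_pXn2r _ 2)// ?nnegrE ?addr_ge0 ?enorm_ge0//.
have -> : enorm (v + w) ^+ 2 = enorm v ^+ 2 + enorm w ^+ 2 + 2 * dot2 v w.
  by rewrite !sq_enorm /dot2 /=; ring.
have := le_trans (ler_norm _) (le_dot2 v w).
by rewrite sqrrD; lra.
Qed.

Lemma enormB v w : enorm v - enorm w <= enorm (v - w).
Proof. by have := enormD (v - w) w; rewrite subrK; lra. Qed.

Lemma enormBC v w : enorm (v - w) = enorm (w - v).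
Proof. by rewrite -enormN opprB. Qed.

Lemma le_fst_enorm v : `|v.1| <= enorm v.
Proof.
rewrite -(@ler_pXn2r _ 2)// ?nnegrE ?enorm_ge0// real_normK ?num_real// sq_enorm.
by have := sqr_ge0 v.2; lra.
Qed.

Lemma le_snd_enorm v : `|v.2| <= enorm v.
Proof.
rewrite -(@ler_pXn2r _ 2)// ?nnegrE ?enorm_ge0// real_normK ?num_real// sq_enorm.
by have := sqr_ge0 v.1; lra.
Qed.

Lemma norm_plane v : `|v| = Num.max `|v.1| `|v.2|.
Proof. by []. Qed.

Lemma norm_plane_le v r : (`|v| <= r) = (`|v.1| <= r) && (`|v.2| <= r).
Proof. by rewrite norm_plane ge_max. Qed.

Lemma norm_le_enorm v : `|v| <= enorm v.
Proof. by rewrite norm_plane_le le_fst_enorm le_snd_enorm. Qed.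

Lemma enorm_le_l1 v : enorm v <= `|v.1| + `|v.2|.
Proof.
rewrite -(@ler_pXn2r _ 2)// ?nnegrE ?enorm_ge0 ?addr_ge0// sq_enorm.
rewrite sqrrD !real_normK ?num_real//.
have := mulr_ge0 (normr_ge0 v.1) (normr_ge0 v.2); lra.
Qed.

Lemma enorm_le_norm v : enorm v <= 2 * `|v|.
Proof.
have := enorm_le_l1 v; have := lexx `|v|; rewrite {1}norm_plane_le => /andP[]; lra.
Qed.

Lemma cont_enorm (T : topologicalType) (f : T -> plane R) :
  continuous f -> continuous (fun x => enorm (f x)).
Proof. by move=> cf; rewrite /enorm; apply: cont_sqrt; cont. Qed.

Lemma cont_det2 (T : topologicalType) (f g : T -> plane R) :
  continuous f -> continuous g -> continuous (fun x => det2 (f x) (g x)).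
Proof. by move=> cf cg; rewrite /det2; cont. Qed.

Lemma cont_dot2 (T : topologicalType) (f g : T -> plane R) :
  continuous f -> continuous g -> continuous (fun x => dot2 (f x) (g x)).
Proof. by move=> cf cg; rewrite /dot2; cont. Qed.

Lemma unit_cis v : enorm v = 1 -> exists t, v = cis t.
Proof.
move=> v1; have := sq_enorm v; rewrite v1 expr1n => /esym s1.
have x1 : -1 <= v.1 <= 1.
  by rewrite -ler_norml -v1 le_fst_enorm.
have s2 : sin (acos v.1) = `|v.2|.
  rewrite sin_acos// (_ : 1 - v.1 ^+ 2 = v.2 ^+ 2) ?sqrtr_sqr//; lra.
have cc : cos (acos v.1) = v.1 by rewrite acosK// in_itv.
have [v0|v0] := leP 0 v.2.
  by exists (acos v.1); apply: plane_eq; rewrite /= ?cc// s2 ger0_norm.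
exists (- acos v.1); apply: plane_eq; rewrite /= ?cosN ?sinN ?cc//.
by rewrite s2 ltr0_norm// opprK.
Qed.

(** For unit vectors at an acute angle, [atan] of sine over cosine is the oriented angle between
    them. It depends continuously on both, so that angles can be accumulated step by step. *)
Lemma cis_step t v w : enorm v = 1 -> enorm w = 1 -> 0 < dot2 v w ->
  v = cis t -> w = cis (t + atan (det2 v w / dot2 v w)).
Proof.
move=> v1 w1 d0 vE.
have lg : dot2 v w ^+ 2 + det2 v w ^+ 2 = 1 by rewrite lagrange v1 w1; ring.
set a := atan _.
have cE : cos a = dot2 v w.
  rewrite cos_atan (_ : 1 + _ = (dot2 v w)^-1 ^+ 2); last first.
    transitivity ((dot2 v w ^+ 2 + det2 v w ^+ 2) / dot2 v w ^+ 2).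
      by field; rewrite gt_eqF.
    by rewrite lg div1r exprVn.
  by rewrite sqrtr_sqr ger0_norm ?invr_ge0 ?ltW// invrK.
have sE : sin a = det2 v w.
  have : tan a = det2 v w / dot2 v w by rewrite atanK.
  rewrite /tan cE => /(congr1 (fun z => z * dot2 v w)).
  by rewrite !divfK// gt_eqF.
have v1' : v.1 ^+ 2 + v.2 ^+ 2 = 1 by rewrite -sq_enorm v1 expr1n.
rewrite /cis cosD sinD cE sE.
have -> : cos t = v.1 by rewrite vE.
have -> : sin t = v.2 by rewrite vE.
apply: plane_eq; rewrite /dot2 /det2 /=.
  by rewrite -[LHS]mul1r -v1'; ring.
by rewrite -[LHS]mul1r -v1'; ring.
Qed.

End PlaneAlgebra.

Section Angles.
Variable R : realType.
Implicit Types (f g : R -> R) (p : plane R).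

Lemma continuous_IVT f a b v : continuous f -> a <= b ->
  f a <= v <= f b \/ f b <= v <= f a -> exists2 c, a <= c <= b & f c = v.
Proof.
move=> cf ab fv.
have [||c] := @IVT R f a b v ab.
- exact: continuous_subspaceT.
- by rewrite ge_min le_max; case: fv => /andP[-> ->]; rewrite ?orbT.
- by rewrite in_itv /=; exists c.
Qed.

Lemma cos_lt1 (x : R) : 0 < x <= pi -> cos x < 1.
Proof.
move=> /andP[x0 xpi].
have : 0 < sin (x / 2) by apply: sin_gt0_pi; have := pi_gt0 R; lra.
have := cos2Dsin2 (x / 2); have := cosD (x / 2) (x / 2).
rewrite -splitr => -> e s0; have := exprn_gt0 2 s0; move: e.
by rewrite -!expr2; lra.
Qed.

(** The hypothesis confines [g] to a discrete set, and a continuous function cannot jump.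
    Integrality of winding numbers is always used in this form. *)
Lemma const_angle g a b : a <= b -> continuous g ->
  (forall t, a <= t <= b -> cos (g t - g a) = 1) -> g b = g a.
Proof.
move=> ab cg H; have p0 := pi_gt0 R.
have key f : continuous f -> (forall t, a <= t <= b -> cos (f t - f a) = 1) ->
    ~ f a < f b.
  move=> cf Hf fab.
  (* The cut at pi makes [v] differ from [f a] by an amount in ]0, pi], where the cosine is less
     than 1. *)
  pose v := f a + Num.min (f b - f a) pi.
  have [|c ca cv] := @continuous_IVT f a b v cf ab.
    left; rewrite /v; case: (leP (f b - f a) pi); lra.
  have := Hf _ ca; rewrite cv /v addrAC subrr add0r => /eqP.
  rewrite lt_eqF// cos_lt1//; case: (leP (f b - f a) pi); lra.
apply/eqP; rewrite eq_le !leNgt; apply/andP; split; apply/negP; first exact: (key g).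
move=> gab; apply: (key (fun t => - g t)); last by rewrite ltrN2.
- by cont.
- by move=> t /H; rewrite -cosN opprB opprK addrC.
Qed.

(** A variation of pi or more would pass through [g a + pi] or [g a - pi], where the sine has the
    opposite sign. *)
Lemma half_turn g a b : a <= b -> continuous g ->
  (forall t, a <= t <= b -> 0 < sin (g t)) -> `|g b - g a| < pi.
Proof.
move=> ab cg H; have p0 := pi_gt0 R.
have key f (s : R) : continuous f -> (forall t, a <= t <= b -> 0 < s * sin (f t)) ->
    f b - f a < pi.
  move=> cf Hf; rewrite ltNge; apply/negP => fab.
  have [|c ca cv] := @continuous_IVT f a b (f a + pi) cf ab; first by left; lra.
  have := Hf _ ca; rewrite cv sinDpi mulrN oppr_gt0 => h.
  by have := Hf a; rewrite lexx ab => /(_ isT); lra.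
rewrite ltr_norml; apply/andP; split; last first.
  by apply: (key g 1) => // t /H; rewrite mul1r.
rewrite ltrNl opprB; have := @key (fun t => - g t) (-1).
rewrite opprK addrC; apply; first by cont.
by move=> t /H; rewrite sinN mulN1r opprK.
Qed.

Lemma cisK (s t : R) : cis s = cis t -> cos (s - t) = 1.
Proof.
move=> [c s1]; rewrite cosB c s1 -!expr2; exact: cos2Dsin2.
Qed.

Lemma cisN (s t : R) : cis s = - cis t -> cos (s - t) = -1.
Proof.
move=> [c s1]; rewrite cosB c s1 !mulNr -opprD -!expr2.
by rewrite cos2Dsin2.
Qed.

Lemma enorm_cis (t : R) : enorm (cis t) = 1.
Proof. by rewrite /enorm /= cos2Dsin2 sqrtr1. Qed.

Lemma det2_cis (s t : R) : det2 (cis s) (cis t) = sin (t - s).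
Proof. by rewrite /det2 sinB /=; ring. Qed.

(** Truncation to [-r, r] for [r >= 0], written with absolute values so that continuity is
    immediate. It extends data known on a square to the whole plane. *)
Definition clamp (r x : R) : R := (`|x + r| - `|x - r|) / 2.
Definition clamp2 r p : plane R := (clamp r p.1, clamp r p.2).

Lemma clamp_le r x : 0 <= r -> `|clamp r x| <= r.
Proof.
move=> r0; rewrite /clamp normrM [`|2^-1|]ger0_norm ?invr_ge0// ler_pdivrMr//.
apply: (le_trans (ler_dist_dist _ _)).
by rewrite (_ : _ - _ = r * 2) ?ger0_norm ?mulr_ge0//; ring.
Qed.

Lemma clamp_id r x : `|x| <= r -> clamp r x = x.
Proof.
rewrite ler_norml => /andP[h1 h2].
by rewrite /clamp ger0_norm ?[`|x - r|]ler0_norm; lra.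
Qed.

Lemma clamp2_le r p : 0 <= r -> `|clamp2 r p| <= r.
Proof. by move=> r0; rewrite norm_plane_le !clamp_le. Qed.

Lemma clamp2_id r p : `|p| <= r -> clamp2 r p = p.
Proof.
by rewrite norm_plane_le => /andP[? ?]; apply: plane_eq; rewrite /= clamp_id.
Qed.

Lemma cont_clamp2 r : continuous (clamp2 r).
Proof.
rewrite /clamp2 /clamp.
by cont.
Qed.

End Angles.

Section Heine.
Variable R : realType.

(** Only [x] is confined to [K]; [y] may lie outside. This is what allows a periodic map to be
    controlled from one fundamental square. *)
Lemma heine (X Y : normedModType R) (f : X -> Y) (K : set X) : compact K ->
  (forall x, K x -> {for x, continuous f}) -> forall e, 0 < e ->
  exists2 d, 0 < d & forall x y, K x -> `|x - y| < d -> `|f x - f y| < e.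
Proof.
move=> cK cf e e0.
have /compact_near_coveringP cov := cK.
have [|d /= d0 H] := cov R (0^'+) (fun d x => forall y, `|x - y| < d -> `|f x - f y| < e).
  move=> x Kx.
  have e2 : 0 < e / 2 by rewrite divr_gt0.
  have /cvgrPdist_lt/(_ _ e2) := cf _ Kx.
  move=> /nbhs_ballP [r /= r0 br].
  exists (ball x (r / 2), [set d | d < r / 2]).
    split => /=; first by apply: nbhsx_ballx; rewrite divr_gt0.
    by apply: nbhs_right_lt; rewrite divr_gt0.
  move=> [x' d] /= [xx' dr] y xy.
  have h1 : `|f x - f x'| < e / 2.
    apply: br; rewrite -ball_normE /=; rewrite -ball_normE /= in xx'; lra.
  have h2 : `|f x - f y| < e / 2.
    apply: br; rewrite -ball_normE /=; rewrite -ball_normE /= in xx'.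
    have := ler_distD x' x y; lra.
  have := ler_distD (f x) (f x') (f y); rewrite (distrC (f x') (f x)); lra.
exists (d / 2); first by rewrite divr_gt0.
move=> x y Kx xy; apply: (H (d / 2)) => //=; last by rewrite divr_gt0.
by rewrite sub0r normrN gtr0_norm ?divr_gt0// ltr_pdivrMr// ltr_pMr// ltr1n.
Qed.

Lemma compact_square (r : R) : compact [set p : plane R | `|p| <= r].
Proof.
have cK := compact_setX (@segment_compact R (- r) r) (@segment_compact R (- r) r).
apply: (subclosed_compact _ cK).
  apply: (@closed_comp _ _ (fun p : plane R => `|p|) [set x | x <= r]).
    by move=> x _; exact: norm_continuous.
  exact: closed_le.
move=> p /=; rewrite norm_plane_le !ler_norml => /andP[h1 h2].
by split; rewrite /= in_itv.
Qed.

(* The angle from 0 to z is accumulated over the steps k z / N, each of which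
   turns by less than a right angle. *)
Lemma angle_lift (r : R) (G : plane R -> plane R) : 0 <= r -> continuous G ->
  (forall p, `|p| <= r -> G p != 0) ->
  exists2 th : plane R -> R, continuous th &
    forall p, `|p| <= r -> G p = enorm (G p) *: cis (th p).
Proof.
move=> r0 cG G0.
pose c := clamp2 r.
pose U p := (enorm (G (c p)))^-1 *: G (c p).
have Gc0 p : enorm (G (c p)) != 0 by rewrite enorm_eq0 G0// clamp2_le.
have cGc : continuous (fun p => G (c p)) by apply: cont_comp => //; exact: cont_clamp2.
have cU : continuous U.
  by apply: cont_scale => //; apply: cont_inv => //; apply: cont_enorm.
have U1 p : enorm (U p) = 1.
  by rewrite enormZ ger0_norm ?invr_ge0 ?enorm_ge0// mulVf.
(* When both coordinates differ by at most 1/2, the squared distance of the unit vectors is at most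
   1/2, and their inner product at least 3/4. *)
have [d d0 Hd] := @heine _ _ U _ (@compact_square r) (fun x _ => cU x) (2^-1) ltac:(by rewrite invr_gt0).
pose N := (Num.truncn (r / d)).+1.
have rN : r / N%:R < d.
  by rewrite ltr_pdivrMr ?ltr0n// mulrC -ltr_pdivrMr// truncnS_gt.
have close p q : `|p| <= r -> `|p - q| < d -> 0 < dot2 (U p) (U q).
  move=> pr pq; have := Hd p q pr pq; move=> /ltW.
  rewrite norm_plane_le => /andP[] /=; set a := U p; set b := U q => h1 h2.
  have := U1 p; have := U1 q; rewrite -/a -/b => ub ua.
  have := sq_enorm a; have := sq_enorm b; rewrite ua ub !expr1n => sb sa.
  have k1 : (a.1 - b.1) ^+ 2 <= 2^-1 ^+ 2.
    by rewrite -[leLHS]real_normK ?num_real// ler_pXn2r ?nnegrE// invr_ge0.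
  have k2 : (a.2 - b.2) ^+ 2 <= 2^-1 ^+ 2.
    by rewrite -[leLHS]real_normK ?num_real// ler_pXn2r ?nnegrE// invr_ge0.
  rewrite /dot2; move: k1 k2; rewrite !sqrrB; lra.
have step k : (k <= N)%N -> exists2 th : plane R -> R, continuous th &
    forall z, U ((k%:R / N%:R) *: c z) = cis (th z).
  elim: k => [_|k IH kN].
    have [t tE] := unit_cis (U1 0).
    exists (fun=> t); first by cont.
    by move=> z; rewrite mul0r scale0r.
  have [th cth thE] := IH (ltnW kN).
  pose a z := U ((k%:R / N%:R) *: c z); pose b z := U ((k.+1%:R / N%:R) *: c z).
  have ab z : 0 < dot2 (a z) (b z).
    apply: close.
      rewrite normrZ ger0_norm ?divr_ge0// -[leRHS]mul1r ler_pM ?divr_ge0//.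
        by rewrite ler_pdivrMr ?ltr0n// mul1r ler_nat ltnW.
      exact: clamp2_le.
    rewrite -scalerBl -mulrBl -opprB -natrB// subSnn mulNr scaleNr normrN normrZ.
    rewrite mul1r ger0_norm ?invr_ge0//; apply: le_lt_trans rN.
    by rewrite mulrC ler_pM// ?invr_ge0// clamp2_le.
  have ca k' : continuous (fun z => U ((k'%:R / N%:R) *: c z)).
    by apply: (cont_comp cU); apply: cont_scale; [cont|exact: cont_clamp2].
  exists (fun z => th z + atan (det2 (a z) (b z) / dot2 (a z) (b z))).
    apply: cont_add => //; apply: cont_atan; apply: (@cont_mul _ _ (fun z => det2 (a z) (b z))); first by apply: cont_det2; exact: ca.
    apply: cont_inv; first by move=> z; rewrite gt_eqF.
    by apply: cont_dot2; exact: ca.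
  by move=> z; exact: (cis_step (U1 _) (U1 _) (ab z) (thE z)).
have [th cth thE] := step N (leqnn N).
exists th => // p pr; have := thE p.
rewrite divff ?pnatr_eq0// scale1r /c clamp2_id// => <-.
by rewrite /U /c clamp2_id// scalerA divff ?scale1r// enorm_eq0 G0.
Qed.

End Heine.

(** * Curves transversal to a line field *)

Section Curves.
Variable R : realType.
Implicit Types (f : R -> R) (g : R -> plane R) (p q v w : plane R).

Lemma is_derive_continuous f f' : (forall t : R, is_derive t 1 f (f' t)) -> continuous f.
Proof.
move=> df t; apply: differentiable_continuous; apply/derivable1_diffP.
exact: (@ex_derive _ _ _ _ _ _ _ (df t)).
Qed.

Lemma mean_value f f' (a b : R) : (forall t : R, is_derive t 1 f (f' t)) -> a < b ->
  exists2 c, a < c < b & f b - f a = f' c * (b - a).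
Proof.
move=> df ab.
have [c] := MVT ab (fun t _ => df t) (continuous_subspaceT (is_derive_continuous df)).
by rewrite in_itv /=; exists c.
Qed.

Lemma mean_value_le f f' (a b : R) : (forall t : R, is_derive t 1 f (f' t)) -> a <= b ->
  exists2 c, a <= c <= b & f b - f a = f' c * (b - a).
Proof.
move=> df; rewrite le_eqVlt => /predU1P[<-|ab].
  by exists a; rewrite ?lexx// !subrr mulr0.
by have [c /andP[/ltW ? /ltW ?] ?] := mean_value df ab; exists c => //; apply/andP.
Qed.

(** The derivative is carried along as a function, and both are defined on the whole line: gluing
    and reparametrization then need no one-sided derivatives. *)
Definition C1curve g g' := continuous g' /\
  forall t : R, is_derive t 1 (fun x => (g x).1) (g' t).1 /\
            is_derive t 1 (fun x => (g x).2) (g' t).2.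

Lemma C1_cont g g' : C1curve g g' -> continuous g.
Proof.
move=> [_ dg].
rewrite (_ : g = fun x => ((g x).1, (g x).2)); last first.
  by apply/funext => x; case: (g x).
apply: cont_pair; apply: is_derive_continuous => t; first exact: (dg t).1.
exact: (dg t).2.
Qed.

(** The secant map, completed on the diagonal by the tangent. Its zeros off the diagonal are the
    double points of the curve. *)
Definition diffquo g g' (p : R * R) : plane R :=
  if p.1 == p.2 then g' p.1 else (p.2 - p.1)^-1 *: (g p.2 - g p.1).

Lemma diffquoM g g' a b : (b - a) *: diffquo g g' (a, b) = g b - g a.
Proof.
rewrite /diffquo /=; case: eqVneq => [->|ab]; first by rewrite !subrr scale0r.
by rewrite scalerA divff ?scale1r// subr_eq0 eq_sym.
Qed.

Lemma diffquo_diag g g' a : diffquo g g' (a, a) = g' a.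
Proof. by rewrite /diffquo eqxx. Qed.

(** At the diagonal, the mean value theorem in each coordinate turns the quotient into values of
    [g'] at intermediate parameters. *)
Lemma cont_diffquo g g' : C1curve g g' -> continuous (diffquo g g').
Proof.
move=> C [a b]; have cg := C1_cont C; case: C => cg' dg.
have [<-{b}|ab] := eqVneq a b; last first.
  have cq : {for (a, b), continuous (fun p : R * R => (p.2 - p.1)^-1 *: (g p.2 - g p.1))}.
    have c1 : continuous (fun p : R * R => p.2 - p.1) by cont.
    have c2 : continuous (fun p : R * R => g p.2 - g p.1).
      by cont; apply: cont_comp => //; cont.
    by apply: cvgZ; [apply: cvgV; [rewrite /= subr_eq0 eq_sym|exact: c1]|exact: c2].
  rewrite /continuous_at (_ : diffquo g g' (a, b) = (b - a)^-1 *: (g b - g a)); last first.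
    by rewrite /diffquo /= (negPf ab).
  apply: cvg_trans cq; apply: near_eq_cvg.
  have : {for (a, b), continuous (fun p : R * R => p.2 - p.1)}.
    have c1 : continuous (fun p : R * R => p.2 - p.1) by cont.
    exact: c1.
  move=> /cvgr_neq0 /=; rewrite subr_eq0 eq_sym => /(_ ab) H.
  near=> p; rewrite /diffquo ifF//; apply/negbTE; rewrite eq_sym -subr_eq0.
  by near: p.
rewrite /continuous_at diffquo_diag; apply/cvgrPdist_le => e e0.
have /cvgrPdist_le/(_ _ e0)/nbhs_ballP[r /= r0 br] := cg' a.
apply: filterS (nbhsx_ballx (a, a) r r0) => -[x y] [/= xr yr].
have key z : (Num.min x y <= z <= Num.max x y) -> `|g' a - g' z| <= e.
  move=> zxy; apply: br; move: xr yr; rewrite -!ball_normE /= !ltr_norml.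
  by move: zxy; case: (leP x y); lra.
have [xy|] := eqVneq x y.
  by rewrite xy diffquo_diag; apply: key; rewrite xy minxx maxxx lexx.
wlog: x y xr yr key / x < y.
  move=> W nxy; have [xy|xy|xy] := ltgtP x y; [exact: W| |by rewrite xy eqxx in nxy].
  have -> : diffquo g g' (x, y) = diffquo g g' (y, x).
    rewrite /diffquo /= [y == x]eq_sym (negPf nxy) -opprB invrN scaleNr -scalerN.
    by rewrite opprB.
  apply: W => //; last by rewrite eq_sym.
  by move=> z; rewrite minC maxC; exact: key.
move=> xy nxy; rewrite /diffquo /= (negPf nxy).
have yx0 : y - x != 0 by rewrite subr_eq0 eq_sym.
rewrite norm_plane_le; apply/andP; split; rewrite !planeE.
  have [z zxy ->] := mean_value (fun t => (dg t).1) xy.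
  rewrite [_^-1 * _]mulrC mulfK//.
  have := key z; rewrite (min_idPl (ltW xy)) (max_idPr (ltW xy)).
  rewrite norm_plane_le => H; have /andP[//] : (x <= z <= y) by lra.
  by move: zxy => /andP[/ltW -> /ltW ->] in H *; case/andP: (H isT).
have [z zxy ->] := mean_value (fun t => (dg t).2) xy.
rewrite [_^-1 * _]mulrC mulfK//.
have := key z; rewrite (min_idPl (ltW xy)) (max_idPr (ltW xy)).
by rewrite norm_plane_le; move: zxy => /andP[/ltW -> /ltW ->] /(_ isT)/andP[].
Unshelve. all: by end_near. Qed.

Lemma det2Zr a v w : det2 v (a *: w) = a * det2 v w.
Proof. by rewrite /det2 !planeE; ring. Qed.
Lemma det2Zl a v w : det2 (a *: v) w = a * det2 v w.
Proof. by rewrite /det2 !planeE; ring. Qed.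
Lemma det2Dr u v w : det2 u (v + w) = det2 u v + det2 u w.
Proof. by rewrite /det2 !planeE; ring. Qed.
Lemma det2Nr v w : det2 v (- w) = - det2 v w.
Proof. by rewrite /det2 !planeE; ring. Qed.
Lemma det20 v : det2 v 0 = 0.
Proof. by rewrite /det2 !planeE !mulr0 subrr. Qed.

(* Hopf's argument for the Umlaufsatz: the secant directions of the loop, over
   the triangle s <= t blown up at the corner (0, 1) by s = u (1 - w) and
   t = s + w, form a nonvanishing map G on the unit square.  Its angle turns by
   less than pi along the sides w = 0 and w = 1, where G is transversal to the
   field, while G (1, w) = - G (0, 1 - w). *)
Lemma no_simple_loop (th : plane R -> R) g g' : continuous th -> C1curve g g' ->
  (forall t, 0 <= t <= 1 -> 0 < det2 (cis (th (g t))) (g' t)) ->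
  (forall s t, 0 <= s -> s < t -> t <= 1 -> g s = g t -> s = 0 /\ t = 1) ->
  g 0 <> g 1.
Proof.
move=> cth C tr simple g01; have p0 := pi_gt0 R.
have cQ := cont_diffquo C; have cg := C1_cont C.
pose Q a b := diffquo g g' (a, b).
have Qe a b : (b - a) *: Q a b = g b - g a by exact: diffquoM.
have Qd a : Q a a = g' a by exact: diffquo_diag.
have Q01 : Q 0 1 = 0 by have := Qe 0 1; rewrite g01 subrr subr0 scale1r.
(* Since [g 0 = g 1], the secant [Q s t] equals [(1 - w) *: G u w]. Dividing out [1 - w] keeps [G]
   nonzero at the corner [s = 0], [t = 1], where it is minus a convex combination of the two end
   tangents. *)
pose G (u w : R) := let s := u * (1 - w) in let t := s + w in
  Q s t - ((1 - u) *: Q t 1 + u *: Q 0 s).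
have G1 (u w : R) : (1 - w) *: G u w = Q (u * (1 - w)) (u * (1 - w) + w).
  rewrite /G; set s := u * (1 - w); set t := s + w.
  rewrite scalerBr scalerDr !scalerA.
  rewrite (_ : (1 - w) * (1 - u) = 1 - t); last by rewrite /t /s; ring.
  rewrite (_ : (1 - w) * u = s - 0); last by rewrite /s; ring.
  rewrite !Qe (_ : g 1 - g t + (g s - g 0) = - (w *: Q s t)); last first.
    by rewrite g01 -[w](addrK s) [w + s]addrC -/t Qe; apply: plane_eq; rewrite !planeE; ring.
  by rewrite opprK -scalerDl subrK scale1r.
have G01 (w : R) : 0 <= w <= 1 -> G 1 w = - G 0 (1 - w).
  have [->|w0] := eqVneq w 0.
    rewrite /G /= => _; rewrite !subr0 !mul1r !subrr !scale0r !scale1r !mul0r !add0r !addr0.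
    by rewrite Q01 subr0 sub0r opprK.
  have [->|w1] := eqVneq w 1.
    rewrite /G /= => _; rewrite !subrr !subr0 !mulr0 !scale0r !scale1r !add0r.
    by rewrite Q01 !mul0r !addr0 Q01 subr0 sub0r.
  move=> _; apply: (@scalerI _ _ (w * (1 - w))).
    by rewrite mulf_neq0// subr_eq0 eq_sym.
  have -> : (w * (1 - w)) *: G 1 w = g 1 - g (1 - w).
    by rewrite -scalerA G1 mul1r subrK -{1}[w](subKr 1) Qe.
  rewrite scalerN (_ : _ *: G 0 _ = g (1 - w) - g 0) ?opprB ?g01//.
  have := Qe 0 (1 - w); have := G1 0 (1 - w).
  rewrite subKr mul0r add0r subr0 => e1 e2; by rewrite mulrC -scalerA e1 e2 g01.
have Gnz (u w : R) : 0 <= u <= 1 -> 0 <= w <= 1 -> G u w != 0.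
  move=> u01 w01; have [w1|w1] := eqVneq w 1.
    have: 0 < - det2 (cis (th (g 0))) (G u w).
      rewrite w1 /G subrr mulr0 add0r.
      rewrite Q01.
      rewrite sub0r det2Nr opprK det2Dr !det2Zr !Qd.
      have h0 := tr 0; have h1 := tr 1; rewrite -g01 in h1.
      have {h0}h0 : 0 < det2 (cis (th (g 0))) (g' 0) by apply: h0; rewrite lexx ler01.
      have {h1}h1 : 0 < det2 (cis (th (g 0))) (g' 1) by apply: h1; rewrite lexx ler01.
      by move: h0 h1; set x := det2 _ _; set y := det2 _ _; nra.
    by apply: contraTneq => ->; rewrite det20 oppr0 ltxx.
  suff : Q (u * (1 - w)) (u * (1 - w) + w) != 0.
    by apply: contraNneq => G0; rewrite -G1 G0 scaler0.
  set s := u * (1 - w).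
  have sw : 0 <= s <= 1 - w by rewrite /s; nra.
  have [w0|w0] := eqVneq w 0.
    rewrite w0 addr0 Qd; have : 0 < det2 (cis (th (g s))) (g' s) by apply: tr; lra.
    by apply: contraTneq => ->; rewrite det20 ltxx.
  apply: contraNneq w1 => Q0.
  have : g s = g (s + w).
    by apply/eqP; rewrite eq_sym -subr_eq0 -Qe Q0 scaler0.
  have wp : 0 < w by rewrite lt0r w0; case/andP: w01.
  have [s0 s1] := andP sw; have s2 : s + w <= 1 by rewrite -lerBrDr.
  have s3 : s < s + w by rewrite ltrDl.
  by move=> /(simple s (s + w) s0 s3 s2)[s0' <-]; rewrite s0' add0r.
pose GG (p : plane R) := G `|p.1| `|p.2|.
have cGG : continuous GG.
  rewrite /GG /G; apply: cont_add.
    by apply: (cont_comp cQ); cont.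
  by apply: cont_opp; apply: cont_add; apply: cont_scale; cont; apply: (cont_comp cQ); cont.
have [p|T cT TE] := angle_lift (@ler01 R) cGG.
  by rewrite norm_plane_le => /andP[h1 h2]; apply: Gnz; rewrite normr_ge0.
have {}TE (u w : R) : 0 <= u <= 1 -> 0 <= w <= 1 ->
    G u w = enorm (G u w) *: cis (T (u, w)).
  move=> /andP[u0 u1] /andP[w0 w1]; have := TE (u, w).
  by rewrite norm_plane_le /GG /= !ger0_norm// u1 w1 => /(_ isT).
have sinT (a u w : R) : 0 <= u <= 1 -> 0 <= w <= 1 ->
    (0 < sin (T (u, w) - a)) = (0 < det2 (cis a) (G u w)).
  move=> hu hw; rewrite [in RHS]TE// det2Zr det2_cis pmulr_rgt0//.
  by rewrite enorm_gt0 Gnz.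
have i01 : 0 <= (1 : R) <= 1 by rewrite ler01 lexx.
have i00 : 0 <= (0 : R) <= 1 by rewrite ler01 lexx.
have A : `|(T (1, 0) - th (g 1)) - (T (0, 0) - th (g 0))| < pi.
  apply: (half_turn (g := fun u => T (u, 0) - th (g u))) => //.
    by cont; [apply: (cont_comp cT); cont|apply: (cont_comp cth)].
  move=> u hu; rewrite sinT//; have := tr u hu.
  have := G1 u 0; rewrite subr0 scale1r mulr1 addr0 Qd => ->.
  by [].
(* At [w = 1] the map points to the negative side of the field, hence the reference angle shifted by
   pi. *)
have B : `|(T (1, 1) - (th (g 0) + pi)) - (T (0, 1) - (th (g 0) + pi))| < pi.
  apply: (half_turn (g := fun u => T (u, 1) - (th (g 0) + pi))) => //.
    by cont; apply: (cont_comp cT); cont.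
  move=> u hu; rewrite sinT//.
  rewrite /cis cosDpi sinDpi (_ : det2 _ _ = - det2 (cis (th (g 0))) (G u 1)); last first.
    by rewrite /det2 /cis /=; ring.
  rewrite /G subrr mulr0 add0r.
  rewrite Q01.
  rewrite sub0r det2Nr opprK det2Dr !det2Zr !Qd.
  have h0 := tr 0 i00; have h1 := tr 1 i01; rewrite -g01 in h1.
  by move: h0 h1; set x := det2 _ _; set y := det2 _ _; move: hu => /andP[]; nra.
pose D (w : R) := T (1, w) - T (0, 1 - w).
have Dpi (w : R) : 0 <= w <= 1 -> cos (D w) = -1.
  move=> hw; apply: cisN.
  have hw' : 0 <= 1 - w <= 1 by lra.
  have en : enorm (G 0 (1 - w)) = enorm (G 1 w) by rewrite G01// enormN.
  have := G01 w hw; rewrite {1}TE// [in RHS]TE// en -scalerN; apply: scalerI.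
  by rewrite enorm_eq0 Gnz.
have cD : D 1 = D 0.
  apply: (@const_angle _ D 0 1) => //.
    by rewrite /D; cont; apply: (cont_comp cT); cont.
  move=> w hw; have c0 := Dpi 0 i00; have c1 := Dpi w hw.
  have s0 : sin (D 0) = 0.
    apply/eqP; rewrite -sqrf_eq0; have := cos2Dsin2 (D 0); rewrite c0 sqrrN expr1n.
    by move=> e; apply/eqP; lra.
  by rewrite cosB c0 c1 s0; ring.
(* The quantities bounded in [A] and [B] add up to [D 0 + D 1 = 2 * D 0]. So [D 0] is less than pi
   in modulus, although its cosine is -1. *)
have D0 : `|D 0| < pi.
  move: A B cD; rewrite /D g01 subrr subr0 !ltr_norml; lra.
have : cos (pi - `|D 0|) = 1.
  have ca : cos `|D 0| = -1.
    by have [h|h] := ler0P (D 0); rewrite ?cosN Dpi.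
  by rewrite addrC cosDpi cosN ca opprK.
by move=> /eqP; rewrite lt_eqF// cos_lt1//; have := normr_ge0 (D 0); lra.
Qed.


(** A closed subarc of least parameter length is a simple loop. It exists because the zeros of the
    completed secant map form a compact set, and transversality keeps the minimum off the
    diagonal. *)
Lemma no_loop_pos (th : plane R -> R) g g' a b : continuous th -> C1curve g g' ->
  a < b -> (forall t, a <= t <= b -> 0 < det2 (cis (th (g t))) (g' t)) ->
  g a <> g b.
Proof.
move=> cth C ab tr gab.
have cQ := cont_diffquo C.
pose K := [set p : R * R | [/\ a <= p.1, p.1 <= p.2, p.2 <= b & diffquo g g' p = 0]].
have cK : compact K.
  have := compact_setX (@segment_compact R a b) (@segment_compact R a b).
  move=> /(@subclosed_compact _ K); apply; last first.
    move=> [x y] [/= h1 h2 h3 _]; split; rewrite /= in_itv /=; lra.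
  have cl (f : R * R -> R) : continuous f -> closed [set p | 0 <= f p].
    move=> cf; apply: (@closed_comp _ _ f [set x | 0 <= x]) => [x _|]; first exact: cf.
    exact: closed_ge.
  rewrite (_ : K = [set p | 0 <= p.1 - a] `&` [set p | 0 <= p.2 - p.1] `&`
     [set p | 0 <= b - p.2] `&` [set p | 0 <= - `|diffquo g g' p|]).
    by repeat apply: closedI; apply: cl; cont.
  apply/seteqP; split => -[x y] /=.
    by move=> [h1 h2 h3 ->]; rewrite normr0 oppr0 !subr_ge0.
  rewrite !subr_ge0 oppr_ge0 normr_le0 => -[[[h1 h2] h3] /eqP h4].
  by split.
have K0 : K !=set0.
  exists (a, b); split; rewrite ?lexx ?ltW//=.
  have := diffquoM g g' a b; rewrite gab subrr => /eqP.
  by rewrite scaler_eq0 subr_eq0 gt_eqF//= => /eqP.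
have cd : continuous (fun p : R * R => p.2 - p.1) by cont.
have [[x y] /set_mem [/= ax xy yb q0] mini] :=
  compact_EVT_min K0 cK (continuous_subspaceT cd).
have {}xy : x < y.
  rewrite lt_neqAle xy andbT; apply: contraPneq q0 => ->; rewrite diffquo_diag => g0.
  by have := tr y; rewrite g0 det20 ltxx (le_trans ax xy) yb => /(_ isT).
pose h t := g (x + t * (y - x)); pose h' t := (y - x) *: g' (x + t * (y - x)).
apply: (@no_simple_loop th h h') => //.
- case: C => cg' dg; split.
    by rewrite /h'; cont; apply: (cont_comp cg'); cont.
  have dl (t : R) : is_derive t 1 (fun t => x + t * (y - x)) (y - x).
    by apply: is_derive_eq; rewrite scaler0 !add0r mul1r; exact: mulr1.
  move=> t; split; rewrite /h' !planeE mulrC.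
    exact: (is_derive1_comp (f := fun x => (g x).1) (dg _).1 (dl t)).
  exact: (is_derive1_comp (f := fun x => (g x).2) (dg _).2 (dl t)).
- move=> t t01; rewrite /h /h' det2Zr; apply: mulr_gt0; [by rewrite subr_gt0|apply: tr].
  by move: t01 => /andP[]; nra.
- move=> s t s0 st t1 hst.
  have zK : (x + s * (y - x), x + t * (y - x)) \in K.
    apply/mem_set; split => /=; [nra|nra|nra|].
    have := diffquoM g g' (x + s * (y - x)) (x + t * (y - x)).
    rewrite -!/(h _) hst subrr => /eqP.
    rewrite scaler_eq0 subr_eq0 => /orP[|/eqP//].
    by rewrite (inj_eq (addrI x)) (inj_eq (mulIf _)) ?subr_eq0 ?gt_eqF.
  have /= := mini _ zK; split; nra.
rewrite /h mul0r addr0 mul1r subrKC; apply/eqP; rewrite eq_sym -subr_eq0.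
by rewrite -(diffquoM g g') q0 scaler0.
Qed.

(** By the intermediate value theorem the determinant keeps its sign; a negative sign is made
    positive by turning the field by pi. *)
Lemma no_loop (th : plane R -> R) g g' a b : continuous th -> C1curve g g' ->
  a < b -> (forall t, a <= t <= b -> det2 (cis (th (g t))) (g' t) != 0) ->
  g a <> g b.
Proof.
move=> cth C ab tr.
pose d t := det2 (cis (th (g t))) (g' t).
have cd : continuous d.
  apply: cont_det2; last by case: C.
  have cg := C1_cont C.
  by rewrite /cis; cont; apply: (cont_comp cth).
have sgn t : a <= t <= b -> 0 < d a * d t.
  move=> /andP[at_ tb].
  have nz : d a * d t != 0 by rewrite mulf_neq0 ?tr// ?lexx ?at_ ?tb ?ltW.
  rewrite lt0r nz /=.
  rewrite leNgt; apply/negP => neg.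
  have [|c /andP[ac ct] /eqP] := @continuous_IVT _ d a t 0 cd at_.
    have [da|da] := leP 0 (d a); [right|left]; apply/andP; split; rewrite ?(ltW da)//.
      by rewrite leNgt; apply/negP => dt; move: neg; rewrite ltNge mulr_ge0// ltW.
    by rewrite leNgt; apply/negP => dt; move: neg; rewrite ltNge mulr_le0// ltW.
  by apply/negP/tr; rewrite ac (le_trans ct).
have aab : a <= a <= b by rewrite lexx ltW.
have [d0|d0|d0] := ltgtP (d a) 0; last by have := tr a aab; rewrite -/(d a) d0 eqxx.
  apply: (@no_loop_pos (fun p => th p + pi) g g') => //; first by cont.
  move=> t /sgn; rewrite nmulr_rgt0//; rewrite /d /cis cosDpi sinDpi /det2 /=; lra.
apply: (@no_loop_pos th g g') => // t /sgn; rewrite pmulr_rgt0//.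
Qed.


(** The square of [v] as a complex number. It identifies [v] with [- v], so it turns a line field
    into a single-valued map. *)
Definition dbl v : plane R := (v.1 ^+ 2 - v.2 ^+ 2, 2 * (v.1 * v.2)).

Lemma dbl_cis v t : enorm v = 1 -> dbl v = cis (2 * t) ->
  v = cis t \/ v = - cis t.
Proof.
move=> v1 [e1 e2].
have ct := cos2Dsin2 t; have := sq_enorm v; rewrite v1 expr1n => sv.
have e3 : v.1 ^+ 2 - v.2 ^+ 2 = cos t ^+ 2 - sin t ^+ 2.
  by rewrite e1 mulr2n mulrDl mul1r cosD -!expr2.
have e4 : v.1 * v.2 = cos t * sin t.
  apply: (@mulfI _ 2) => //; rewrite e2 mulrDl mul1r sinD; ring.
have a1 : (v.1 - cos t) * (v.1 + cos t) = 0.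
  by rewrite -subr_sqr; lra.
have a2 : (v.2 - sin t) * (v.2 + sin t) = 0.
  by rewrite -subr_sqr; lra.
have s0 : v.1 = cos t /\ v.2 = sin t \/ v.1 = - cos t /\ v.2 = - sin t.
  move: a1 a2 => /eqP; rewrite mulf_eq0 subr_eq0 addr_eq0 => /orP[] /eqP h1 /eqP;
    rewrite mulf_eq0 subr_eq0 addr_eq0 => /orP[] /eqP h2; auto.
    move: e4; rewrite h1 h2 mulrN => e4.
    have : cos t * sin t = 0 by lra.
    move=> /eqP; rewrite mulf_eq0 => /orP[] /eqP z; [right|left]; split; lra.
  move: e4; rewrite h1 h2 mulNr => e4.
  have : cos t * sin t = 0 by lra.
  move=> /eqP; rewrite mulf_eq0 => /orP[] /eqP z; [left|right]; split; lra.
by case: s0 => -[h1 h2]; [left|right]; apply: plane_eq.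
Qed.

Lemma norm_dblB v w : enorm v = 1 -> enorm w = 1 ->
  enorm (dbl v - dbl w) = 2 * `|det2 v w|.
Proof.
move=> v1 w1; apply/eqP.
rewrite -(@eqrXn2 _ 2)// ?mulr_ge0 ?enorm_ge0//.
rewrite exprMn real_normK ?num_real// sq_enorm /dbl !planeE /det2 /=.
have := sq_enorm v; have := sq_enorm w; rewrite v1 w1 expr1n => ew ev.
have e : (v.1 ^+ 2 + v.2 ^+ 2) ^+ 2 + (w.1 ^+ 2 + w.2 ^+ 2) ^+ 2 -
  2 * ((v.1 ^+ 2 + v.2 ^+ 2) * (w.1 ^+ 2 + w.2 ^+ 2)) = 0 by rewrite -ew -ev; ring.
by apply/eqP; rewrite -[RHS]addr0 -e; ring.
Qed.

(* A line field, given by unit vectors e p determined up to sign, is uniformly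
   continuous when |det2 (e p) (e q)|, the sine of the angle between the lines
   at p and q, is uniformly small for q close to p. *)
Definition unif_line_field (e : plane R -> plane R) :=
  (forall p, enorm (e p) = 1) /\
  forall h, 0 < h -> exists2 d, 0 < d &
    forall p q, `|p - q| < d -> `|det2 (e p) (e q)| < h.

(** The doubled field is continuous and never vanishes, so it has a continuous angle on the square;
    half of it is an angle for the lines. *)
Lemma line_field_angle e r : unif_line_field e -> 0 <= r ->
  exists2 th : plane R -> R, continuous th &
    forall p, `|p| <= r -> e p = cis (th p) \/ e p = - cis (th p).
Proof.
move=> [e1 ue] r0.
have cd : continuous (fun p => dbl (e p)).
  move=> p; apply/cvgrPdist_lt => h h0.
  have h2 : 0 < h / 2 by rewrite divr_gt0.
  have [d d0 H] := ue _ h2.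
  apply: filterS (nbhsx_ballx p d d0) => q; rewrite -ball_normE /= => pq.
  apply: (le_lt_trans (norm_le_enorm _)); rewrite norm_dblB//.
  by have := H _ _ pq; lra.
have nd p : enorm (dbl (e p)) = 1.
  have := sq_enorm (e p); rewrite e1 expr1n => ee.
  apply/eqP; rewrite -(@eqrXn2 _ 2)// ?enorm_ge0// sq_enorm expr1n /dbl /=.
  by apply/eqP; rewrite [in RHS]ee -[RHS]mul1r [in RHS]ee; ring.
have [p _|T cT TE] := angle_lift r0 cd.
  by rewrite -enorm_gt0 nd.
exists (fun p => T p / 2); first by cont.
move=> p pr; apply: dbl_cis => //.
by rewrite TE// nd scale1r; congr cis; field.
Qed.

(** Expand [w] in the frame of [v], and use that 1 minus the modulus of a cosine is at most the
    modulus of the sine. The lemma transfers transversality to a nearby line of the field. *)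
Lemma det2_line v w u : enorm v = 1 -> enorm w = 1 ->
  `|det2 v u| - 2 * `|det2 v w| * enorm u <= `|det2 w u|.
Proof.
move=> v1 w1; have L := lagrange v w; rewrite v1 w1 expr1n mulr1 in L.
have id : det2 w u = dot2 v w * det2 v u - det2 v w * dot2 v u.
  have := sq_enorm v; rewrite v1 expr1n => ev.
  by rewrite -[LHS]mul1r ev /det2 /dot2; ring.
have d1 : 1 - `|det2 v w| <= `|dot2 v w|.
  have l1 : `|det2 v w| <= 1 by have := le_det2 v w; rewrite v1 w1 mulr1.
  rewrite -(@ler_pXn2r _ 2)// ?nnegrE ?subr_ge0// real_normK ?num_real//.
  have := real_normK (num_real (det2 v w)); have := normr_ge0 (det2 v w).
  by set a := `|_| in l1 *; nra.
have a1 : `|det2 v u| <= enorm u by have := le_det2 v u; rewrite v1 mul1r.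
have a2 : `|dot2 v u| <= enorm u by have := le_dot2 v u; rewrite v1 mul1r.
rewrite id; apply: le_trans (lerB_dist _ _); rewrite !normrM.
have := normr_ge0 (det2 v u); have := normr_ge0 (dot2 v u).
have := normr_ge0 (det2 v w); have := normr_ge0 (dot2 v w).
nra.
Qed.

(* A curve coming back close to a former position could be closed up into a
   loop transversal to the field. *)
Lemma near_return e K al : unif_line_field e -> 0 < K -> 0 < al ->
  exists2 d, 0 < d & forall g g' a b, C1curve g g' -> a + 1 <= b ->
    (forall t, a <= t <= b -> enorm (g' t) <= K /\ al <= `|det2 (e (g t)) (g' t)|) ->
    d <= enorm (g b - g a).
Proof.
move=> ue K0 al0; have [e1 ec] := ue.
have h0 : 0 < al / (8 * K) by rewrite divr_gt0// mulr_gt0.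
have [r r0 Hr] := ec _ h0.
exists (Num.min r (al / 4)); first by rewrite lt_min r0 divr_gt0.
move=> g g' a b C ab tr; rewrite leNgt; apply/negP; rewrite lt_min => /andP[sr sa].
have lt_ab : a < b by lra.
(* The drift that closes the curve up. As [b - a >= 1], it has speed less than [al / 4] and moves
   each point by less than [r]; the change of field line costs at most another [al / 4] by the
   choice of [r]. *)
pose dd := (b - a)^-1 *: (g b - g a).
pose h t := g t - (t - a) *: dd; pose h' t := g' t - dd.
have ndd : enorm dd < al / 4.
  rewrite /dd enormZ ger0_norm ?invr_ge0 ?subr_ge0 ?ltW//.
  apply: le_lt_trans sa; rewrite ler_piMl ?enorm_ge0// invf_le1; lra.
have Ch : C1curve h h'.
  case: C => cg' dg; split; first by rewrite /h'; cont.
  move=> t; have [d1 d2] := dg t; split; rewrite /h /h' !planeE.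
    by apply: is_derive_eq; rewrite scaler0 add0r subr0; congr (_ - _); exact: mulr1.
  by apply: is_derive_eq; rewrite scaler0 add0r subr0; congr (_ - _); exact: mulr1.
have clo t : a <= t <= b -> `|g t - h t| < r.
  move=> /andP[at_ tb]; apply: (le_lt_trans (norm_le_enorm _)); apply: le_lt_trans sr.
  rewrite /h opprB addrC subrK /dd scalerA enormZ ler_piMl ?enorm_ge0//.
  rewrite ger0_norm; last by rewrite divr_ge0; lra.
  by rewrite ler_pdivrMr; lra.
have trh t : a <= t <= b -> 0 < `|det2 (e (h t)) (h' t)|.
  move=> tt; have [s1 s2] := tr t tt.
  have := det2_line (g' t) (e1 (g t)) (e1 (h t)).
  have := Hr _ _ (clo t tt); rewrite ltr_pdivlMr ?mulr_gt0// => k1.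
  have k2 : 2 * `|det2 (e (g t)) (e (h t))| * enorm (g' t) <= al / 4.
    have := normr_ge0 (det2 (e (g t)) (e (h t))); have := enorm_ge0 (g' t); nra.
  have k3 := le_det2 (e (h t)) dd; rewrite e1 mul1r in k3.
  rewrite /h' det2Dr det2Nr => k4.
  have := lerB_dist (det2 (e (h t)) (g' t)) (det2 (e (h t)) dd); lra.
have [x hx] : exists x, forall t, a <= t <= b -> `|h t| <= x.
  have [c _ cm] := EVT_max (ltW lt_ab) (continuous_subspaceT (cont_norm (C1_cont Ch))).
  by exists `|h c| => t tt; apply: cm; rewrite in_itv.
have x0 : 0 <= x by apply: le_trans (hx a _) => //; rewrite lexx ltW.
have [th cth thE] := line_field_angle ue x0.
apply: (no_loop (g := h) cth Ch lt_ab).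
  move=> t tt; have := trh t tt; rewrite normr_gt0.
  case: (thE (h t) (hx t tt)) => ->//.
  by rewrite (_ : - cis _ = -1 *: cis (th (h t))) ?det2Zl ?mulN1r ?oppr_eq0// scaleN1r.
by rewrite /h /dd subrr scale0r subr0 scalerA divff ?scale1r ?subKr// subr_eq0 gt_eqF.
Qed.


End Curves.

(** * Length of transversal curves bounded by area *)

Section Packing.
Variable R : realType.
Implicit Types (f : R -> R) (g : R -> plane R) (p q v w : plane R).

Lemma lin_bound m1 m2 : det2 m1 m2 != 0 -> exists2 k, 0 < k &
  forall v, enorm v <= k * (`|dot2 m1 v| + `|dot2 m2 v|).
Proof.
move=> d0; pose k := (`|m1.1| + `|m1.2| + `|m2.1| + `|m2.2|) / `|det2 m1 m2|.
have k0 : 0 <= k by rewrite divr_ge0// !addr_ge0.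
exists (k + 1) => [|v]; first by rewrite ltr_wpDl.
have nd : 0 < `|det2 m1 m2| by rewrite normr_gt0.
suff : enorm v <= k * (`|dot2 m1 v| + `|dot2 m2 v|).
  by have := normr_ge0 (dot2 m1 v); have := normr_ge0 (dot2 m2 v); nra.
rewrite /k mulrAC ler_pdivlMr//.
apply: le_trans (_ : (`|v.1| + `|v.2|) * `|det2 m1 m2| <= _).
  by apply: ler_wpM2r; rewrite ?enorm_le_l1.
have e1 : det2 m1 m2 * v.1 = m2.2 * dot2 m1 v - m1.2 * dot2 m2 v.
  by rewrite /det2 /dot2; ring.
have e2 : det2 m1 m2 * v.2 = m1.1 * dot2 m2 v - m2.1 * dot2 m1 v.
  by rewrite /det2 /dot2; ring.
rewrite mulrDl -!normrM ![_ * det2 _ _]mulrC e1 e2.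
apply: (le_trans (lerD (ler_normB _ _) (ler_normB _ _))); rewrite !normrM.
have h1 := mulr_ge0 (normr_ge0 m1.1) (normr_ge0 (dot2 m1 v)).
have h2 := mulr_ge0 (normr_ge0 m1.2) (normr_ge0 (dot2 m1 v)).
have h3 := mulr_ge0 (normr_ge0 m2.1) (normr_ge0 (dot2 m2 v)).
have h4 := mulr_ge0 (normr_ge0 m2.2) (normr_ge0 (dot2 m2 v)).
lra.
Qed.

(** Pigeonhole in the coordinates [dot2 m1] and [dot2 m2]: with cells of side [d / (4 * k)], two
    points in the same cell would be at distance less than [d]. *)
Lemma separated_points (n : nat) (p : 'I_n -> plane R) m1 m2 k d U V :
  0 < d -> 0 < k -> 0 <= U -> 0 <= V ->
  (forall v, enorm v <= k * (`|dot2 m1 v| + `|dot2 m2 v|)) ->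
  (forall i j, i != j -> d <= enorm (p i - p j)) ->
  (forall i j, `|dot2 m1 (p i - p j)| <= U /\ `|dot2 m2 (p i - p j)| <= V) ->
  n%:R <= (8 * k * U / d + 1) * (8 * k * V / d + 1).
Proof.
move=> d0 k0 U0 V0 kE sep ext.
case: n p sep ext => [|n] p sep ext.
  by rewrite mulr_ge0// addr_ge0// divr_ge0 ?mulr_ge0// ltW.
pose c := 4 * k / d.
have c0 : 0 < c by rewrite divr_gt0// mulr_gt0.
pose cell m W i := Num.truncn (c * (dot2 m (p i - p ord0) + W)).
have cell_ge0 m W i : `|dot2 m (p i - p ord0)| <= W -> 0 <= c * (dot2 m (p i - p ord0) + W).
  by rewrite ler_norml => /andP[h _]; rewrite mulr_ge0 ?(ltW c0)//; lra.
have cell_le m W i : `|dot2 m (p i - p ord0)| <= W -> (cell m W i < (Num.truncn (2 * c * W)).+1)%N.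
  move=> h; rewrite ltnS; apply: le_truncn; move: h; rewrite ler_norml => /andP[_ h].
  by have := c0; nra.
have cell_eq m W i j : `|dot2 m (p i - p ord0)| <= W -> `|dot2 m (p j - p ord0)| <= W ->
    cell m W i = cell m W j -> c * `|dot2 m (p i - p j)| < 1.
  move=> hi hj e; rewrite -[X in X * _](gtr0_norm c0) -normrM.
  have -> : c * dot2 m (p i - p j) = c * (dot2 m (p i - p ord0) + W) -
      c * (dot2 m (p j - p ord0) + W).
    by rewrite /dot2 !planeE; ring.
  have := truncn_itv (cell_ge0 _ _ _ hi); have := truncn_itv (cell_ge0 _ _ _ hj).
  rewrite -!/(cell _ _ _) e -natr1 ltr_norml; lra.
pose N1 := (Num.truncn (2 * c * U)).+1; pose N2 := (Num.truncn (2 * c * V)).+1.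
pose phi (i : 'I_n.+1) : 'I_N1 * 'I_N2 := (Ordinal (cell_le m1 U i (ext i ord0).1),
  Ordinal (cell_le m2 V i (ext i ord0).2)).
have inj : injective phi.
  move=> i j [/= e1 e2]; apply/eqP; rewrite -[_ == _]negbK; apply/negP => /sep.
  have c1 := cell_eq _ _ _ _ (ext i ord0).1 (ext j ord0).1 e1.
  have c2 := cell_eq _ _ _ _ (ext i ord0).2 (ext j ord0).2 e2.
  rewrite leNgt => /negP; apply; apply: (le_lt_trans (kE _)).
  have cE x : (c * x < 1) = (4 * k * x < d) by rewrite /c mulrAC ltr_pdivrMr// mul1r.
  by move: c1 c2; rewrite !cE; lra.
have := leq_card _ inj; rewrite card_prod !card_ord -(ler_nat R) natrM => /le_trans; apply.
have le1 W : 0 <= W -> (Num.truncn (2 * c * W)).+1%:R <= 8 * k * W / d + 1.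
  move=> W0; rewrite -natr1 lerD2r; apply: le_trans (_ : 2 * c * W <= _).
    by rewrite truncn_le mulr_ge0// mulr_ge0// ltW.
  by rewrite [leRHS](_ : _ = 2 * c * W)// /c; field; rewrite gt_eqF.
by apply: ler_pM => //; exact: le1.
Qed.

(** By [near_return] the positions at integer times are separated, and there are about [T] of them
    in a parallelogram with sides comparable to [U] and [V]. It is essential that [B] depends
    neither on the curve nor on [T], [U], [V]. *)
Lemma packing e K al m1 m2 : unif_line_field e -> 0 < K -> 0 < al ->
  det2 m1 m2 != 0 -> exists2 B, 0 < B & forall g g' T U V, C1curve g g' -> 0 <= T ->
    (forall t, 0 <= t <= T -> enorm (g' t) <= K /\ al <= `|det2 (e (g t)) (g' t)|) ->
    (forall s t, 0 <= s -> s <= t -> t <= T ->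
      `|dot2 m1 (g t - g s)| <= U /\ `|dot2 m2 (g t - g s)| <= V) ->
    T <= B * (1 + U) * (1 + V).
Proof.
move=> ue K0 al0 dm; have [d d0 near] := near_return ue K0 al0.
have [k k0 kE] := lin_bound dm.
have B1 : 0 <= 8 * k / d by rewrite divr_ge0 ?mulr_ge0// ltW.
exists ((8 * k / d + 1) ^+ 2) => [|g g' T U V C T0 tr ext].
  by rewrite exprn_gt0// ltr_wpDl.
have [U0 V0] : 0 <= U /\ 0 <= V.
  have [h1 h2] := ext 0 0 (lexx _) (lexx _) T0; split.
    exact: le_trans (normr_ge0 _) h1.
  exact: le_trans (normr_ge0 _) h2.
pose n := Num.truncn T.
have nT (i : 'I_n.+1) : (i : nat)%:R <= T.
  by apply: le_trans (_ : n%:R <= _); rewrite ?ler_nat ?leq_ord// truncn_le.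
have e2 i j : `|dot2 m1 (g (i : 'I_n.+1)%:R - g (j : 'I_n.+1)%:R)| <= U /\
    `|dot2 m2 (g i%:R - g j%:R)| <= V.
  have [ij|ji] := leqP j i; first by apply: ext; rewrite ?ler_nat// nT.
  have -> : g i%:R - g j%:R = - (g j%:R - g i%:R) by rewrite opprB.
  rewrite (_ : dot2 m1 _ = - dot2 m1 (g j%:R - g i%:R)); last by rewrite /dot2 !planeE; ring.
  rewrite (_ : dot2 m2 _ = - dot2 m2 (g j%:R - g i%:R)); last by rewrite /dot2 !planeE; ring.
  by rewrite !normrN; apply: ext; rewrite ?ler_nat ?nT// ltnW.
have sep i j : i != j -> d <= enorm (g (i : 'I_n.+1)%:R - g (j : 'I_n.+1)%:R).
  wlog : i j / (i < j)%N.
    move=> W ij; have [h|h|h] := ltngtP i j; first exact: W.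
      by rewrite enormBC; apply: W => //; rewrite eq_sym.
    by move: ij; rewrite (val_inj h) eqxx.
  move=> ij _; rewrite enormBC; apply: (near g g') => //.
    by rewrite natr1 ler_nat.
  by move=> t /andP[t1 t2]; apply: tr; rewrite (le_trans _ t1)// (le_trans t2).
have /ltW := truncnS_gt T; rewrite -/n => /le_trans; apply.
apply: le_trans (separated_points d0 k0 U0 V0 kE sep e2) _.
have -> : 8 * k * U / d = 8 * k / d * U by rewrite mulrAC.
have -> : 8 * k * V / d = 8 * k / d * V by rewrite mulrAC.
set b := 8 * k / d in B1 *.
have a1 : b * U + 1 <= (b + 1) * (1 + U) by nra.
have a2 : b * V + 1 <= (b + 1) * (1 + V) by nra.
apply: le_trans (ler_pM _ _ a1 a2) _; rewrite ?(addr_ge0 (mulr_ge0 B1 _))//.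
by rewrite [leRHS](_ : _ = (b + 1) * (1 + U) * ((b + 1) * (1 + V))) //; ring.
Qed.

End Packing.

(** * Lifts of torus maps *)

Section Lattice.
Variable R : realType.
Implicit Types (p q v : plane R) (m n : int).

Definition zvec m n : plane R := (m%:~R, n%:~R).

Lemma torus_piP p q : torus_pi p = torus_pi q <-> exists m n, p = q + zvec m n.
Proof.
split=> [/eqP|[m [n ->]]].
  by rewrite /torus_pi => /eqP/eqmodP/asboolP.
by apply/eqmodP/asboolP; exists m, n.
Qed.

Lemma torus_pi_repr (x : torus R) : torus_pi (repr x) = x.
Proof. exact: reprK. Qed.

Lemma torus_piD p m n : torus_pi (p + zvec m n) = torus_pi p.
Proof. by apply/torus_piP; exists m, n. Qed.

Lemma cis_int (x : R) m : cis (2 * pi * (x + m%:~R)) = cis (2 * pi * x).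
Proof.
have nat_case (y : R) (k : nat) : cis (2 * pi * (y + k%:R)) = cis (2 * pi * y).
  elim: k => [|k IH]; first by rewrite addr0.
  have -> : 2 * pi * (y + k.+1%:R) = 2 * pi * (y + k%:R) + pi + pi.
    by rewrite -natr1; ring.
  by rewrite /cis !cosDpi !sinDpi !opprK.
case: m => k; first exact: nat_case.
by have := nat_case (x - k.+1%:R) k.+1; rewrite subrK => ->; rewrite NegzE mulrNz.
Qed.

Lemma cos_sub1 (x y : R) : cos x = 1 -> cos y = 1 -> cos (x - y) = 1.
Proof.
move=> cx cy; have sx : sin x = 0.
  have := cos2Dsin2 x; rewrite cx expr1n => e.
  by apply/eqP; rewrite -sqrf_eq0; apply/eqP; lra.
by rewrite cosB cx cy sx; ring.
Qed.

Lemma periodic_bounded (g : plane R -> R) : continuous g ->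
  (forall p m n, g (p + zvec m n) = g p) -> exists C, forall p, `|g p| <= C.
Proof.
move=> cg per.
have S0 : [set p : plane R | `|p| <= 1] !=set0 by exists 0; rewrite /= normr0.
have [c _ cM] := compact_EVT_max S0 (@compact_square R 1)
  (continuous_subspaceT (cont_norm cg)).
exists `|g c| => p.
pose q := p - zvec (Num.floor p.1) (Num.floor p.2).
rewrite -[p](subrK (zvec (Num.floor p.1) (Num.floor p.2))) per -/q.
apply: cM; apply/mem_set; rewrite /= norm_plane_le /q !planeE /=.
have h1 := floor_itv p.1; have h2 := floor_itv p.2.
rewrite intrD1 in h1; rewrite intrD1 in h2.
by rewrite !ger0_norm; lra.
Qed.

Lemma within_comp (T U V : topologicalType) (A : set U) (H : U -> V) (k : T -> U) :
  {within A, continuous H} -> continuous k -> (forall z, A (k z)) ->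
  continuous (fun z => H (k z)).
Proof.
move=> /subspace_continuousP cH ck Ak z.
apply: (cvg_trans _ (cH _ (Ak z))).
move=> P /= HP; have := ck z _ HP; rewrite /nbhs /=; apply: filterS => y; apply; exact: Ak.
Qed.

(** A coordinate of the torus as a point of the circle: unlike [repr], it is continuous. *)
Definition tcoord (c : plane R -> R) (x : torus R) : plane R :=
  cis (2 * pi * c (repr x)).

Definition is_coord (c : plane R -> R) := c = fst \/ c = snd.

Lemma coord_cont c : is_coord c -> continuous c.
Proof. by case=> ->; cont. Qed.

Lemma coordB c p q : is_coord c -> c (p - q) = c p - c q.
Proof. by case=> ->. Qed.

Lemma coord_zvec c m n : is_coord c -> exists k : int, c (zvec m n) = k%:~R.
Proof. by case=> ->; eexists. Qed.

Lemma tcoord_pi c p : is_coord c -> tcoord c (torus_pi p) = cis (2 * pi * c p).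
Proof.
move=> cc; rewrite /tcoord.
have /torus_piP[m [n ->]] := torus_pi_repr (torus_pi p).
case: cc => ->; exact: cis_int.
Qed.

Lemma cont_tcoord c : is_coord c -> continuous (tcoord c).
Proof.
move=> cc; apply: (@repr_comp_continuous _ _ _ (fun p => cis (2 * pi * c p))).
  by rewrite /cis; have := coord_cont cc => ?; cont.
move=> p q /eqP pq.
have /torus_piP[m [n ->]] : torus_pi p = torus_pi q by [].
by apply/eqP; case: cc => ->; exact: cis_int.
Qed.

Lemma cont_torus_pi : continuous (@torus_pi R).
Proof. exact: pi_continuous. Qed.

Variables (f : torus R -> torus R) (F : plane R -> plane R) (A : 'M[int]_2).
Hypothesis lF : is_lift f F.
Let cF : continuous F := lF.1.

Lemma lift_int p m n : exists m' n', F (p + zvec m n) = F p + zvec m' n'.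
Proof. by apply/torus_piP; rewrite !lF.2 torus_piD. Qed.

(** Both points project to the same point of the torus, so the difference has integer coordinates;
    being continuous along the segment from 0 to [p], it is constant. *)
Lemma lift_shift_const p m n : F (p + zvec m n) - F p = F (zvec m n) - F 0.
Proof.
have key c : is_coord c -> c (F (p + zvec m n) - F p) = c (F (zvec m n) - F 0).
  move=> cc; have ccc := coord_cont cc.
  pose g (t : R) := 2 * pi * c (F (t *: p + zvec m n) - F (t *: p)).
  have cg : continuous g.
    rewrite /g; apply: cont_mul; first by cont.
    apply: (cont_comp ccc); apply: cont_add.
      by apply: (cont_comp cF); cont.
    by apply: cont_opp; apply: (cont_comp cF); cont.
  have gint t : cos (g t) = 1.
    rewrite /g; have [m' [n' ->]] := lift_int (t *: p) m n.
    rewrite addrAC subrr add0r.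
    have [k ->] := coord_zvec m' n' cc.
    by have [+ _] := cis_int 0 k; rewrite add0r mulr0 cos0.
  have := const_angle ler01 cg (fun t _ => cos_sub1 (gint t) (gint 0)).
  rewrite /g !scale1r !scale0r add0r => /mulfI; apply.
  by rewrite mulf_neq0// gt_eqF// pi_gt0.
by apply: plane_eq; [apply: (key fst); left|apply: (key snd); right].
Qed.

Hypothesis hA : is_linearization f A.

Lemma mat_actD p q : mat_act A (p + q) = mat_act A p + mat_act A q.
Proof. by apply: plane_eq; rewrite !planeE /=; ring. Qed.

Lemma mat_actZ (a : R) p : mat_act A (a *: p) = a *: mat_act A p.
Proof. by apply: plane_eq; rewrite /mat_act !planeE /=; ring. Qed.

Lemma mat_act_int m n : exists m' n', mat_act A (zvec m n) = zvec m' n'.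
Proof.
exists (A 0 0 * m + A 0 1 * n), (A 1 0 * m + A 1 1 * n).
by rewrite /mat_act /zvec /= !rmorphD !rmorphM.
Qed.

Lemma toral_endo_pi p : toral_endo A (torus_pi p) = torus_pi (mat_act A p).
Proof.
rewrite /toral_endo; apply/torus_piP.
have /torus_piP[m [n ->]] := torus_pi_repr (torus_pi p).
by rewrite mat_actD; have [m' [n' ->]] := mat_act_int m n; exists m', n'.
Qed.

(** The winding, in each circle coordinate, of the image of the loop in direction [zvec m n] does
    not change during the homotopy, since both ends of the loop are the same point of the torus. It
    is read off [F] at time 0 and [A] at time 1. *)
Lemma lift_shift_basis m n : F (zvec m n) - F 0 = mat_act A (zvec m n).
Proof.
have [H [cH H0 H1]] := hA; have p0 := pi_gt0 R.
have key c : is_coord c -> c (F (zvec m n) - F 0) = c (mat_act A (zvec m n)).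
  move=> cc; have ccc := coord_cont cc.
  (* The clamp followed by the absolute value sends the line to [0, 1] and fixes [0, 1], so [K] is
     continuous on the whole plane. *)
  pose K (z : plane R) := H (torus_pi (z.1 *: zvec m n), `|clamp 1 z.2|).
  have cK : continuous K.
    apply: (within_comp (k := fun z : plane R => (torus_pi (z.1 *: zvec m n), `|clamp 1 z.2|)) cH).
      apply: cont_pair; first by apply: (cont_comp cont_torus_pi); cont.
      apply: cont_norm; apply: (cont_snd (f := clamp2 1)); exact: cont_clamp2.
    by move=> z /=; rewrite in_itv /= normr_ge0 clamp_le.
  have cKc : continuous (fun z => tcoord c (K z)).
    by apply: cont_comp => //; exact: cont_tcoord.
  have un z : enorm (tcoord c (K z)) = 1 by exact: enorm_cis.
  have [z _|T cT TE] := angle_lift (@ler01 R) cKc.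
    by rewrite -enorm_gt0 un.
  have {}TE u w : 0 <= u <= 1 -> 0 <= w <= 1 -> tcoord c (K (u, w)) = cis (T (u, w)).
    move=> /andP[u0 u1] /andP[w0 w1]; rewrite TE ?un ?scale1r//.
    by rewrite norm_plane_le /= !ger0_norm// u1.
  have Ki u w : 0 <= w <= 1 -> K (u, w) = H (torus_pi (u *: zvec m n), w).
    by move=> /andP[w0 w1]; rewrite /K /= clamp_id ger0_norm.
  have i0 : 0 <= (0 : R) <= 1 by rewrite lexx ler01.
  have i1 : 0 <= (1 : R) <= 1 by rewrite lexx ler01.
  have hor (w : R) (L : plane R -> plane R) : 0 <= w <= 1 -> continuous L ->
      (forall p, H (torus_pi p, w) = torus_pi (L p)) ->
      T (1, w) - T (0, w) = 2 * pi * (c (L (zvec m n)) - c (L 0)).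
    move=> hw cL HL.
    pose g (u : R) := T (u, w) - 2 * pi * c (L (u *: zvec m n)).
    have cg : continuous g.
      rewrite /g; apply: cont_add; first by apply: (cont_comp cT); cont.
      apply: cont_opp; apply: cont_mul; first by cont.
      by apply: (cont_comp ccc); apply: (cont_comp cL); cont.
    have g1 u : 0 <= u <= 1 -> cos (g u) = 1.
      by move=> hu; apply: cisK; rewrite -TE// Ki// HL tcoord_pi.
    have := const_angle ler01 cg (fun t ht => cos_sub1 (g1 t ht) (g1 0 i0)).
    by rewrite /g scale1r scale0r; lra.
  have e0 := hor 0 F i0 cF.
  have {}e0 := e0 (fun p => etrans (H0 _) (esym (lF.2 p))).
  have cL : continuous (mat_act A : plane R -> plane R) by rewrite /mat_act; cont.
  have e1 := hor 1 (mat_act A) i1 cL (fun p => etrans (H1 _) (toral_endo_pi p)).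
  have ver : T (1, 1) - T (0, 1) = T (1, 0) - T (0, 0).
    pose g (w : R) := T (1, w) - T (0, w).
    have cg : continuous g.
      by rewrite /g; cont; apply: (cont_comp cT); cont.
    have g1 w : 0 <= w <= 1 -> cos (g w) = 1.
      move=> hw; apply: cisK; rewrite -!TE// !Ki// scale1r scale0r.
      by congr (tcoord c (H (_, w))); rewrite -[zvec m n]add0r torus_piD.
    exact: const_angle ler01 cg (fun t ht => cos_sub1 (g1 t ht) (g1 0 i0)).
  rewrite coordB//; move: ver; rewrite e0 e1 => /mulfI e.
  have p2 : 2 * pi != 0 :> R by rewrite mulf_neq0// gt_eqF.
  have {}e := e p2.
  have A0 : mat_act A (0 : plane R) = 0.
    by have := mat_actZ 0 (0 : plane R); rewrite !scale0r.
  by rewrite -e A0; case: cc => ->; rewrite /= subr0.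
by apply: plane_eq; [apply: (key fst); left|apply: (key snd); right].
Qed.

Lemma lift_shift p m n : F (p + zvec m n) = F p + mat_act A (zvec m n).
Proof. by rewrite -lift_shift_basis -(lift_shift_const p) addrCA subrr addr0. Qed.

Lemma lift_near_linear : exists C, forall p, enorm (F p - mat_act A p) <= C.
Proof.
have cg : continuous (fun p => enorm (F p - mat_act A p)).
  apply: cont_enorm; apply: cont_add => //; apply: cont_opp.
  by rewrite /mat_act; cont.
have [p m n|C HC] := periodic_bounded cg.
  by rewrite lift_shift mat_actD opprD addrACA subrr addr0.
by exists C => p; rewrite -[enorm _]ger0_norm ?enorm_ge0.
Qed.

Lemma iter_lift_shift k m n : exists m' n', forall p,
  iter k F (p + zvec m n) = iter k F p + zvec m' n'.
Proof.
elim: k => [|k [m' [n' IH]]]; first by exists m, n.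
have [m2 [n2 e]] := mat_act_int m' n'.
by exists m2, n2 => p; rewrite /= IH lift_shift e.
Qed.

End Lattice.

(** * Derivatives of the iterates and hyperbolic splittings *)

Section TangentIteration.
Variable R : realType.
Implicit Types (p q v w : plane R).
Variables (f : torus R -> torus R) (F : plane R -> plane R) (A : 'M[int]_2).
Hypothesis lF : is_lift f F.
Hypothesis hA : is_linearization f A.
Hypothesis C1F : Ck 1 [set: plane R] F.

Let cF : continuous F := lF.1.

Lemma iter_differentiable n p : differentiable (iter n F) p.
Proof.
elim: n p => [|n IH] p; first by have [] := @is_diff_id R (plane R) p.
apply: (@differentiable_comp _ _ _ _ (iter n F) F) => //.
by have [dF _] := C1F; exact: dF.
Qed.

Lemma cont_iter n : continuous (iter n F).
Proof. by move=> p; apply: differentiable_continuous; exact: iter_differentiable. Qed.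

Lemma T0 p v : plane_iter F 0 p v = v.
Proof. by rewrite /plane_iter (_ : iter 0 F = id)// diff_val. Qed.

Lemma TS n p v :
  plane_iter F n.+1 p v = plane_iter F 1 (iter n F p) (plane_iter F n p v).
Proof.
rewrite /plane_iter (_ : iter 1 F = F)// (_ : iter n.+1 F = F \o iter n F)//.
have [dF _] := C1F.
exact: (congr1 (fun g : plane R -> plane R => g v)
  (diff_comp (iter_differentiable n p) (dF (iter n F p) I))).
Qed.

Lemma TD n m p v :
  plane_iter F (n + m) p v = plane_iter F m (iter n F p) (plane_iter F n p v).
Proof.
elim: m => [|m IH]; first by rewrite addn0 T0.
by rewrite addnS TS [in RHS]TS IH -iterD addnC.
Qed.

Lemma TaddE n p v w : plane_iter F n p (v + w) = plane_iter F n p v + plane_iter F n p w.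
Proof. by rewrite /plane_iter linearD. Qed.

Lemma TscaleE n p a v : plane_iter F n p (a *: v) = a *: plane_iter F n p v.
Proof. by rewrite /plane_iter linearZ. Qed.

Lemma T_basis n p v : plane_iter F n p v =
  v.1 *: plane_iter F n p (1, 0) + v.2 *: plane_iter F n p (0, 1).
Proof.
rewrite -!TscaleE -TaddE; congr (plane_iter F n p _).
by apply: plane_eq; rewrite !planeE /= ?mulr1 ?mulr0 ?addr0 ?add0r.
Qed.

Lemma cont_T1 (U : topologicalType) (a b : U -> plane R) : continuous a ->
  continuous b -> continuous (fun x => plane_iter F 1 (a x) (b x)).
Proof.
move=> ca cb; have [dF cD] := C1F.
rewrite [X in continuous X](_ : _ = fun x => (b x).1 *: 'D_(1, 0) F (a x) +
    (b x).2 *: 'D_(0, 1) F (a x)).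
  have cD1 v : continuous ('D_v F : plane R -> plane R) by move=> q; exact: cD.
  by cont; apply: (cont_comp (cD1 _)).
by apply/funext => x; rewrite T_basis !deriveE//; exact: dF.
Qed.

Lemma cont_T n (U : topologicalType) (a b : U -> plane R) : continuous a ->
  continuous b -> continuous (fun x => plane_iter F n (a x) (b x)).
Proof.
move=> ca cb; elim: n => [|n IH].
  by rewrite [X in continuous X](_ : _ = b)//; apply/funext => x; rewrite T0.
rewrite [X in continuous X](_ : _ = fun x => plane_iter F 1 (iter n F (a x)) (plane_iter F n (a x) (b x))).
  by apply: cont_T1 => //; apply: cont_comp => //; exact: cont_iter.
by apply/funext => x; rewrite TS.
Qed.

(** A lattice translation changes [iter n F] by a constant, so the difference quotients coincide. *)
Lemma T_periodic n p v k l : plane_iter F n (p + zvec R k l) v = plane_iter F n p v.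
Proof.
have [k' [l' H]] := iter_lift_shift lF hA n k l.
have e q : 'D_v (iter n F) q = plane_iter F n q v by exact: (deriveE v (iter_differentiable n q)).
apply: (etrans (esym (e _)) (etrans _ (e _))).
rewrite /derive.
set z := zvec R k l.
have -> // : (fun h : R => h^-1 *: ((iter n F \o shift (p + z)) (h *: v) - iter n F (p + z))) =
  (fun h : R => h^-1 *: ((iter n F \o shift p) (h *: v) - iter n F p)).
apply/funext => h; rewrite /= addrA !H opprD addrACA; congr (_ *: _).
by rewrite subrr addr0.
Qed.

Lemma tangent_iter_pi n p v : tangent_iter F n (torus_pi p) v = plane_iter F n p v.
Proof.
rewrite /tangent_iter; have /torus_piP[k [l ->]] := torus_pi_repr (torus_pi p).
exact: T_periodic.
Qed.

Lemma T1_bounded : exists2 L, 1 <= L & forall p v,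
  enorm (plane_iter F 1 p v) <= L * enorm v.
Proof.
pose g p := enorm (plane_iter F 1 p (1, 0)) + enorm (plane_iter F 1 p (0, 1)).
have cg : continuous g.
  by apply: cont_add; apply: cont_enorm; apply: cont_T; cont.
have [p m n|C HC] := periodic_bounded cg; first by rewrite /g !T_periodic.
exists (Num.max 1 C) => [|p v]; first by rewrite le_max lexx.
rewrite T_basis; apply: (le_trans (enormD _ _)); rewrite !enormZ.
have gC : g p <= Num.max 1 C.
  by rewrite le_max (le_trans (ler_norm _) (HC p)) orbT.
apply: le_trans (_ : g p * enorm v <= _); last by rewrite ler_wpM2r ?enorm_ge0.
rewrite /g mulrDl ![_ * enorm v]mulrC.
by apply: lerD; rewrite ler_wpM2r ?enorm_ge0 ?le_fst_enorm ?le_snd_enorm.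
Qed.

Lemma T_bounded : exists2 L, 1 <= L & forall n p v,
  enorm (plane_iter F n p v) <= L ^+ n * enorm v.
Proof.
have [L L1 HL] := T1_bounded; exists L => // n p v.
elim: n => [|n IH]; first by rewrite T0 mul1r.
rewrite TS exprS -mulrA; apply: (le_trans (HL _ _)).
by rewrite ler_wpM2l// (le_trans ler01).
Qed.

End TangentIteration.

Section Splittings.
Variable R : realType.
Variables (X : Type) (h : X -> X) (Dh : nat -> X -> plane R -> plane R).
Hypothesis DhD : forall n x v w, Dh n x (v + w) = Dh n x v + Dh n x w.
Variables (x : int -> X) (Eu Es : int -> set (plane R)).
Hypothesis spl : hyperbolic_splitting Dh x Eu Es.

Lemma expr_unbounded (l : R) M : 1 < l -> exists n, M < l ^+ n.
Proof.
move=> l1; have bern n : 1 + n%:R * (l - 1) <= l ^+ n.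
  elim: n => [|n IH]; first by rewrite mul0r addr0.
  have := mulr_ge0 (ler0n R n) (sqr_ge0 (l - 1)).
  have := ler_wpM2l (ltW (lt_trans ltr01 l1)) IH.
  have e : n.+1%:R = n%:R + 1 :> R by rewrite natr1.
  by rewrite [l ^+ n.+1]exprS e; lra.
exists (Num.truncn (`|M| / (l - 1))).+1; apply: lt_le_trans (bern _).
apply: le_lt_trans (ler_norm M) _.
have := truncnS_gt (`|M| / (l - 1)); rewrite ltr_pdivrMr ?subr_gt0//; lra.
Qed.

Lemma split_is_line i : is_line (Eu i) /\ is_line (Es i).
Proof. by case: spl => /(_ i)[]. Qed.

Lemma split_sum i v : exists v1 v2, [/\ Eu i v1, Es i v2 & v = v1 + v2].
Proof. by case: spl => /(_ i)[_ _ []]. Qed.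

Lemma line_scale (E : set (plane R)) a v : is_line E -> E v -> E (a *: v).
Proof. by move=> [e _ ->] [b _ <-]; exists (a * b); rewrite ?scalerA. Qed.

Lemma split_uniq i v : Eu i v -> Es i v -> v = 0.
Proof. by case: spl => /(_ i)[_ _ [_ E]] _ _ u s; have : [set 0] v by rewrite -E. Qed.

(** An unstable component would grow exponentially, while the stable one stays bounded. With
    [stable_bounded] this characterizes [Es i] without reference to the splitting or its
    constants. *)
Lemma bounded_stable i v M : (forall n, enorm (Dh n (x i) v) <= M) -> Es i v.
Proof.
move=> bd; have [u [s [Eui Esi vE]]] := split_sum i v.
suff u0 : u = 0 by rewrite vE u0 add0r.
apply/eqP/negP => /negP; rewrite -enorm_gt0 => u0.
have [_ _ [c [l [c0 l1 H]]]] := spl.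
have M0 : 0 <= M by exact: le_trans (enorm_ge0 _) (bd 0).
have [n ln] := expr_unbounded ((M + c * enorm s) * c / enorm u) l1.
have [/(_ _ Eui) hu /(_ _ Esi) hs] := H n i; last first.
have l0 : 0 < l ^+ n by rewrite exprn_gt0// (lt_trans ltr01).
have hs2 : enorm (Dh n (x i) s) <= c * enorm s.
  apply: (le_trans hs); rewrite ler_wpM2r ?enorm_ge0// ler_piMr ?(ltW c0)//.
  by rewrite invf_le1// exprn_ege1// ltW.
have := bd n; rewrite vE DhD => b.
have := enormD (Dh n (x i) u + Dh n (x i) s) (- Dh n (x i) s).
rewrite addrK enormN => tri.
have : M + c * enorm s < c^-1 * l ^+ n * enorm u.
  by rewrite -mulrA [c^-1 * _]mulrC ltr_pdivlMr// -ltr_pdivrMr.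
lra.
Qed.

Lemma stable_bounded i v : Es i v -> exists M, forall n, enorm (Dh n (x i) v) <= M.
Proof.
move=> Ev; have [_ _ [c [l [c0 l1 H]]]] := spl.
exists (c * enorm v) => n; have [_ /(_ _ Ev) hs] := H n i.
apply: (le_trans hs); rewrite ler_wpM2r ?enorm_ge0// ler_piMr ?(ltW c0)//.
by rewrite invf_le1 ?exprn_gt0 ?(lt_trans ltr01)// exprn_ege1// ltW.
Qed.

End Splittings.

(** * Uniform hyperbolicity of the lift *)

Section Expansivity.
Variable R : realType.
Implicit Types (p q v w : plane R).
Variables (f : torus R -> torus R) (F : plane R -> plane R) (A : 'M[int]_2).
Hypothesis lF : is_lift f F.
Hypothesis hA : is_linearization f A.
Hypothesis C1F : Ck 1 [set: plane R] F.
Hypothesis anF : anosov f F.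

Let T := plane_iter F.
Let TS' n p v : T n.+1 p v = T 1 (iter n F p) (T n p v) := TS C1F n p v.
Let TD' n m p v : T (n + m) p v = T m (iter n F p) (T n p v) := TD C1F n m p v.
Let Tper n p v k l : T n (p + zvec R k l) v = T n p v := T_periodic lF hA C1F n p v k l.

Definition fracp p : plane R := p - zvec R (Num.floor p.1) (Num.floor p.2).

Lemma fracp_le p : `|fracp p| <= 1.
Proof.
rewrite norm_plane_le /fracp !planeE /=.
have h1 := floor_itv p.1; have h2 := floor_itv p.2.
rewrite intrD1 in h1; rewrite intrD1 in h2.
by rewrite !ger0_norm; lra.
Qed.

Let Tfrac n p v : T n (fracp p) v = T n p v.
Proof.
have := Tper n (fracp p) v (Num.floor p.1) (Num.floor p.2).
by rewrite subrK => ->.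
Qed.

(** Being an integer is thus expressed by a closed condition on a continuous function, which passes
    to cluster points. *)
Lemma cos_int (x : R) : cos (2 * pi * x) = 1 -> exists k : int, x = k%:~R.
Proof.
have p0 := pi_gt0 R; move=> cx; exists (Num.floor x).
have h := floor_itv x; rewrite intrD1 in h.
set y := x - (Num.floor x)%:~R.
have cy : cos (2 * pi * y) = 1.
  apply: etrans cx; have [+ _] := cis_int y (Num.floor x).
  by rewrite /y subrK => ->.
have y0 : 0 <= y < 1 by rewrite /y; lra.
have [yz|yz] := eqVneq y 0; first by apply/eqP; rewrite -subr_eq0 -/y yz.
have yp : 0 < y by rewrite lt0r yz; case/andP: y0.
have [hy|hy] := leP (2 * y) 1.
  have : cos (2 * pi * y) < 1 by apply: cos_lt1; nra.
  by rewrite cy ltxx.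
have : cos (pi + pi - 2 * pi * y) < 1 by apply: cos_lt1; nra.
rewrite (_ : cos (pi + pi - 2 * pi * y) = cos (2 * pi * y)); last first.
  by rewrite (_ : _ - _ = - (2 * pi * y) + pi + pi) ?cosDpi ?opprK ?cosN//; ring.
by rewrite cy ltxx.
Qed.

(** Bounded forward orbits make every [w i] stable; contraction from time -n to time 0 then makes
    [w 0] arbitrarily small. The orbit is required only modulo the lattice, because hyperbolicity is
    assumed on the torus. The bound 4 covers vectors of sup norm at most 2. *)
Lemma no_bounded_orbit (x w : int -> plane R) :
  (forall i, exists m n, F (x i) = x (i + 1) + zvec R m n) ->
  (forall i, w (i + 1) = T 1 (x i) (w i)) ->
  (forall i, enorm (w i) <= 4) -> w 0 = 0.
Proof.
move=> orb cw bw; have [_ an] := anF.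
pose X i := torus_pi (x i).
have orbX : full_orbit f X.
  by move=> i; rewrite /X -lF.2; have [m [n ->]] := orb i; rewrite torus_piD.
have [Eu [Es spl]] := an X orbX.
have TX n i v : tangent_iter F n (X i) v = T n (x i) v by exact: (tangent_iter_pi lF hA C1F).
have wn n i : T n (x i) (w i) = w (i + n%:Z).
  elim: n i => [|n IH] i; first by rewrite addr0 /T T0.
  rewrite -[n.+1]add1n TD' -cw /=.
  have [k [l ->]] := orb i; rewrite Tper IH; congr w.
  by rewrite PoszD addrA.
have DD n (y : torus R) v v' : tangent_iter F n y (v + v') = tangent_iter F n y v + tangent_iter F n y v'.
  by rewrite /tangent_iter linearD.
have wEs i : Es i (w i).
  by apply: (bounded_stable DD spl (M := 4)) => n; rewrite TX wn.
have [_ _ [c [l [c0 l1 H]]]] := spl.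
apply/eqP/negP => /negP; rewrite -enorm_gt0 => w0.
have [n ln] := expr_unbounded (c * 4 / enorm (w 0)) l1.
have [_ /(_ _ (wEs _)) hs] := H n (- n%:Z).
move: hs; rewrite TX wn addNr; apply/negP; rewrite -ltNge.
have l0 : 0 < l ^+ n by rewrite exprn_gt0// (lt_trans ltr01).
apply: le_lt_trans (_ : c * l ^- n * 4 < _).
  by rewrite ler_wpM2l// mulr_ge0 ?(ltW c0)// invr_ge0 ltW.
by rewrite mulrAC ltr_pdivrMr// [enorm _ * _]mulrC -ltr_pdivrMr.
Qed.

(** Otherwise there are, for all [N], orbit segments of length [2 * N] carrying tangent vectors of
    norm below 2, equal to 1 at the middle. Centred there and reduced modulo the lattice, they have
    a cluster point by Tychonoff's theorem: a full bounded tangent orbit of norm 1 at time 0. *)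
Lemma expansivity : exists N : nat, forall p w, T N p w != 0 ->
  exists2 j, (j <= 2 * N)%N & 2 * enorm (T N p w) <= enorm (T j p w).
Proof.
apply: contrapT => neg.
have bad (N : nat) : exists pw : plane R * plane R, enorm (T N pw.1 pw.2) = 1 /\
    forall j, (j <= 2 * N)%N -> enorm (T j pw.1 pw.2) < 2.
  apply: contrapT => nb; apply: neg; exists N => p w Tw.
  apply: contrapT => nj; apply: nb.
  have e0 : 0 < enorm (T N p w) by rewrite enorm_gt0.
  exists (p, (enorm (T N p w))^-1 *: w) => /=; split.
    by rewrite /T TscaleE enormZ gtr0_norm ?invr_gt0// mulVf// gt_eqF.
  move=> j jN; rewrite /T TscaleE enormZ gtr0_norm ?invr_gt0// mulrC ltr_pdivrMr//.
  by rewrite ltNge; apply/negP => h; apply: nj; exists j.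
have /choice[pw pwE] := bad.
(* The value outside the segment is harmless: each [i] is inside as soon as [N] is large. *)
pose z (N : nat) (i : int) : plane R * plane R :=
  if (- N%:Z <= i <= N%:Z) then
    let k := absz (N%:Z + i) in (fracp (iter k F (pw N).1), T k (pw N).1 (pw N).2)
  else (0, 0).
pose Q : set (plane R * plane R) := [set y | `|y.1| <= 1] `&` [set y | `|y.2| <= 2].
have cQ : compact Q.
  have := compact_setX (@compact_square R 1) (@compact_square R 2).
  by congr compact; apply/seteqP; split => -[a b] [].
have zQ N i : Q (z N i).
  rewrite /z; case: ifP => [Ni|_]; last by split; rewrite /= normr0.
  split; rewrite /= ?fracp_le//.
  apply: (le_trans (norm_le_enorm _)); apply/ltW.
  have [_] := pwE N; apply.
  by move: Ni => /andP[]; lia.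
pose PT := prod_topology (fun _ : int => (plane R * plane R)%type).
have [zz [_ clz]] : [set y : PT | forall i, Q (y i)] `&` cluster ((z : nat -> PT) @ \oo) !=set0.
  apply: (tychonoff (fun _ : int => cQ) (F := (z : nat -> PT) @ \oo)).
  by exists 0%N => // N _; exact: zQ.
have ev i : continuous (fun y : PT => y i).
  exact: (@proj_continuous int (fun=> (plane R * plane R)%type) i).
(* Equations between continuous functions that hold eventually along [z] hold at the cluster point;
   no convergent subsequence is needed. *)
have lim (g : PT -> R) a N0 : continuous g ->
    (forall N, (N0 <= N)%N -> g (z N) = a) -> g zz = a.
  move=> cg gz; apply: contrapT => nga.
  have op : open (~` [set x : R | x = a]) by apply: closed_openC; exact: closed_eq.
  have nb : nbhs zz (g @^-1` (~` [set x : R | x = a])).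
    by apply: cg; apply: open_nbhs_nbhs; split.
  have fz : (z @ \oo) [set y | g y = a].
    by exists N0 => // N; exact: gz.
  by have [y [/= e1 e2]] := clz _ _ fz nb.
have lim2 (g : PT -> R) a : continuous g ->
    (forall N, g (z N) <= a) -> g zz <= a.
  move=> cg gz; have cm : continuous (fun y : PT => Num.max (g y) a).
    rewrite (_ : (fun y => _) = fun y => ((g y + a) + `|g y - a|) / 2); first by cont.
    apply/funext => y; case: (leP (g y) a) => h.
      by rewrite ler0_norm; lra.
    by rewrite gtr0_norm; lra.
  have := lim _ a 0%N cm (fun N _ => max_idPr (gz N)).
  by move=> <-; rewrite le_max lexx.
have zE N i : (absz i < N)%N ->
    z N i = (fracp (iter (absz (N%:Z + i)) F (pw N).1), T (absz (N%:Z + i)) (pw N).1 (pw N).2).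
  by move=> iN; rewrite /z ifT//; lia.
have c1 i : continuous (fun y : PT => (y i).1) by apply: cont_fst.
have c2 i : continuous (fun y : PT => (y i).2) by apply: cont_snd.
have w0 : (zz 0).2 = 0.
  apply: (@no_bounded_orbit (fun i => (zz i).1) (fun i => (zz i).2)).
  - move=> i.
    have key c : is_coord c -> exists k : int, c (F (zz i).1 - (zz (i + 1)).1) = k%:~R.
      move=> cc; apply: cos_int.
      pose g (y : PT) := cos (2 * pi * c (F (y i).1 - (y (i + 1)).1)).
      apply: (lim g 1 (absz i).+2).
        rewrite /g; apply: cont_cos; apply: cont_mul; first by cont.
        apply: (cont_comp (coord_cont cc)); apply: cont_add; last by apply: cont_opp.
        exact: (cont_comp lF.1).
      move=> N iN; rewrite /g !zE; [|lia|lia].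
      rewrite (_ : absz (N%:Z + (i + 1))= (absz (N%:Z + i)).+1); last by lia.
      set q := iter _ F _; rewrite [iter _.+1 _ _]/= -/q /=.
      have [m [n qE]] : exists m n, F q = F (fracp q) + zvec R m n.
        by have := lift_int lF (fracp q) (Num.floor q.1) (Num.floor q.2); rewrite subrK.
      pose a := Num.floor (F q).1; pose b := Num.floor (F q).2.
      have -> : F (fracp q) - fracp (F q) = zvec R (a - m) (b - n).
        have -> : fracp (F q) = F q - zvec R a b by [].
        by rewrite qE; apply: plane_eq; rewrite !planeE /= intrB; ring.
      have [k ->] := coord_zvec (a - m) (b - n) cc.
      by have [+ _] := @cis_int R 0 k; rewrite add0r mulr0 cos0.
    have [k e1] := key fst (or_introl erefl); have [l e2] := key snd (or_intror erefl).
    by exists k, l; apply: plane_eq; rewrite !planeE /= -?e1 -?e2 !planeE addrC subrK.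
  - move=> i; apply/eqP; rewrite -subr_eq0 -enorm_eq0; apply/eqP.
    pose g (y : PT) := enorm ((y (i + 1)).2 - T 1 (y i).1 (y i).2).
    apply: (lim g 0 (absz i).+2).
      rewrite /g; apply: cont_enorm; apply: cont_add => //; apply: cont_opp.
      exact: cont_T.
    move=> N iN; rewrite /g !zE; [|lia|lia].
    rewrite (_ : absz (N%:Z + (i + 1))= (absz (N%:Z + i)).+1); last by lia.
    by rewrite /= TS' Tfrac subrr enorm0.
  - move=> i; apply: (lim2 (fun y : PT => enorm (y i).2)); first exact: cont_enorm.
    move=> N; have [_ h] := zQ N i; apply: (le_trans (enorm_le_norm _)); rewrite /= in h; lra.
have : enorm (zz 0).2 = 1.
  apply: (lim (fun y : PT => enorm (y 0).2) 1 1%N); first exact: cont_enorm.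
  by move=> N N1; rewrite zE// addr0 /=; have [] := pwE N.
by rewrite w0 enorm0 => /eqP; rewrite eq_sym oner_eq0.
Unshelve. all: by end_near. Qed.

End Expansivity.

Lemma line_coord (R : realType) (w v : plane R) : enorm w = 1 -> det2 w v = 0 -> v = dot2 w v *: w.
Proof.
move=> w1 dv; have := sq_enorm w; rewrite w1 expr1n => ee.
have e1 : v.1 = dot2 w v * w.1 - det2 w v * w.2.
  by rewrite -[LHS]mul1r ee /dot2 /det2; ring.
have e2 : v.2 = dot2 w v * w.2 + det2 w v * w.1.
  by rewrite -[LHS]mul1r ee /dot2 /det2; ring.
by apply: plane_eq; rewrite !planeE; [rewrite e1|rewrite e2]; rewrite dv mul0r ?subr0 ?addr0.
Qed.

Lemma cramer (R : realType) (s u e : plane R) : det2 s u != 0 ->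
  e = (det2 e u / det2 s u) *: s + (det2 s e / det2 s u) *: u.
Proof.
case: s u e => [s1 s2] [u1 u2] [e1 e2]; rewrite /det2 /= => d0.
by apply: plane_eq; rewrite !planeE /=; field.
Qed.

Lemma periodic_unif (R : realType) (g : plane R -> plane R) : continuous g ->
  (forall p k l, g (p + zvec R k l) = g p) -> forall h, 0 < h ->
  exists2 d, 0 < d & forall p q, `|p - q| < d -> `|g p - g q| < h.
Proof.
move=> cg per h h0.
have [d d0 Hd] := heine (@compact_square R 1) (fun p _ => cg p) h0.
exists d => // p q pq.
pose z := zvec R (Num.floor p.1) (Num.floor p.2).
have := Hd (p - z) (q - z) (fracp_le p).
rewrite opprB addrA subrK => /(_ pq).
by rewrite -(per (p - z) (Num.floor p.1) (Num.floor p.2)) -(per (q - z) (Num.floor p.1) (Num.floor p.2)) !subrK.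
Qed.

Lemma solve_summand (R : realType) (x y z v : plane R) a b :
  y = a *: z + b *: v -> b *: v = x - (x - y) - a *: z.
Proof. by rewrite subKr => ->; rewrite addrC addKr. Qed.

(** * Uniform bounds, uniform angle and the stable line field *)

Section UniformHyperbolicity.
Variable R : realType.
Implicit Types (p q v w : plane R).
Variables (f : torus R -> torus R) (F : plane R -> plane R) (A : 'M[int]_2).
Hypothesis lF : is_lift f F.
Hypothesis hA : is_linearization f A.
Hypothesis C1F : Ck 1 [set: plane R] F.
Hypothesis anF : anosov f F.
Hypothesis splF : forall p, exists x Eu Es,
  [/\ full_orbit F x, x 0 = p & hyperbolic_splitting (plane_iter F) x Eu Es].

Let T := plane_iter F.
Local Opaque plane_iter.
Let TS' n p v : T n.+1 p v = T 1 (iter n F p) (T n p v) := TS C1F n p v.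
Let TD' n m p v : T (n + m) p v = T m (iter n F p) (T n p v) := TD C1F n m p v.
Let Tper n p v k l : T n (p + zvec R k l) v = T n p v := T_periodic lF hA C1F n p v k l.
Let Tadd n p v w : T n p (v + w) = T n p v + T n p w := TaddE F n p v w.
Let Tscale n p a v : T n p (a *: v) = a *: T n p v := TscaleE F n p a v.

(** Intrinsic form of the stable line: it involves the forward orbit only, so it does not depend on
    a choice of past and is periodic. *)
Definition fwd_bounded p v := exists M, forall n, enorm (T n p v) <= M.

Lemma fwd_boundedP x Eu Es i v : hyperbolic_splitting (plane_iter F) x Eu Es ->
  Es i v <-> fwd_bounded (x i) v.
Proof.
move=> spl; split=> [/(stable_bounded spl)//|[M HM]].
exact: (bounded_stable Tadd spl HM).
Qed.

Lemma fwd_bounded_scale p a v : fwd_bounded p v -> fwd_bounded p (a *: v).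
Proof.
move=> [M HM]; exists (`|a| * M) => n.
by rewrite Tscale enormZ ler_wpM2l.
Qed.

Lemma fwd_bounded_iter n p v : fwd_bounded p v -> fwd_bounded (iter n F p) (T n p v).
Proof. by move=> [M HM]; exists M => m; rewrite -TD'. Qed.

Lemma fwd_bounded_periodic p v k l : fwd_bounded (p + zvec R k l) v <-> fwd_bounded p v.
Proof. by split=> -[M HM]; exists M => n; have := HM n; rewrite Tper. Qed.

(** If the norm exceeds [L ^+ N * enorm v], the time is at least [N], and expansivity centred there
    yields a time where the norm has doubled. That time is again at least [N], so the doubling
    repeats forever and the orbit is unbounded. *)
Lemma stable_bound : exists2 K, 1 <= K & forall p v, fwd_bounded p v ->
  forall n, enorm (T n p v) <= K * enorm v.
Proof.
have [N HN] := expansivity lF hA C1F anF; have [L L1 HL] := T_bounded lF hA C1F.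
exists (L ^+ N); first exact: exprn_ege1.
move=> p v [M HM] n; rewrite leNgt; apply/negP => big.
have LN k : (k <= N)%N -> enorm (T k p v) <= L ^+ N * enorm v.
  move=> kN; apply: (le_trans (HL _ _ _)); rewrite ler_wpM2r ?enorm_ge0//.
  exact: ler_weXn2l.
have T0v : 0 < enorm (T n p v).
  by apply: le_lt_trans big; rewrite mulr_ge0 ?enorm_ge0// exprn_ge0// (le_trans ler01).
have step i : exists2 k, (N <= k)%N & 2 ^+ i * enorm (T n p v) <= enorm (T k p v).
  have late k : L ^+ N * enorm v < enorm (T k p v) -> (N <= k)%N.
    by move=> h; rewrite leqNgt; apply/negP => /ltnW/LN; rewrite leNgt h.
  elim: i => [|i [k Nk IH]]; first by exists n; [exact: late|rewrite mul1r].
  have := HN (iter (k - N) F p) (T (k - N) p v).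
  rewrite -/T -TD' subnK// => H.
  have Tk0 : T k p v != 0.
    by rewrite -enorm_gt0; apply: lt_le_trans IH; rewrite mulr_gt0// exprn_gt0.
  have [j _ Hj] := H Tk0; rewrite -/T -TD' in Hj.
  have Hj2 : 2 ^+ i.+1 * enorm (T n p v) <= enorm (T (k - N + j) p v).
    by apply: le_trans Hj; rewrite exprS -mulrA ler_wpM2l.
  exists (k - N + j)%N => //; apply: late; apply: (lt_le_trans big).
  apply: le_trans Hj2; by rewrite ler_peMl ?enorm_ge0// exprn_ege1// ler1n.
have [i Mi] := @expr_unbounded R 2 (M / enorm (T n p v)) ltac:(by rewrite ltr1n).
have [k _ hk] := step i; have := HM k; rewrite leNgt => /negP; apply.
by apply: lt_le_trans hk; rewrite -ltr_pdivrMr.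
Qed.

(* An unstable vector close to the stable line could not grow for a long time
   in the future, and it is bounded in the past: by expansivity its orbit would
   have to grow without bound in the past. *)
Lemma uniform_angle : exists2 al, 0 < al & forall x Eu Es u e,
  full_orbit F x -> hyperbolic_splitting (plane_iter F) x Eu Es -> Eu 0 u ->
  enorm u = 1 -> fwd_bounded (x 0) e -> enorm e = 1 -> al <= `|det2 e u|.
Proof.
have [N HN] := expansivity lF hA C1F anF; have [L L1 HL] := T_bounded lF hA C1F.
have [K K1 HK] := stable_bound.
have [I KI] := @expr_unbounded R 2 (2 * K) ltac:(by rewrite ltr1n).
pose M := (N * I)%N.
have LM0 : 0 < L ^+ M by rewrite exprn_gt0// (lt_le_trans ltr01).
(* [I] doublings pass the bound [2 * K], each moving the time by at most [N]. A vector this close to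
   the stable line is still bounded by [2 * K] up to time [M = N * I]. *)
exists (K / L ^+ M); first by rewrite divr_gt0// (lt_le_trans ltr01).
move=> x Eu Es u e ox spl Eu0 u1 be e1; rewrite leNgt; apply/negP => small.
have orb n i : iter n F (x i) = x (i + n%:Z).
  elim: n => [|n IH]; first by rewrite addr0.
  by rewrite /= IH ox; congr x; lia.
have orb0 n : iter n F (x 0) = x n%:Z by rewrite orb; congr x; lia.
have [_ inv [c [l [c0 l1 H]]]] := spl.
have fut j : (j <= M)%N -> enorm (T j (x 0) u) <= 2 * K.
  move=> jM; pose r : plane R := (- e.2, e.1).
  have r1 : enorm r = 1 by rewrite /enorm /= sqrrN addrC -/(enorm e).
  have uE : u = dot2 e u *: e + det2 e u *: r.
    have := sq_enorm e; rewrite e1 expr1n => ee.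
    by apply: plane_eq; rewrite !planeE -[LHS]mul1r ee /dot2 /det2 /r /=; ring.
  rewrite uE Tadd (le_trans (enormD _ _))// (_ : 2 * K = K + K); last by ring.
  apply: lerD; rewrite Tscale enormZ.
    have := HK _ _ be j; rewrite e1 mulr1 => h.
    have d1 : `|dot2 e u| <= 1 by have := le_dot2 e u; rewrite e1 u1 mulr1.
    by have := enorm_ge0 (T j (x 0) e); have := normr_ge0 (dot2 e u); nra.
  have h : enorm (T j (x 0) r) <= L ^+ M.
    apply: (le_trans (HL _ _ _)); rewrite r1 mulr1; exact: ler_weXn2l.
  apply: le_trans (_ : K / L ^+ M * L ^+ M <= _); last by rewrite divfK ?gt_eqF.
  by apply: ler_pM => //; [exact: enorm_ge0|exact: ltW].
have pre i v : exists w, Eu (i + 1) v -> Eu i w /\ T 1 (x i) w = v.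
  have [Ev|nEv] := pselect (Eu (i + 1) v); last by exists 0.
  have [eqE _] := inv i; have : (plane_iter F 1 (x i) @` Eu i) v by rewrite eqE.
  by move=> [w Ew wv]; exists w.
have /choice[g0 g0E] : forall iv : int * plane R, exists w,
    Eu (iv.1 + 1) iv.2 -> Eu iv.1 w /\ T 1 (x iv.1) w = iv.2.
  by move=> [i v]; exact: pre.
pose back := fix back (n : nat) : plane R :=
  if n is n'.+1 then g0 (- n'.+1%:Z, back n') else u.
have backE n : Eu (- n%:Z) (back n).
  elim: n => [|n IH]; first by rewrite oppr0.
  have [] // := g0E (- n.+1%:Z, back n).
  by rewrite /= (_ : - n.+1%:Z + 1 = - n%:Z)//; lia.
have back1 n : T 1 (x (- n.+1%:Z)) (back n.+1) = back n.
  have [|//] := g0E (- n.+1%:Z, back n).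
  by rewrite /= (_ : - n.+1%:Z + 1 = - n%:Z)//; lia.
(* The full tangent orbit of [u]: iterates for [t >= 0], preimages inside [Eu] for [t < 0]. *)
pose W (t : int) := match t with Posz n => T n (x 0) u | Negz n => back n.+1 end.
have W0 : W 0 = u by exact: (T0 F (x 0) u).
have W1 t : T 1 (x t) (W t) = W (t + 1).
  case: t => [n|[|n]].
  - by rewrite /W -PoszD addn1 (TS' n) orb0.
  - by rewrite /W NegzE back1 /= /T T0.
  - rewrite /W (_ : Negz n.+1 + 1 = Negz n); last by lia.
    by rewrite NegzE back1.
have Wn n t : T n (x t) (W t) = W (t + n%:Z).
  elim: n => [|n IH]; first by rewrite /T T0 addr0.
  by rewrite TS' orb IH W1; congr W; lia.
have past n : enorm (back n) <= c.
  have [/(_ _ (backE n)) h _] := H n (- n%:Z).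
  have WB : W (- n%:Z) = back n by case: n {h} => [|n] //=; rewrite oppr0 W0.
  have : T n (x (- n%:Z)) (back n) = u.
    by rewrite -WB Wn addNr.
  move: h; rewrite -/T => + e2; rewrite e2 u1 -mulrA ler_pdivrMl// mulr1 => h.
  apply: le_trans h; rewrite ler_peMl ?enorm_ge0//.
  by rewrite exprn_ege1// ltW.
(* A doubling may advance the time by at most [N]. Once the norm exceeds [2 * K], [fut] makes the
   time negative, so it never passes [N * I] again. *)
have step i : exists2 t : int, t <= (N * minn i I)%:Z & 2 ^+ i <= enorm (W t).
  elim: i => [|i [t tM IH]].
    by exists 0 => //; rewrite W0 u1.
  have Wt0 : W t != 0 by rewrite -enorm_gt0; apply: lt_le_trans IH; rewrite exprn_gt0.
  have := HN (x (t - N%:Z)) (W (t - N%:Z)).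
  rewrite -/T Wn subrK => /(_ Wt0)[j jN]; rewrite -/T Wn => Hj.
  have Wj : 2 ^+ i.+1 <= enorm (W (t - N%:Z + j%:Z)).
    by apply: le_trans Hj; rewrite exprS ler_wpM2l.
  exists (t - N%:Z + j%:Z) => //.
  have [iI|iI] := ltnP i I.
    move: tM jN; rewrite (minn_idPl (ltnW iI)) (minn_idPl iI) mulnS.
    by move: (N * i)%N => Ni; clear; lia.
  have big : 2 * K < enorm (W t).
    by apply: lt_le_trans KI (le_trans _ IH); rewrite ler_weXn2l// ler1n.
  rewrite (minn_idPr iI) in tM; rewrite (minn_idPr (leqW iI)).
  have tneg : t < 0.
    rewrite ltNge; apply/negP => t0.
    have [n tn] : exists n : nat, t = n%:Z by exists (absz t); rewrite gez0_abs.
    have nM : (n <= M)%N by move: tM; rewrite tn lez_nat.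
    have WE : W t = T n (x 0) u by rewrite tn.
    by have := fut n nM; rewrite -WE leNgt big.
  have I0 : (0 < I)%N.
    by rewrite lt0n; apply/eqP => I0; move: KI; rewrite I0 expr0; lra.
  have : (N <= N * I)%N by rewrite leq_pmulr.
  move: (N * I)%N jN tneg => NI; clear; lia.
have [i ci] := @expr_unbounded R 2 (Num.max c (2 * K)) ltac:(by rewrite ltr1n).
have [t tM ht] := step i.
move: ci; rewrite gt_max => /andP[ci ki].
case: t tM ht => n tM; rewrite /W => ht.
  have : (n <= M)%N.
    move: tM; rewrite lez_nat => /leq_trans; apply.
    by rewrite /M leq_mul2l geq_minr orbT.
  by move=> /fut; lra.
by have := past n.+1; lra.
Qed.

Lemma stable_dir_exists p : exists2 e, enorm e = 1 & fwd_bounded p e.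
Proof.
have [x [Eu [Es [ox x0 spl]]]] := splF p.
have [_ [e e0 EsE]] := split_is_line spl 0.
exists ((enorm e)^-1 *: e).
  by rewrite enormZ gtr0_norm ?invr_gt0 ?enorm_gt0// mulVf ?enorm_eq0.
rewrite -x0; apply/(fwd_boundedP _ _ spl); rewrite EsE.
by exists (enorm e)^-1.
Qed.

Lemma stable_unique p v w : fwd_bounded p v -> fwd_bounded p w -> det2 v w = 0.
Proof.
have [x [Eu [Es [ox x0 spl]]]] := splF p; rewrite -x0.
move=> /(fwd_boundedP _ _ spl) + /(fwd_boundedP _ _ spl).
have [_ [e e0 ->]] := split_is_line spl 0.
by move=> [a _ <-] [b _ <-]; rewrite /det2 !planeE; ring.
Qed.

(** A unit vector of the stable line with an arbitrary sign; continuity and periodicity are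
    therefore stated for [dbl (es p)]. *)
Definition es p : plane R := sval (cid2 (stable_dir_exists p)).

Lemma es1 p : enorm (es p) = 1.
Proof. by rewrite /es; case: cid2. Qed.

Lemma esP p : fwd_bounded p (es p).
Proof. by rewrite /es; case: cid2. Qed.

Local Opaque es.

Lemma fwd_bounded_es p v : fwd_bounded p v -> exists a, v = a *: es p.
Proof.
move=> bv; exists (dot2 (es p) v).
by apply: line_coord (es1 p) _; exact: stable_unique (esP p) bv.
Qed.

Lemma dbl_es_periodic p k l : dbl (es (p + zvec R k l)) = dbl (es p).
Proof.
apply/eqP; rewrite -subr_eq0 -enorm_eq0 norm_dblB ?es1//.
have b1 : fwd_bounded p (es (p + zvec R k l)).
  exact: (fwd_bounded_periodic p _ k l).1 (esP (p + zvec R k l)).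
by rewrite (stable_unique b1 (esP p)) normr0 mulr0.
Qed.

(** Decompose [es q] into a stable and an unstable part at [p]. For a fixed large [n] and [q] near
    [p], the n-th derivatives at [p] and [q] are close, so the image at [p] of [es q] is bounded; as
    the unstable part is expanded by about [l ^+ n], it is small. *)
Lemma cont_dbl_es : continuous (fun p => dbl (es p)).
Proof.
have [K K1 HK] := stable_bound.
move=> p; apply/cvgrPdist_lt => h h0.
have [x [Eu [Es [ox x0 spl]]]] := splF p.
have [[e' e'0 EuE] _] := split_is_line spl 0.
pose u := (enorm e')^-1 *: e'.
have u1 : enorm u = 1.
  by rewrite enormZ gtr0_norm ?invr_gt0 ?enorm_gt0// mulVf ?enorm_eq0.
have Eu0 : Eu 0 u by rewrite EuE; exists (enorm e')^-1.
have du : det2 (es p) u != 0.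
  have [al al0 Hal] := uniform_angle.
  rewrite -normr_gt0; apply: (lt_le_trans al0).
  by apply: (Hal x Eu Es) => //; rewrite ?x0 ?es1//; exact: esP.
(* [B] collects the image of [es q] ([K]), the change of base point (1) and the stable part, whose
   coefficient is at most [1 / |d|]. *)
pose d := det2 (es p) u; pose B := K + 1 + K / `|d|.
have [_ _ [c [l [c0 l1 H]]]] := spl.
have [n ln] := expr_unbounded (2 * c * B / h) l1.
have cT' v : continuous (fun q => T n q v) by apply: cont_T => //; cont.
have near1 v : \forall q \near p, enorm (T n q v - T n p v) < 1 / 2.
  have cc : continuous (fun q => enorm (T n q v - T n p v)).
    by apply: cont_enorm; apply: cont_add; [exact: cT'|cont].
  have /cvgrPdist_lt/(_ (1/2) ltac:(by lra)) := cc p.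
  apply: filterS => q; move: (T n q v) => Tq.
  by rewrite subrr enorm0 sub0r normrN ger0_norm ?enorm_ge0.
apply: filterS2 (near1 (1, 0)) (near1 (0, 1)) => q q1 q2.
apply: (le_lt_trans (norm_le_enorm _)); rewrite norm_dblB ?es1//.
set e := es q.
have close : enorm (T n q e - T n p e) <= 1.
  rewrite /T (T_basis F n q) (T_basis F n p) -/T opprD addrACA -!scalerBr.
  apply: (le_trans (enormD _ _)); rewrite !enormZ.
  have h1 := le_fst_enorm e; have h2 := le_snd_enorm e; rewrite es1 in h1 h2.
  have := normr_ge0 e.1; have := normr_ge0 e.2.
  have := enorm_ge0 (T n q (1, 0) - T n p (1, 0)).
  have := enorm_ge0 (T n q (0, 1) - T n p (0, 1)).
  nra.
pose a := det2 e u / d; pose b := det2 (es p) e / d.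
have eE : e = a *: es p + b *: u.
  exact: cramer.
have Tb : `|b| * (c^-1 * l ^+ n) <= B.
  have Tu : c^-1 * l ^+ n <= enorm (T n p u).
    by have [/(_ _ Eu0)] := H n 0; rewrite u1 mulr1 x0.
  apply: le_trans (_ : enorm (b *: T n p u) <= _).
    by rewrite enormZ ler_wpM2l.
  have -> : b *: T n p u = T n q e - (T n q e - T n p e) - a *: T n p (es p).
    have Te : T n p e = a *: T n p (es p) + b *: T n p u.
      rewrite eE. rewrite (Tadd n p). by rewrite (Tscale n p a) (Tscale n p b).
    exact: (solve_summand (T n q e) Te).
  apply: (le_trans (enormD _ _)); rewrite enormN /B; apply: lerD.
    apply: (le_trans (enormD _ _)); rewrite enormN; apply: lerD => //.
    by have := HK _ _ (esP q) n; rewrite es1 mulr1.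
  rewrite enormZ mulrC; have := HK _ _ (esP p) n; rewrite es1 mulr1 => h1.
  rewrite /a normrM normfV; apply: ler_pM => //; first exact: enorm_ge0.
  by rewrite ler_piMl ?invr_ge0//; have := le_det2 e u; rewrite es1 u1 mulr1.
have l0 : 0 < l ^+ n by rewrite exprn_gt0// (lt_trans ltr01).
have bB : `|b| <= c * B / l ^+ n.
  rewrite ler_pdivlMr// -ler_pdivrMl//; apply: le_trans Tb.
  by rewrite mulrCA mulrA.
have db : `|det2 (es p) e| <= `|b|.
  rewrite /b normrM normfV ler_pdivlMr ?normr_gt0// ler_piMr//.
  by have := le_det2 (es p) u; rewrite es1 u1 mulr1.
apply: le_lt_trans (_ : 2 * (c * B / l ^+ n) < _).
  by rewrite ler_wpM2l// (le_trans db).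
by rewrite mulrA ltr_pdivrMr// mulrA [h * _]mulrC -ltr_pdivrMr.
Qed.

Lemma stable_field_unif : unif_line_field es.
Proof.
split=> [p|h h0]; first exact: es1.
have [d d0 Hd] := periodic_unif cont_dbl_es dbl_es_periodic h0.
exists d => // p q /Hd lt.
have := enorm_le_norm (dbl (es p) - dbl (es q)); rewrite norm_dblB ?es1//; lra.
Qed.

End UniformHyperbolicity.

(** * Arcs and densities *)

Section Arcs.
Variable R : realType.
Implicit Types (p q v w : plane R) (g : R -> plane R).

Lemma is_derive_fst g t v : is_derive t (1 : R) g v ->
  is_derive t (1 : R) (fun x => (g x).1) v.1 /\ is_derive t (1 : R) (fun x => (g x).2) v.2.
Proof.
move=> [dg vE].
have cv : h^-1 *: ((g \o shift t) (h *: 1) - g t) @[h --> 0^'] --> v by rewrite -vE.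
split; apply: DeriveDef.
- apply/cvg_ex; exists v.1.
  exact: (cvg_comp _ _ cv (cvg_fst : fst @ v --> v.1)).
- apply: cvg_lim => //.
  exact: (cvg_comp _ _ cv (cvg_fst : fst @ v --> v.1)).
- apply/cvg_ex; exists v.2.
  exact: (cvg_comp _ _ cv (cvg_snd : snd @ v --> v.2)).
- apply: cvg_lim => //.
  exact: (cvg_comp _ _ cv (cvg_snd : snd @ v --> v.2)).
Qed.

Lemma is_derive_plane g t v : is_derive t (1 : R) (fun x => (g x).1) v.1 ->
  is_derive t (1 : R) (fun x => (g x).2) v.2 -> is_derive t (1 : R) g v.
Proof.
move=> [d1 e1] [d2 e2].
have cv1 (f : R -> R) (l : R) : derivable f t 1 -> 'D_1 f t = l ->
    h^-1 *: ((f \o shift t) (h *: 1) - f t) @[h --> 0^'] --> l by move=> d <-.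
have cv : h^-1 *: ((g \o shift t) (h *: 1) - g t) @[h --> 0^'] --> v.
  have -> : v = (v.1, v.2) by case: (v).
  rewrite (_ : (fun h => _) = fun h : R => (h^-1 *: (((fun x => (g x).1) \o shift t) (h *: 1) - (g t).1),
     h^-1 *: (((fun x => (g x).2) \o shift t) (h *: 1) - (g t).2))).
    by apply: (cvg_pair (F := 0^') (G := nbhs v.1) (H := nbhs v.2)); [exact: cv1 d1 e1|exact: cv1 d2 e2].
  by apply/funext => h; apply: plane_eq; rewrite ?planeE.
by apply: DeriveDef; [apply/cvg_ex; exists v|exact: cvg_lim].
Qed.

Lemma C1curveP g g' : C1curve g g' <-> continuous g' /\ forall t : R, is_derive t (1 : R) g (g' t).
Proof.
split=> -[cg' dg]; split=> // t; first by have [] := dg t; exact: is_derive_plane.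
exact: is_derive_fst.
Qed.

Lemma C1curve_arc (a : Defs.arc R) : C1curve a ('D_1 a).
Proof.
apply/C1curveP; have [da ca] := arc_C1 a; split=> t; first exact: ca.
by apply: DeriveDef => //; apply/derivable1_diffP; exact: da.
Qed.

Lemma arc_of_curve g g' : C1curve g g' ->
  (forall t, 0 <= t <= 1 -> g' t != 0) ->
  (forall s t, 0 <= s <= 1 -> 0 <= t <= 1 -> g s = g t -> s = t) ->
  exists a : Defs.arc R, (a : R -> plane R) = g /\ 'D_1 a = g'.
Proof.
move=> C reg inj; have [cg' dg] := (C1curveP g g').1 C.
have D1t (t : R) : 'D_1 g t = g' t by rewrite (@derive_val _ _ _ _ _ _ _ (dg t)).
have D1 : 'D_1 g = g' by apply/funext.
have dif (t : R) : differentiable g t by apply/derivable1_diffP; have [] := dg t.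
have C1g : Ck 1 [set: R] g.
  split=> [t _|v]; first exact: dif.
  move=> t _; have -> : 'D_v g = fun s => v *: g' s.
    apply/funext => s; rewrite (deriveE _ (dif s)) -D1 (deriveE _ (dif s)).
    by rewrite -linearZ; congr ('d g s _); rewrite /GRing.scale /= mulr1.
  by have c : continuous (fun s => v *: g' s); [cont|exact: c].
have i : {in `[0, 1] &, injective g}.
  by move=> s t; rewrite !in_itv /= => hs ht; exact: inj.
have r t : t \in `[0, 1] -> 'D_1 g t != 0 by rewrite in_itv /= D1t; exact: reg.
by exists (Defs.Arc C1g i r).
Qed.

Lemma C1curve_affine g g' (s k : R) : C1curve g g' ->
  C1curve (fun t => g (s + t * k)) (fun t => k *: g' (s + t * k)).
Proof.
move=> [cg' dg]; split.
  by cont; apply: (cont_comp cg'); cont.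
have dl (t : R) : is_derive t 1 (fun t => s + t * k) k.
  by apply: is_derive_eq; rewrite scaler0 !add0r mul1r; exact: mulr1.
move=> t; rewrite !planeE ![k * _.1]mulrC ![k * _.2]mulrC; split.
  exact: (is_derive1_comp (f := fun x => (g x).1) (dg _).1 (dl t)).
exact: (is_derive1_comp (f := fun x => (g x).2) (dg _).2 (dl t)).
Qed.

(** The factor 2 comes from using the mean value theorem in each coordinate separately; only the
    order of magnitude matters. *)
Lemma curve_displacement g g' a b M : C1curve g g' -> a <= b ->
  (forall t, a <= t <= b -> enorm (g' t) <= M) -> enorm (g b - g a) <= 2 * M * (b - a).
Proof.
move=> [_ dg] ab bd; apply: (le_trans (enorm_le_l1 _)).
have M0 : 0 <= M by apply: le_trans (enorm_ge0 _) (bd a _); rewrite lexx.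
have [c hc e1] := mean_value_le (fun t => (dg t).1) ab.
have [d hd e2] := mean_value_le (fun t => (dg t).2) ab.
rewrite !planeE e1 e2 !normrM (ger0_norm (x := b - a)) ?subr_ge0// -mulrDl.
rewrite ler_wpM2r ?subr_ge0// mulr2n mulrDl !mul1r; apply: lerD.
  exact: le_trans (le_fst_enorm _) (bd _ hc).
exact: le_trans (le_snd_enorm _) (bd _ hd).
Qed.

(** A double point would be a loop transversal to the field. This is how images of arcs by
    [iter k F] are seen to be arcs. *)
Lemma curve_injective e g g' a b : unif_line_field e -> C1curve g g' ->
  (forall t, a <= t <= b -> det2 (e (g t)) (g' t) != 0) ->
  forall s t, a <= s <= b -> a <= t <= b -> g s = g t -> s = t.
Proof.
move=> ue C tr.
wlog : / a <= b.
  move=> W s t sab; apply: W => //; lra.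
move=> ab.
have [x hx] : exists x, forall t, a <= t <= b -> `|g t| <= x.
  have [c _ cm] := EVT_max ab (continuous_subspaceT (cont_norm (C1_cont C))).
  by exists `|g c| => t tt; apply: cm; rewrite in_itv.
have x0 : 0 <= x by apply: le_trans (hx a _) => //; rewrite lexx.
have [th cth thE] := line_field_angle ue x0.
have main s t : a <= s -> s < t -> t <= b -> g s <> g t.
  move=> as_ st tb; apply: (no_loop cth C st) => y yst.
  have yab : a <= y <= b by lra.
  have := tr y yab; case: (thE (g y) (hx y yab)) => -> //.
  by rewrite (_ : - cis _ = -1 *: cis (th (g y))) ?det2Zl ?mulN1r ?oppr_eq0// scaleN1r.
move=> s t hs ht gst; have [h|h|//] := ltgtP s t.
  by exfalso; apply: (main s t) => //; lra.
by exfalso; apply: (main t s) => //; lra.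
Qed.

End Arcs.

(** * From bounded densities to bounded distortion of speeds *)

Section DensityRatio.
Variable R : realType.
Implicit Types (p q v w : plane R) (a b : Defs.arc R).

Lemma density_bound (m : {measure set (plane R) -> \bar R}) C mu S :
  1 < C -> density_between C mu m -> measurable S ->
  ((C^-1)%:E * m S <= mu S)%E /\ (mu S <= C%:E * m S)%E.
Proof.
move=> C1 [g [mg gE gC]] mS; rewrite gE//.
have C0 : 0 < C by rewrite (lt_trans ltr01).
have CC : C^-1 <= C by apply: (@le_trans _ _ 1); rewrite ?invf_le1// ltW.
(* Truncating the density changes it on a null set only and makes its bounds hold everywhere. *)
pose k p := Num.max C^-1 (Num.min C (g p)).
have mk : measurable_fun [set: plane R] k.
  apply: measurable_realfun.measurable_maxr; first exact: measurable_cst.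
  by apply: measurable_realfun.measurable_minr => //; exact: measurable_cst.
have k1 p : C^-1 <= k p by rewrite le_max lexx.
have k2 p : k p <= C by rewrite ge_max CC ge_min lexx.
have -> : (\int[m]_(p in S) (g p)%:E = \int[m]_(p in S) (k p)%:E)%E.
  apply: ae_eq_integral => //.
  - by apply: measurable_funTS; apply/measurable_EFinP.
  - by apply: measurable_funTS; apply/measurable_EFinP.
  - apply: filterS gC => p /andP[h1 h2] _; rewrite /k (min_idPr h2) (max_idPr h1)//.
have mk' : measurable_fun S (fun p => (k p)%:E).
  by apply: measurable_funTS; apply/measurable_EFinP.
rewrite -!integral_cst//; split; apply: ge0_le_integral => //.
- by move=> p _; rewrite lee_fin invr_ge0 ltW.
- by move=> p _; rewrite lee_fin.
- by move=> p _; rewrite lee_fin (le_trans _ (k1 p))// invr_ge0 ltW.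
- by move=> p _; rewrite lee_fin.
Qed.

Lemma cont_speed a : continuous (fun t : R => enorm ('D_1 a t)).
Proof. by apply: cont_enorm; have [] := C1curve_arc a. Qed.

Lemma speed_gt0 a t : 0 <= t <= 1 -> 0 < enorm ('D_1 a t).
Proof. by move=> h; rewrite enorm_gt0; apply: arc_reg; rewrite in_itv. Qed.

Lemma integral_between (phi : R -> R) (E : set R) c d : continuous phi ->
  measurable E -> 0 <= c -> (forall t, E t -> c <= phi t <= d) ->
  (c%:E * lebesgue_measure E <= \int[lebesgue_measure]_(t in E) (phi t)%:E)%E /\
  (\int[lebesgue_measure]_(t in E) (phi t)%:E <= d%:E * lebesgue_measure E)%E.
Proof.
move=> cphi mE c0 cd.
have ms : measurable_fun E (EFin \o phi).
  apply: measurable_funTS; apply/measurable_EFinP.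
  by apply: (open_continuous_measurable_fun openT) => t _; exact: cphi.
rewrite -!integral_cst//; split; apply: ge0_le_integral => //.
- by move=> t Et; rewrite lee_fin; case/andP: (cd t Et).
- by move=> t Et; rewrite lee_fin; case/andP: (cd t Et) => /(le_trans c0).
- by move=> t Et; rewrite lee_fin; case/andP: (cd t Et).
Qed.

Lemma integral_pos_fin (phi : R -> R) : continuous phi ->
  (forall t, 0 <= t <= 1 -> 0 < phi t) -> exists2 L, 0 < L &
  (\int[lebesgue_measure]_(t in `[0%R, 1%R]) (phi t)%:E)%E = L%:E.
Proof.
move=> cphi p0.
have [c hc cmin] := EVT_min ler01 (continuous_subspaceT cphi).
have [d hd dmax] := EVT_max ler01 (continuous_subspaceT cphi).
have c0 : 0 < phi c by apply: p0; move: hc; rewrite in_itv.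
have bd t : `[0%R, 1%R]%classic t -> phi c <= phi t <= phi d.
  by move=> ht; rewrite cmin// dmax.
have [] := integral_between cphi (measurable_itv `[0%R, 1%R]) (ltW c0) bd.
rewrite lebesgue_measure_itv /= lte_fin ltr01 oppr0 adde0 !mule1.
case: (\int[_]_(_ in _) _)%E => [L|_ //|//].
by rewrite !lee_fin => h _; exists L => //; exact: lt_le_trans h.
Qed.

Lemma arc_length_total a : exists2 L, 0 < L & arc_length a [set: plane R] = L%:E.
Proof.
have [t ht|L L0 LE] := integral_pos_fin (@cont_speed a); first exact: speed_gt0.
by exists L => //; rewrite -LE /arc_length preimage_setT setIT.
Qed.

Lemma normalized_lengthE a L S : 0 < L -> arc_length a [set: plane R] = L%:E ->
  normalized_length a S = (arc_length a S * (L^-1)%:E)%E.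
Proof.
move=> L0 LE.
have LE2 := LE : (arc_length a : {measure set (plane R) -> \bar R}) [set: plane R] = L%:E.
by rewrite /normalized_length /= /mnormalize LE2 eqe gt_eqF.
Qed.

End DensityRatio.

(** [l] is the measure of a small set of parameters, on which the speeds lie within a factor 2 of
    [x] and [y]. Cancelling it leaves the constant [2 * C * 2]. *)
Lemma density_arith (R : realType) (C La Lb l x y : R) (Ai Bi : \bar R) :
  1 < C -> 0 < La -> 0 < Lb -> 0 < l ->
  (C^-1%:E * (Ai * (La^-1)%:E) <= Bi * (Lb^-1)%:E)%E ->
  (Bi * (Lb^-1)%:E <= C%:E * (Ai * (La^-1)%:E))%E ->
  ((x / 2)%:E * l%:E <= Bi)%E -> (Bi <= (2 * x)%:E * l%:E)%E ->
  ((y / 2)%:E * l%:E <= Ai)%E -> (Ai <= (2 * y)%:E * l%:E)%E ->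
  x * La <= 4 * C * (y * Lb) /\ y * Lb <= 4 * C * (x * La).
Proof.
move=> C1 La0 Lb0 l0.
case: Bi => [B| |]; case: Ai => [A| |] //.
rewrite -!EFinM !lee_fin => D1 D2 B1 B2 A1 A2.
have C0 : 0 < C by rewrite (lt_trans ltr01).
have D2' : B * La <= C * (A * Lb).
  have := ler_wpM2r (ltW (mulr_gt0 La0 Lb0)) D2.
  rewrite (_ : B / Lb * (La * Lb) = B * La); last by field; rewrite gt_eqF.
  by rewrite (_ : C * (A / La) * (La * Lb) = C * (A * Lb))//; field; rewrite gt_eqF.
have D1' : A * Lb <= C * (B * La).
  have := ler_wpM2r (ltW (mulr_gt0 C0 (mulr_gt0 La0 Lb0))) D1.
  rewrite (_ : C^-1 * (A / La) * (C * (La * Lb)) = A * Lb); last by field; rewrite !gt_eqF.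
  by rewrite (_ : B / Lb * (C * (La * Lb)) = C * (B * La))//; field; rewrite gt_eqF.
have l2 : 0 < l / 2 by rewrite divr_gt0.
split; rewrite -(ler_pM2r l2).
  apply: (@le_trans _ _ (B * La)).
    by have := ler_wpM2r (ltW La0) B1; lra.
  apply: (le_trans D2').
  have := ler_wpM2l (ltW C0) (ler_wpM2r (ltW Lb0) A2); lra.
apply: (@le_trans _ _ (A * Lb)).
  by have := ler_wpM2r (ltW Lb0) A1; lra.
apply: (le_trans D1').
have := ler_wpM2l (ltW C0) (ler_wpM2r (ltW La0) B2); lra.
Qed.

(* The square S around b t0 meets the arc only for parameters close to t0, where
   the speeds pa and pb are almost constant. *)
Lemma density_ratio_aux (R : realType) (al be : R -> plane R) (pa pb : R -> R)
    (h : plane R -> plane R) (C La Lb : R) (na nb : set (plane R) -> \bar R) :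
  1 < C -> 0 < La -> 0 < Lb -> continuous be ->
  measurable_fun [set: R] be -> continuous pa -> continuous pb ->
  (forall s t, 0 <= s <= 1 -> 0 <= t <= 1 -> be s = be t -> s = t) ->
  (forall t, 0 <= t <= 1 -> 0 < pa t) -> (forall t, 0 <= t <= 1 -> 0 < pb t) ->
  (forall t, 0 <= t <= 1 -> be t = h (al t)) ->
  (forall S, measurable S ->
    nb S = ((\int[lebesgue_measure]_(t in `[0%R, 1%R] `&` be @^-1` S) (pb t)%:E) * (Lb^-1)%:E)%E) ->
  (forall S, measurable S ->
    na S = ((\int[lebesgue_measure]_(t in `[0%R, 1%R] `&` al @^-1` (h @^-1` S)) (pa t)%:E) * (La^-1)%:E)%E) ->
  (forall S, measurable S -> (C^-1%:E * na S <= nb S)%E /\ (nb S <= C%:E * na S)%E) ->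
  forall t, 0 <= t <= 1 ->
    pb t * La <= 4 * C * (pa t * Lb) /\ pa t * Lb <= 4 * C * (pb t * La).
Proof.
move=> C1 La0 Lb0 cb mb ca cpb bi pa0 pb0 bE nbE naE dens t0 ht0.
set x := pb t0; set y := pa t0.
have x0 : 0 < x by exact: pb0.
have y0 : 0 < y by exact: pa0.
have [d d0 Hd] : exists2 d, 0 < d & forall t, `|t - t0| < d ->
    (x / 2 <= pb t <= 2 * x) /\ (y / 2 <= pa t <= 2 * y).
  have nr (phi : R -> R) : continuous phi -> 0 < phi t0 -> \forall t \near t0,
      phi t0 / 2 <= phi t <= 2 * phi t0.
    move=> cphi z0; have /cvgrPdist_lt/(_ (phi t0 / 2)) := cphi t0.
    rewrite divr_gt0// => /(_ isT); apply: filterS => t; rewrite ltr_norml; lra.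
  have /nbhs_ballP[d /= d0 Hd] : \forall t \near t0,
      (x / 2 <= pb t <= 2 * x) /\ (y / 2 <= pa t <= 2 * y).
    by apply: filterS2 (nr _ cpb x0) (nr _ ca y0) => t; split.
  exists d => // t ht; apply: Hd; rewrite -ball_normE /= distrC//.
have [e e0 He] : exists2 e, 0 < e & forall t, 0 <= t <= 1 -> `|be t - be t0| < e -> `|t - t0| < d.
  pose K := [set t : R | 0 <= t <= 1 /\ d <= `|t - t0|].
  have cK : compact K.
    apply: (subclosed_compact _ (@segment_compact R 0 1)).
      rewrite (_ : K = `[0, 1]%classic `&` [set t | d <= `|t - t0|]).
        apply: closedI; first exact: itv_closed.
        apply: (@closed_comp _ _ (fun t : R => `|t - t0|) [set z | d <= z]); last exact: closed_ge.
        by move=> z _; have c : continuous (fun t : R => `|t - t0|); [cont|exact: c].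
      by apply/seteqP; split=> z /=; rewrite in_itv.
    by move=> z [hz _]; rewrite /= in_itv.
  have [K0|K0] := pselect (K !=set0); last first.
    exists 1 => // t ht _; rewrite ltNge; apply/negP => dt.
    by apply: K0; exists t.
  have cd : continuous (fun t : R => `|be t - be t0|) by cont.
  have [c /set_mem[hc dc] cmin] := compact_EVT_min K0 cK (continuous_subspaceT cd).
  exists `|be c - be t0|.
    rewrite normr_gt0 subr_eq0; apply/negP => /eqP /(bi _ _ hc ht0) e.
    by move: dc; rewrite e subrr normr0 leNgt d0.
  move=> t ht; apply: contraTT; rewrite -!leNgt => dt.
  by apply: cmin; apply/mem_set.
pose S : set (plane R) := `]((be t0).1 - e), ((be t0).1 + e)[%classic `*`
  `]((be t0).2 - e), ((be t0).2 + e)[%classic.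
have mS : measurable S by apply: measurableX; exact: measurable_itv.
have SE p : S p <-> `|p - be t0| < e.
  rewrite norm_plane gt_max !planeE !ltr_norml /S /= !in_itv /=; split.
    by move=> [/andP[? ?] /andP[? ?]]; lra.
  by move=> /andP[/andP[? ?] /andP[? ?]]; split; lra.
pose E := `[0%R, 1%R]%classic `&` be @^-1` S.
have mE : measurable E.
  apply: measurableI; first exact: measurable_itv.
  by rewrite -[X in measurable X]setTI; exact: mb.
have Et t : E t -> `|t - t0| < d.
  by rewrite /E /= in_itv /= => -[ht /SE]; exact: He.
have [l l0 lE] : exists2 l, 0 < l & lebesgue_measure E = l%:E.
  have fin : (lebesgue_measure E <= 1%:E)%E.
    apply: (@le_trans _ _ (lebesgue_measure (`[0%R, 1%R]%classic : set R))).
      by apply: le_measure; rewrite ?inE//; apply: subIsetl.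
    by rewrite lebesgue_measure_itv /= lte_fin ltr01 oppr0 adde0.
  have [r r0 Hr] : exists2 r, 0 < r & forall t, `|t - t0| < r -> S (be t).
    have /cvgrPdist_lt/(_ _ e0)/nbhs_ballP[r /= r0 Hr] := cb t0.
    exists r => // t tr; apply/SE; rewrite distrC; apply: Hr.
    by rewrite -ball_normE /= distrC.
  have [u [v [uv sub]]] : exists u v : R, u < v /\ `[u, v]%classic `<=` E.
    pose k := Num.min (r / 2) (1 / 2).
    have k0 : 0 < k by rewrite lt_min; lra.
    have k1 : k <= 1 / 2 by rewrite ge_min lexx orbT.
    have k2 : k <= r / 2 by rewrite ge_min lexx.
    have [h1|h1] := leP t0 (1 / 2).
      exists t0, (t0 + k); split; first lra.
      move=> t; rewrite /E /= !in_itv /= => ht; split; first lra.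
      by apply: Hr; rewrite ltr_norml; lra.
    exists (t0 - k), t0; split; first lra.
    move=> t; rewrite /E /= !in_itv /= => ht; split; first lra.
    by apply: Hr; rewrite ltr_norml; lra.
  have low : ((v - u)%:E <= lebesgue_measure E)%E.
    have -> : ((v - u)%:E = lebesgue_measure (`[u, v]%classic : set R))%E.
      by rewrite lebesgue_measure_itv /= lte_fin uv EFinB.
    by apply: le_measure; rewrite ?inE.
  move: low fin; case: (lebesgue_measure E) => [l| |] //.
  by rewrite !lee_fin => h1 _; exists l => //; lra.
have [D1 D2] := dens S mS; rewrite (nbE S mS) (naE S mS) in D1 D2.
have EE : `[0%R, 1%R]%classic `&` al @^-1` (h @^-1` S) = E.
  apply/seteqP; split=> t [ht hS]; split=> //; move: hS; rewrite /preimage /= bE//;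
    by move: ht; rewrite /= in_itv.
rewrite EE -/E in D1 D2.
have [B1 B2] := integral_between cpb mE (ltW (divr_gt0 x0 (ltr0n _ 2)))
   (fun t h => (Hd t (Et t h)).1).
have [A1 A2] := integral_between ca mE (ltW (divr_gt0 y0 (ltr0n _ 2)))
   (fun t h => (Hd t (Et t h)).2).
rewrite lE in B1 B2 A1 A2.
exact: (density_arith C1 La0 Lb0 l0 D1 D2 B1 B2 A1 A2).
Qed.

Lemma ratio_arith (R : realType) (x y z w La Lb C : R) : 0 < La -> 0 < Lb ->
  0 <= x -> 0 <= w -> x * La <= 4 * C * (y * Lb) -> w * Lb <= 4 * C * (z * La) ->
  x * w <= 16 * C ^+ 2 * (y * z).
Proof.
move=> La0 Lb0 x0 w0 h1 h2; rewrite -(ler_pM2r (mulr_gt0 La0 Lb0)).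
have := ler_pM (mulr_ge0 x0 (ltW La0)) (mulr_ge0 w0 (ltW Lb0)) h1 h2.
rewrite (_ : x * La * (w * Lb) = x * w * (La * Lb)); last by ring.
by rewrite (_ : 4 * C * (y * Lb) * (4 * C * (z * La)) = 16 * C ^+ 2 * (y * z) * (La * Lb)); last by ring.
Qed.

(** The densities compare normalized lengths, so the total lengths of both arcs enter at a single
    point. They cancel when two points are compared. *)
Lemma density_ratio (R : realType) (a b : Defs.arc R) (h : plane R -> plane R) C :
  1 < C -> measurable_fun [set: plane R] h ->
  (forall t, 0 <= t <= 1 -> b t = h (a t)) ->
  density_between C (normalized_length b) (pushforward (normalized_length a) h) ->
  forall s t, 0 <= s <= 1 -> 0 <= t <= 1 ->
    enorm ('D_1 b s) * enorm ('D_1 a t) <=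
    16 * C ^+ 2 * (enorm ('D_1 a s) * enorm ('D_1 b t)).
Proof.
move=> C1 mh bE dens s t hs ht.
have [La La0 LaE] := arc_length_total a; have [Lb Lb0 LbE] := arc_length_total b.
have bi u v : 0 <= u <= 1 -> 0 <= v <= 1 -> b u = b v -> u = v.
  by move=> hu hv; apply: arc_inj; rewrite in_itv.
have H := density_ratio_aux C1 La0 Lb0 (C1_cont (C1curve_arc b)) (measurable_arc b)
  (@cont_speed _ a) (@cont_speed _ b) bi (@speed_gt0 _ a) (@speed_gt0 _ b) bE
  (fun S _ => normalized_lengthE S Lb0 LbE)
  (fun S _ => normalized_lengthE (h @^-1` S) La0 LaE)
  (fun S mS => density_bound C1 dens mS).
have [h1 _] := H mh s hs; have [_ h2] := H mh t ht.
exact: (ratio_arith La0 Lb0 (ltW (speed_gt0 b hs)) (ltW (speed_gt0 a ht)) h1 h2).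
Qed.

Section MeasurabilityPlane.
Variable R : realType.

(** Measurability in the plane refers to the product sigma-algebra, so an open set is written as a
    countable union of half-open grid squares contained in it. *)
Lemma open_plane_measurable (O : set (plane R)) : open O -> measurable O.
Proof.
move=> oO.
pose J a k : set R := `[a%:~R / k.+1%:R, (a + 1)%:~R / k.+1%:R[%classic.
pose box (i : int * int * nat) : set (plane R) := J i.1.1 i.2 `*` J i.1.2 i.2.
pose B n : set (plane R) := if unpickle n is Some i then
   (if `[< box i `<=` O >] then box i else set0) else set0.
have mB n : measurable (B n).
  rewrite /B; case: (unpickle n) => [i|]; last exact: measurable0.
  case: ifP => _; last exact: measurable0.
  by apply: measurableX; exact: measurable_itv.
suff -> : O = \bigcup_n B n by apply: bigcupT_measurable.
apply/seteqP; split=> p; last first.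
  move=> [n _]; rewrite /B; case: (unpickle n) => [i|//].
  by case: ifP => // /asboolP; apply.
move=> Op; have /nbhs_ballP[r /= r0 Hr] : nbhs p O by apply: open_nbhs_nbhs.
pose k := Num.truncn r^-1.
have k0 : 0 < k.+1%:R :> R by rewrite ltr0n.
have kr : k.+1%:R^-1 < r.
  by rewrite invf_plt ?posrE//; exact: truncnS_gt.
have fl (x : R) : (Num.floor (x * k.+1%:R))%:~R / k.+1%:R <= x <
    (Num.floor (x * k.+1%:R) + 1)%:~R / k.+1%:R.
  by rewrite ler_pdivrMr// ltr_pdivlMr//; exact: floor_itv.
pose i := (Num.floor (p.1 * k.+1%:R), Num.floor (p.2 * k.+1%:R), k).
have ip : box i p by split; rewrite /J /= in_itv /= fl.
have close (x y : R) : J (Num.floor (x * k.+1%:R)) k y -> `|x - y| < r.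
  have := fl x; rewrite /J /= in_itv /= intrD1 mulrDl mul1r.
  set u := _ / _; set w := _^-1 in kr *; rewrite ltr_norml.
  by move=> /andP[? ?] /andP[? ?]; apply/andP; split; lra.
have BE : B (pickle i) p; last exact: (@bigcup_sup _ _ (pickle i) setT B Logic.I p BE).
rewrite /B pickleK ifT//.
apply/asboolP => q [q1 q2]; apply: Hr; rewrite -ball_normE /= norm_plane gt_max !planeE.
by rewrite !close.
Qed.

Lemma cont_plane_measurable (h : plane R -> R) : continuous h ->
  measurable_fun [set: plane R] h.
Proof.
move=> ch; apply: (measurability _ (RGenOpens.measurableE R)) => _ [_ [a [b ->] <-]].
rewrite setTI; apply: open_plane_measurable.
by apply: open_comp; [move=> x _; exact: ch|exact: interval_open].
Qed.

Lemma cont_planes_measurable (h : plane R -> plane R) : continuous h ->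
  measurable_fun [set: plane R] h.
Proof.
move=> ch; apply/measurable_fun_pairP; split; apply: cont_plane_measurable.
  exact: (cont_fst ch).
exact: (cont_snd ch).
Qed.

End MeasurabilityPlane.

Section QuasiPreservation.
Variable R : realType.
Implicit Types (p q v w : plane R).
Variables (f : torus R -> torus R) (F : plane R -> plane R).
Hypothesis C1F : Ck 1 [set: plane R] F.

Lemma C1curve_iter k (g g' : R -> plane R) : C1curve g g' ->
  C1curve (fun t => iter k F (g t)) (fun t => plane_iter F k (g t) (g' t)).
Proof.
move=> C; have cg := C1_cont C; have [cg' dg] := (C1curveP g g').1 C.
apply/C1curveP; split=> [|t]; first exact: cont_T.
have [dgt gE] := dg t.
have difg : differentiable g t by apply/derivable1_diffP.
have difF := iter_differentiable C1F k (g t).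
have dc := differentiable_comp difg difF.
apply: DeriveDef; first by apply/derivable1_diffP.
have e1 : 'D_1 (iter k F \o g) t = 'd (iter k F \o g) t 1 by exact: deriveE.
have e2 : 'd (iter k F \o g) t 1 = 'd (iter k F) (g t) ('d g t 1).
  exact: (congr1 (fun h : R -> plane R => h 1) (diff_comp difg difF)).
have e3 : 'd g t 1 = g' t by rewrite -gE; exact: esym (deriveE _ difg).
by rewrite -e3; exact: etrans e1 e2.
Qed.

(** The speed of the image arc over that of [a] is the norm of the derivative on the tangent line.
    Transversality to [e] guarantees that the image is an arc, so that the density hypothesis
    applies to it. *)
Lemma qpd_growth (W : foliation R) (e : plane R -> plane R) :
  unif_line_field e -> quasi_preserves_densities F W ->
  (forall p (a : Defs.arc R), arc_set a `<=` W p -> forall k t, 0 <= t <= 1 ->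
     det2 (e (iter k F (a t))) (plane_iter F k (a t) ('D_1 a t)) != 0) ->
  exists2 C, 0 < C & forall p (a : Defs.arc R), arc_set a `<=` W p ->
    forall k s t, 0 <= s <= 1 -> 0 <= t <= 1 ->
    enorm (plane_iter F k (a s) ('D_1 a s)) * enorm ('D_1 a t) <=
    C * (enorm ('D_1 a s) * enorm (plane_iter F k (a t) ('D_1 a t))).
Proof.
move=> ue [_ [C [C1 HC]]] tr; exists (16 * C ^+ 2).
  by rewrite mulr_gt0// exprn_gt0// (lt_trans ltr01).
move=> p a aW k s t hs ht.
have Ca := C1curve_iter k (C1curve_arc a).
have [||b [bE bE']] := arc_of_curve Ca.
- by move=> u hu; have := tr p a aW k u hu; apply: contra_neq => ->; rewrite det20.
- exact: (curve_injective ue Ca (tr p a aW k)).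
have bs : arc_set b = iter k F @` arc_set a.
  by rewrite /arc_set bE image_comp.
have ci : continuous (iter k F) by exact: cont_iter.
have bt u : 0 <= u <= 1 -> b u = iter k F (a u) by rewrite bE.
have b' u : plane_iter F k (a u) ('D_1 a u) = 'D_1 b u := esym (congr1 (fun g => g u) bE').
have := density_ratio C1 (cont_planes_measurable ci) bt (HC p a aW k b bs) hs ht.
by rewrite (b' s) (b' t).
Qed.

End QuasiPreservation.

(** * Long curves in the leaves *)

Section Reparametrization.
Variable R : realType.
Implicit Types (f d : R -> R) (g : R -> plane R).

Lemma cont_max (T : topologicalType) (f g : T -> R) : continuous f ->
  continuous g -> continuous (fun x => Num.max (f x) (g x)).
Proof. by move=> cf cg x; apply: continuous_max; [exact: cf|exact: cg]. Qed.

Lemma cont_min (T : topologicalType) (f g : T -> R) : continuous f ->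
  continuous g -> continuous (fun x => Num.min (f x) (g x)).
Proof. by move=> cf cg x; apply: continuous_min; [exact: cf|exact: cg]. Qed.

Lemma is_derive_quotient f (t v : R) : is_derive t (1 : R) f v <->
  (fun h : R => h^-1 * (f (h + t) - f t)) @ 0^' --> v.
Proof.
have e : (fun h : R => h^-1 *: ((f \o shift t) (h *: 1) - f t)) =
    (fun h : R => h^-1 * (f (h + t) - f t)).
  by apply/funext => h; rewrite /= /GRing.scale /= mulr1.
split=> [[df fE]|cv].
  by rewrite -fE /derive e; move: df; rewrite /derivable e.
by apply: DeriveDef; [apply/cvg_ex; exists v; rewrite e|rewrite /derive e; exact: cvg_lim].
Qed.

Definition glue (V : Type) (a : R) (f1 f2 : R -> V) (t : R) : V :=
  if t <= a then f1 t else f2 t.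

Lemma glue_is_derive (a : R) f1 f2 d : f1 a = f2 a ->
  (forall t, t <= a -> is_derive t (1 : R) f1 (d t)) ->
  (forall t, a <= t -> is_derive t (1 : R) f2 (d t)) ->
  forall t, is_derive t (1 : R) (glue a f1 f2) (d t).
Proof.
move=> fa d1 d2 t; have [ta|ta|->] := ltgtP t a.
- apply: (near_eq_is_derive (f := f1)) (d1 t (ltW ta)).
  near=> x; rewrite /glue ifT//; apply: ltW; near: x; exact: lt_nbhsl.
- apply: (near_eq_is_derive (f := f2)) (d2 t (ltW ta)).
  near=> x; rewrite /glue ifF//; apply/negbTE; rewrite -ltNge.
  by near: x; exact: lt_nbhsr.
apply/is_derive_quotient; apply/cvgrPdist_lt => e e0.
have /is_derive_quotient/cvgrPdist_lt/(_ e e0) c1 := d1 a (lexx a).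
have /is_derive_quotient/cvgrPdist_lt/(_ e e0) c2 := d2 a (lexx a).
apply: filterS2 c1 c2 => h c1 c2; rewrite /glue lexx.
by case: ifP => _ //; rewrite fa.
Unshelve. all: by end_near. Qed.

Lemma cont_glue (V : normedModType R) (a : R) (f1 f2 : R -> V) : f1 a = f2 a ->
  continuous f1 -> continuous f2 -> continuous (glue a f1 f2).
Proof.
move=> fa c1 c2.
have -> : glue a f1 f2 = fun t => f1 (Num.min t a) + f2 (Num.max t a) - f1 a.
  apply/funext => t; rewrite /glue minEle maxEle; case: ifP => _.
    by rewrite fa addrK.
  by rewrite addrAC subrr add0r.
have cm : continuous (fun t : R => Num.min t a) by apply: cont_min; cont.
have cM : continuous (fun t : R => Num.max t a) by apply: cont_max; cont.
apply: cont_add; last by cont.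
by apply: cont_add; [exact: (cont_comp c1 cm)|exact: (cont_comp c2 cM)].
Qed.

Lemma C1curve_glue (a : R) g1 g1' g2 g2' : C1curve g1 g1' -> C1curve g2 g2' ->
  g1 a = g2 a -> g1' a = g2' a -> C1curve (glue a g1 g2) (glue a g1' g2').
Proof.
move=> [c1 d1] [c2 d2] ga ga'; split; first exact: cont_glue.
have key (c : plane R -> R) :
    (forall t, is_derive t (1 : R) (fun x => c (g1 x)) (c (g1' t))) ->
    (forall t, is_derive t (1 : R) (fun x => c (g2 x)) (c (g2' t))) ->
    forall t, is_derive t (1 : R) (fun x => c (glue a g1 g2 x)) (c (glue a g1' g2' t)).
  move=> h1 h2 t.
  have -> : (fun x => c (glue a g1 g2 x)) = glue a (fun x => c (g1 x)) (fun x => c (g2 x)).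
    by apply/funext => x; rewrite /glue; case: ifP.
  apply: (glue_is_derive (d := fun t => c (glue a g1' g2' t))).
  - by rewrite ga.
  - by move=> s sa; rewrite /glue sa.
  - move=> s; rewrite le_eqVlt /glue => /predU1P[<-|sa]; first by rewrite lexx ga'.
    by rewrite leNgt sa.
by move=> t; split; [apply: (key fst)|apply: (key snd)] => s; have [] := d1 s; have [] := d2 s.
Qed.

(** Integration from -1 gives a primitive on the right of -1 only; as [phi] is constant on the left
    of 0, an affine function continues it there. *)
Lemma primitive_exists (phi : R -> R) : continuous phi ->
  (forall t, t <= 0 -> phi t = phi 0) ->
  exists P : R -> R, forall t, is_derive t (1 : R) P (phi t).
Proof.
move=> cphi phi0.
pose Q (x : R) := (\int[lebesgue_measure]_(t in `[(-1)%R, x]) phi t)%R.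
have dQ (t : R) : -1 < t -> is_derive t (1 : R) Q (phi t).
  move=> t1; have t2 : t < t + 1 by lra.
  have [|dq qE] := continuous_FTC1_closed t2 _ t1 (cphi t).
    by apply: continuous_compact_integrable; [exact: segment_compact|exact: continuous_subspaceT].
  by rewrite -qE derive1E; apply: DeriveDef.
exists (glue 0 (fun t => Q 0 + phi 0 * t) Q); apply: glue_is_derive.
- by rewrite mulr0 addr0.
- move=> t t0; rewrite phi0//; apply: is_derive_eq.
  by rewrite add0r mul1r /GRing.scale /= mulr1.
- by move=> t t0; apply: dQ; lra.
Qed.

Lemma increasing_inverse (P phi : R -> R) (m : R) : 0 < m -> (forall t, m <= phi t) ->
  (forall t, is_derive t (1 : R) P (phi t)) ->
  exists s : R -> R, [/\ cancel P s, cancel s P &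
    forall u, is_derive u (1 : R) s (phi (s u))^-1].
Proof.
move=> m0 mphi dP.
have grow (a b : R) : a <= b -> m * (b - a) <= P b - P a.
  move=> ab; have [c _ ->] := mean_value_le dP ab.
  by rewrite ler_wpM2r ?subr_ge0.
have cP : continuous P by move=> t; apply: differentiable_continuous; apply/derivable1_diffP; have [] := dP t.
have onto u : exists t, P t = u.
  pose b := `|u - P 0| / m.
  have b0 : 0 <= b by rewrite divr_ge0// ltW.
  have bm : m * b = `|u - P 0| by rewrite /b mulrC divfK// gt_eqF.
  have h1 := grow 0 b b0; have h2 := grow (- b) 0 ltac:(lra).
  have := ler_norm (u - P 0); have := lerNnormlW (lexx `|u - P 0|) => n1 n2.
  have [||c _ cE] := @continuous_IVT _ P (- b) b u cP; [lra| |by exists c].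
  by left; apply/andP; split; lra.
have [s sP] := choice onto.
have inj (a b : R) : P a = P b -> a = b.
  have lt (c e : R) : c < e -> P c < P e.
    by move=> cd; rewrite -subr_gt0; apply: lt_le_trans (grow c e (ltW cd)); rewrite mulr_gt0// subr_gt0.
  by move=> e; have [/lt|/lt|//] := ltgtP a b; rewrite e ltxx.
have Ps : cancel P s by move=> t; apply: inj; rewrite sP.
exists s; split=> // u.
have := @is_derive_inverse R P s (phi (s u)) (s u); rewrite sP; apply.
- by near=> x; exact: Ps.
- by near=> x; exact: cP.
- by rewrite gt_eqF// (lt_le_trans m0).
Unshelve. all: by end_near. Qed.

Lemma unit_speed g g' : C1curve g g' -> (forall t, 0 <= t <= 1 -> g' t != 0) ->
  exists c c' L, [/\ C1curve c c', 0 <= L, c 0 = g 0, c L = g 1 &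
    forall u, 0 <= u <= L -> enorm (c' u) = 1 /\
      exists t k, [/\ 0 <= t <= 1, 0 < k, c u = g t & c' u = k *: g' t]].
Proof.
move=> C reg; have [cg' dg] := C.
(* Outside [0, 1] the speed of [g] may vanish. Freezing the parameter at the ends keeps [phi]
   bounded below on the whole line, so that its primitive is invertible. *)
pose cl (t : R) := Num.max 0 (Num.min t 1).
have ccl : continuous cl.
  by apply: cont_max; [cont|apply: cont_min; cont].
have cl01 t : 0 <= cl t <= 1 by rewrite /cl le_max lexx /= ge_max ge_min lexx ler01 orbT.
have clid t : 0 <= t <= 1 -> cl t = t by move=> /andP[? ?]; rewrite /cl min_l// max_r.
pose phi t := enorm (g' (cl t)).
have cphi : continuous phi by apply: cont_enorm; exact: (cont_comp cg' ccl).
have [||t0 t01 mt] := @EVT_min R phi 0 1; [by []|exact: continuous_subspaceT|].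
have m0 : 0 < phi t0 by rewrite enorm_gt0 reg.
have mphi t : phi t0 <= phi t.
  have := mt (cl t); rewrite in_itv /= => /(_ (cl01 t)).
  by rewrite /phi [cl (cl t)]clid.
have [|P0 dP0] := primitive_exists cphi.
  by move=> t t_le0; rewrite /phi /cl min_l ?(le_trans t_le0)// max_l// min_l// maxxx.
pose P t := P0 t - P0 0.
have dP (t : R) : is_derive t (1 : R) P (phi t).
  by have := dP0 t => ?; apply: is_derive_eq; rewrite subr0.
have [s [Ps sP ds]] := increasing_inverse m0 mphi dP.
have P00 : P 0 = 0 by rewrite /P subrr.
have mono (a b : R) : a <= b -> P a <= P b.
  move=> ab; rewrite -subr_ge0; have [c _ ->] := mean_value_le dP ab.
  by rewrite mulr_ge0 ?subr_ge0// (le_trans (ltW m0)).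
have s01 u : 0 <= u <= P 1 -> 0 <= s u <= 1.
  move=> /andP[u0 u1]; apply/andP; split; rewrite leNgt; apply/negP => h.
    have e : P (s u) = 0 by apply/eqP; rewrite eq_le {2}sP u0 andbT -P00 mono// ltW.
    by move: h; rewrite -{1}[s u]Ps e -{2}[0]Ps P00 ltxx.
  have e : P (s u) = P 1 by apply/eqP; rewrite eq_le {1}sP u1 /= mono// ltW.
  by move: h; rewrite -{1}[s u]Ps e Ps ltxx.
have cs : continuous s by move=> t; apply: differentiable_continuous; apply/derivable1_diffP; have [] := ds t.
exists (fun u => g (s u)), (fun u => (phi (s u))^-1 *: g' (s u)), (P 1); split.
- split.
    apply: cont_scale; last exact: (cont_comp cg' cs).
    apply: cont_inv; last exact: (cont_comp cphi cs).
    by move=> x; rewrite gt_eqF// (lt_le_trans m0).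
  move=> u; have [d1 d2] := dg (s u); rewrite !planeE ![_^-1 * _]mulrC; split.
    exact: (is_derive1_comp (f := fun x => (g x).1) d1 (ds u)).
  exact: (is_derive1_comp (f := fun x => (g x).2) d2 (ds u)).
- by rewrite -P00 mono.
- by rewrite -{1}P00 Ps.
- by rewrite Ps.
move=> u /s01 su; split.
  rewrite enormZ /phi clid// gtr0_norm ?invr_gt0 ?enorm_gt0 ?reg// mulVf//.
  by rewrite enorm_eq0 reg.
exists (s u), (phi (s u))^-1; split=> //.
by rewrite invr_gt0 (lt_le_trans m0).
Qed.

End Reparametrization.

(** * Foliated boxes and plaques *)

Section Boxes.
Variable R : realType.
Implicit Types (p q z w : plane R).

(** The points of [K] outside the interior of [U] have a compact, hence closed, image, which misses
    [h z]. *)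
Lemma inverse_near (X Y : topologicalType) (h : X -> Y) (K U : set X) (z : X) :
  hausdorff_space Y -> compact K -> continuous h ->
  (forall x, K x -> h x = h z -> x = z) -> nbhs z U ->
  \forall q \near h z, forall x, K x -> h x = q -> U x.
Proof.
move=> hY cK ch inj zU.
have cC : closed (h @` (K `&` ~` U°)).
  apply: compact_closed => //; apply: continuous_compact; first exact: continuous_subspaceT.
  by apply: compact_closedI => //; apply: open_closedC; exact: open_interior.
have nz : (~` (h @` (K `&` ~` U°))) (h z).
  move=> [x [Kx nUx] hx]; apply: nUx; rewrite (inj x Kx hx); exact: zU.
have := open_nbhs_nbhs (conj (closed_openC cC) nz); apply: filterS => q nq x Kx hx.
apply: interior_subset; apply: contrapT => nUx; apply: nq.
by exists x.
Qed.

Lemma cont_lift (T X Y : topologicalType) (h : X -> Y) (K : set X) (g : T -> Y) (k : T -> X) :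
  hausdorff_space Y -> compact K -> continuous h ->
  (forall x y, K x -> K y -> h x = h y -> x = y) -> continuous g ->
  (forall t, K (k t)) -> (forall t, h (k t) = g t) -> continuous k.
Proof.
move=> hY cK ch inj cg Kk hk t U tU.
have n := inverse_near hY cK ch (fun x Kx => inj x _ Kx (Kk t)) tU.
rewrite hk in n; change (nbhs t (k @^-1` U)).
have n' : nbhs t (g @^-1` [set q | forall x, K x -> h x = q -> U x]) := cg t _ n.
by apply: filterS n' => s /(_ (k s) (Kk s)); rewrite hk; apply.
Qed.

Definition unit_square : set (plane R) := [set p | (0 <= p.1 <= 1) && (0 <= p.2 <= 1)].

Lemma unit_squareE : unit_square = `[0, 1] `*` `[0, 1].
Proof.
apply/seteqP; split=> -[x y]; rewrite /unit_square /= !in_itv /= => /andP; exact.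
Qed.

Lemma compact_unit_square : compact unit_square.
Proof.
have cK := compact_setX (@segment_compact R 0 1) (@segment_compact R 0 1).
by rewrite unit_squareE.
Qed.

(* Pulling back a small circle around [h z] by [h] and contracting it to the
   centre of the square inside the square minus [z] would make its winding
   number vanish. *)
Lemma no_edge (h : plane R -> plane R) z : continuous h ->
  (forall p q, unit_square p -> unit_square q -> h p = h q -> p = q) ->
  unit_square z -> (h @` unit_square)° (h z) -> 0 < z.1 < 1.
Proof.
move=> ch inj sz; have p0 := pi_gt0 R.
rewrite /interior /= => /nbhs_ballP[r /= r0 Hr].
have hz : 0 <= z.1 <= 1 by case/andP: sz.
apply: contrapT => /negP edge.
have {}edge : z.1 = 0 \/ z.1 = 1.
  move: edge; rewrite negb_and -!leNgt => /orP[] e; [left|right]; lra.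
pose g (t : R) := h z + (r / 2) *: cis (2 * pi * t).
have cg : continuous g by rewrite /g /cis; cont.
have gB t : exists w, unit_square w /\ h w = g t.
  have [|w sw hw] := Hr (g t); last by exists w.
  rewrite -ball_normE /= /g opprD addrA subrr sub0r normrN.
  apply: (le_lt_trans (norm_le_enorm _)); rewrite enormZ enorm_cis mulr1.
  by rewrite ger0_norm; lra.
have [k kP] := choice gB.
have ck : continuous k.
  apply: (cont_lift (@norm_hausdorff _ _) compact_unit_square ch inj cg) => t; by have [] := kP t.
have kz t : k t <> z.
  move=> e; have [_] := kP t; rewrite e /g => /esym/eqP.
  rewrite -subr_eq0 addrAC subrr add0r -enorm_eq0 enormZ enorm_cis mulr1 normr_eq0.
  by apply/negP; lra.
pose c : plane R := (1 / 2, 1 / 2).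
(* The cone over the curve [k] with apex the centre of the square: the apex at [p.2 = 0], the curve
   itself at [p.2 = 1]. *)
pose m (p : plane R) := (1 - `|p.2|) *: c + `|p.2| *: k p.1.
have cm : continuous m by rewrite /m; cont; apply: (cont_comp ck); cont.
pose G p := h (m p) - h z.
have cG : continuous G by apply: cont_add; [exact: (cont_comp ch cm)|cont].
have G0 p : `|p| <= 1 -> G p != 0.
  rewrite norm_plane_le => /andP[_ p2]; have p20 := normr_ge0 p.2.
  have [sk _] := kP p.1; have := sk => /andP[/andP[k1 k2] /andP[k3 k4]].
  have sm : unit_square (m p).
    by apply/andP; split; apply/andP; split; rewrite /m !planeE /c /=; nra.
  apply/eqP => /eqP; rewrite subr_eq0 => /eqP/(inj _ _ sm sz) e.
  have e1 : (1 - `|p.2|) * (1 / 2) + `|p.2| * (k p.1).1 = z.1 by rewrite -e.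
  (* The first coordinate of [c] is 1/2, so the cone reaches an edge coordinate only where [c] has
     weight 0. *)
  have l1 : `|p.2| = 1 by case: edge => ez; rewrite ez in e1; nra.
  by apply: (kz p.1); rewrite -e /m l1 subrr scale0r add0r scale1r.
have [th cth thE] := angle_lift ler01 cG G0.
have cis_eq (p q : plane R) : `|p| <= 1 -> `|q| <= 1 -> G p = G q -> cos (th p - th q) = 1.
  move=> hp hq e; apply: cisK; apply: (@scalerI _ _ (enorm (G p))).
    by rewrite enorm_eq0 G0.
  by rewrite -thE// {2}e -thE.
have b (t l : R) : 0 <= t <= 1 -> 0 <= l <= 1 -> `|(t, l) : plane R| <= 1.
  by move=> /andP[? ?] /andP[? ?]; rewrite norm_plane_le /= !ger0_norm//; apply/andP.
have row0 : th (1, 0) = th (0, 0).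
  apply: (@const_angle _ (fun t => th (t, 0)) 0 1) => //; first by apply: (cont_comp cth); cont.
  move=> t ht; apply: cis_eq; try (apply: b => //; lra).
  by rewrite /G /m /= normr0 !scale0r.
have cols : th (1, 1) - th (0, 1) = th (1, 0) - th (0, 0).
  apply: (@const_angle _ (fun l => th (1, l) - th (0, l)) 0 1) => //.
    by apply: cont_add; [|apply: cont_opp]; apply: (cont_comp cth); cont.
  have k01 : k 1 = k 0.
    have [s1 h1] := kP 1; have [s0 h0] := kP 0; apply: inj => //.
    rewrite h1 h0 /g; congr (_ + _ *: _).
    by have := @cis_int R 0 1; rewrite !mulr0 add0r.
  have d1 (l : R) : 0 <= l <= 1 -> cos (th (1, l) - th (0, l)) = 1.
    move=> hl; apply: cis_eq; try (apply: b => //; lra).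
    by rewrite /G /m /= k01.
  by move=> l hl; apply: cos_sub1; apply: d1 => //; lra.
(* On the outer circle the angle is that of [cis], which gains 2 pi over a turn; by [row0] and
   [cols] it gains nothing. *)
have row1 : th (1, 1) - 2 * pi * 1 = th (0, 1) - 2 * pi * 0.
  apply: (@const_angle _ (fun t => th (t, 1) - 2 * pi * t) 0 1) => //.
    by apply: cont_add; [apply: (cont_comp cth)|]; cont.
  have d1 (t : R) : 0 <= t <= 1 -> cos (th (t, 1) - 2 * pi * t) = 1.
    move=> ht; apply: cisK; have bt : `|(t, 1) : plane R| <= 1 by apply: b => //; lra.
    have := thE _ bt.
    have -> : G (t, 1) = (r / 2) *: cis (2 * pi * t).
      have [_ hk] := kP t.
      by rewrite /G /m /= normr1 subrr scale0r add0r scale1r hk /g addrAC subrr add0r.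
    rewrite enormZ enorm_cis mulr1 ger0_norm; last by lra.
    by move/scalerI => <- //; lra.
  by move=> t ht; apply: cos_sub1; apply: d1 => //; lra.
lra.
Qed.

(** By [no_edge] the point [p] has first coordinate strictly between 0 and 1 in the box, so the two
    ends of its plaque are at positive distance; continuity of [h] and of its inverse gives a common
    [eps] for all nearby points. *)
Lemma box_step (W : foliation R) p : exists2 eps, 0 < eps &
  \forall q \near p, exists (a : Defs.arc R) (l t r : R),
    [/\ 0 <= l, l < t, t < r & r <= 1] /\
    [/\ a t = q, arc_set a `<=` W q, eps <= enorm (a l - q) & eps <= enorm (a r - q)].
Proof.
have [B Bp [h0 [ch0 inj0 BE plq]]] := leaf_box W p.
pose c1 (x : R) := Num.max 0 (Num.min x 1).
have cc1 : continuous c1 by apply: cont_max; [cont|apply: cont_min; cont].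
have c01 t : 0 <= c1 t <= 1 by rewrite /c1 le_max lexx /= ge_max ge_min lexx ler01 orbT.
have cid t : 0 <= t <= 1 -> c1 t = t by move=> /andP[? ?]; rewrite /c1 min_l// max_r.
pose h (w : plane R) := h0 (c1 w.1, c1 w.2).
have ch : continuous h.
  apply: (within_comp ch0); last by move=> w; split; rewrite /= in_itv /= c01.
  by apply: cont_pair; [apply: (cont_comp cc1)|apply: (cont_comp cc1)]; cont.
have hE w : unit_square w -> h w = h0 w.
  by case: w => x y /andP[/= hx hy]; rewrite /h /= !cid.
have inj v w : unit_square v -> unit_square w -> h v = h w -> v = w.
  move=> sv sw; rewrite !hE// => /inj0; apply; apply/mem_set; by rewrite -unit_squareE.
have BE2 : B = h @` unit_square.
  rewrite BE -unit_squareE; apply/seteqP; split=> _ [w sw <-]; exists w => //; by rewrite hE.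
have [z sz hz] : (h @` unit_square) p by rewrite -BE2; exact: interior_subset.
have z01 : 0 < z.1 < 1.
  by apply: (no_edge ch inj sz); rewrite hz -BE2.
pose D i (w : plane R) := enorm (h (i, w.2) - h w).
have cD i : continuous (D i).
  by apply: cont_enorm; apply: cont_add; [apply: (cont_comp ch)|apply: cont_opp; exact: ch]; cont.
have sz2 : 0 <= z.2 <= 1 by case/andP: sz.
have D0 i : i = 0 \/ i = 1 -> 0 < D i z.
  move=> hi; rewrite enorm_gt0 subr_eq0; apply/eqP => /inj e.
  have := congr1 fst (e _ sz); rewrite /= => /(_ _) e1.
  have si : unit_square (i, z.2) by rewrite /unit_square /= sz2 andbT; case: hi => ->; lra.
  by have := e1 si; case: hi => ->; lra.
pose eps := Num.min (D 0 z) (D 1 z) / 2.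
have eps0 : 0 < eps by rewrite divr_gt0// lt_min !D0; [|right|left].
have e0 : eps < D 0 z.
  by have := D0 0 (or_introl erefl); rewrite /eps; case: (leP (D 0 z) (D 1 z)); lra.
have e1 : eps < D 1 z.
  by have := D0 1 (or_intror erefl); rewrite /eps; case: (leP (D 0 z) (D 1 z)); lra.
exists eps => //.
pose U := [set w : plane R | [/\ 0 < w.1, w.1 < 1, eps < D 0 w & eps < D 1 w]].
have zU : nbhs z U.
  have n (g1 g2 : plane R -> R) : continuous g1 -> continuous g2 -> g1 z < g2 z ->
      \forall w \near z, g1 w < g2 w.
    move=> cg1 cg2 lt; have cB : continuous (fun w => g2 w - g1 w) by cont.
    have pos : 0 < g2 z - g1 z by rewrite subr_gt0.
    have /cvgrPdist_lt/(_ _ pos) := cB z; apply: filterS => w; rewrite ltr_norml; lra.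
  have [z0 z1] := andP z01.
  have n1 := n (fun=> 0) fst ltac:(cont) ltac:(cont) z0.
  have n2 := n fst (fun=> 1) ltac:(cont) ltac:(cont) z1.
  have n3 := n (fun=> eps) (D 0) ltac:(cont) (cD 0) e0.
  have n4 := n (fun=> eps) (D 1) ltac:(cont) (cD 1) e1.
  by near=> w; split; near: w.
have near1 := inverse_near (@norm_hausdorff _ _) compact_unit_square ch (fun x Kx => inj x _ Kx sz) zU.
rewrite hz in near1.
have near2 : \forall q \near p, B q by exact: Bp.
apply: filterS2 near1 near2 => q inU Bq.
have [w sw hw] : (h @` unit_square) q by rewrite -BE2.
have [w0 w1 wD0 wD1] := inU w sw hw.
have w2 : 0 <= w.2 <= 1 by case/andP: sw.
have [|a [aE apl]] := plq w.2; first by rewrite in_itv.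
have aEh i : 0 <= i <= 1 -> exists2 t, 0 <= t <= 1 & a t = h (i, w.2).
  move=> hi; have [t /= ht <-] : arc_set a (h (i, w.2)).
    rewrite aE; exists (i, w.2); first by split; rewrite /= ?in_itv.
    by rewrite hE// /unit_square /= hi.
  by exists t => //; move: ht; rewrite in_itv.
have [t ht at_q] : exists2 t, 0 <= t <= 1 & a t = q.
  have [|t ht e] := aEh w.1; first lra.
  by exists t => //; rewrite e -hw; case: (w).
have [t0 ht0 at0] := aEh 0 ltac:(lra).
have [t1 ht1 at1] := aEh 1 ltac:(lra).
have lev s : exists v, [/\ unit_square v, v.2 = w.2 & h v = a (c1 s)].
  have : arc_set a (a (c1 s)) by exists (c1 s) => //=; rewrite in_itv /= c01.
  rewrite aE => -[[x y] [/= hx ->]]; rewrite in_itv /= in hx => e.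
  exists (x, w.2); split=> //; first by rewrite /unit_square /= hx.
  by rewrite hE// /unit_square /= hx.
(* [k] reads the arc, whose parametrization is unrelated to [h], in the coordinates of the
   square. *)
have [k kP] := choice lev.
have ca : continuous a by exact: C1_cont (C1curve_arc a).
have ck : continuous k.
  apply: (cont_lift (@norm_hausdorff _ _) compact_unit_square ch inj (cont_comp ca cc1)) => s; by have [] := kP s.
have kE s i : 0 <= i <= 1 -> 0 <= s <= 1 -> a s = h (i, w.2) -> (k s).1 = i.
  move=> hi hs e; have [sk _] := kP s; rewrite cid// e => /inj -> //.
  by rewrite /unit_square /= hi.
have ainj s s' : 0 <= s <= 1 -> 0 <= s' <= 1 -> a s = a s' -> s = s'.
  by move=> hs hs'; apply: arc_inj; rewrite in_itv.
have kt : (k t).1 = w.1 by apply: kE => //; [lra|rewrite at_q -hw; case: (w)].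
have k0 : (k t0).1 = 0 by apply: kE => //; lra.
have k1 : (k t1).1 = 1 by apply: kE => //; lra.
have kinj s : 0 <= s <= 1 -> (k s).1 = w.1 -> s = t.
  move=> hs e; apply: ainj => //; have [_ k2 hk] := kP s.
  by rewrite cid// in hk; rewrite -hk at_q -hw; congr h; apply: plane_eq.
have t0t : t0 != t by apply/eqP => e; move: k0; rewrite e kt; lra.
have t1t : t1 != t by apply/eqP => e; move: k1; rewrite e kt; lra.
have aW : arc_set a `<=` W q.
  rewrite -(apl q); last by exists t => //=; rewrite in_itv.
  by apply: subset_trans (@connected_component_sub _ _ _) _ => s [].
have d0 : eps <= enorm (a t0 - q) by rewrite at0 -hw ltW.
have d1 : eps <= enorm (a t1 - q) by rewrite at1 -hw ltW.
have ck1 : continuous (fun s => (k s).1) by exact: cont_fst.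
(* The first coordinate of [k] takes the value [w.1] only at [t], so by the intermediate value
   theorem [t] lies between the parameters of the two ends, in whichever order these come. *)
have same s s' : s <= s' -> 0 <= s <= 1 -> 0 <= s' <= 1 ->
    (k s).1 <= w.1 <= (k s').1 \/ (k s').1 <= w.1 <= (k s).1 -> s <= t <= s'.
  move=> ss hs hs' hk; have [x hx e] := continuous_IVT ck1 ss hk.
  have [[h1 h2] [[h3 _] [_ h4]]] := (andP hx, (andP hs, andP hs')).
  by rewrite -(kinj x _ e)// (le_trans h3 h1) (le_trans h2 h4).
have w01h : 0 <= w.1 <= 1 by rewrite !ltW.
have [t01|t10] := leP t0 t1.
  have := same _ _ t01 ht0 ht1; rewrite k0 k1 => /(_ (or_introl w01h)).
  move=> /andP[l r]; exists a, t0, t, t1; split; last by split.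
  split; [by case/andP: ht0|by rewrite lt_neqAle t0t|by rewrite lt_neqAle eq_sym t1t|].
  by case/andP: ht1.
have := same _ _ (ltW t10) ht1 ht0; rewrite k0 k1 => /(_ (or_intror w01h)).
move=> /andP[l r]; exists a, t1, t, t0; split; last by split.
split; [by case/andP: ht1|by rewrite lt_neqAle t1t|by rewrite lt_neqAle eq_sym t0t|].
by case/andP: ht0.
Unshelve. all: by end_near. Qed.

End Boxes.

Section LeafCurves.
Variable R : realType.
Implicit Types (p q x : plane R) (e : plane R -> plane R) (W : foliation R).

Lemma uniform_box_step W (r : R) : exists2 eps, 0 < eps & forall q, `|q| <= r ->
  exists (a : Defs.arc R) (s t u : R),
    [/\ 0 <= s, s < t, t < u & u <= 1] /\
    [/\ a t = q, arc_set a `<=` W q, eps <= enorm (a s - q) & eps <= enorm (a u - q)].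
Proof.
have /compact_near_coveringP cov := @compact_square R r.
pose P d q := exists (a : Defs.arc R) (s t u : R),
    [/\ 0 <= s, s < t, t < u & u <= 1] /\
    [/\ a t = q, arc_set a `<=` W q, d <= enorm (a s - q) & d <= enorm (a u - q)].
have [|d /= d0 H] := cov R (0^'+) P.
  move=> q Kq; have [eps eps0 n] := box_step W q.
  exists ([set q' | P eps q'], [set d | d < eps]) => /=.
    by split => //; exact: nbhs_right_lt.
  move=> [q' d] /= [[a [s [t [u [h1 [h2 h3 h4 h5]]]]]] deps].
  exists a, s, t, u; split=> //; split=> //; exact: le_trans (ltW deps) _.
exists (d / 2); first by rewrite divr_gt0.
move=> q Kq; apply: (H (d / 2)) => //=; last by rewrite divr_gt0.
by rewrite sub0r normrN gtr0_norm ?divr_gt0// ltr_pdivrMr// ltr_pMr// ltr1n.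
Qed.

Variables (e : plane R -> plane R) (W : foliation R).
Hypothesis ue : unif_line_field e.
Hypothesis We : forall p (a : Defs.arc R), arc_set a `<=` W p ->
  forall t, 0 <= t <= 1 -> det2 (e (a t)) ('D_1 a t) = 0.

(** Half of the arc through [q] is run at unit speed. Its alignment with [cis (th _)] is continuous
    with values 1 and -1, so it keeps its initial value; the oriented field thus tells how to
    continue from any point. *)
Lemma short_leaf_curve (th : plane R -> R) (r eps : R) q : continuous th ->
  (forall p, `|p| <= r -> e p = cis (th p) \/ e p = - cis (th p)) ->
  0 < eps -> eps <= 1 -> `|q| + 1 <= r ->
  (exists (a : Defs.arc R) (s t u : R),
    [/\ 0 <= s, s < t, t < u & u <= 1] /\
    [/\ a t = q, arc_set a `<=` W q, eps <= enorm (a s - q) & eps <= enorm (a u - q)]) ->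
  exists c c', [/\ C1curve c c', c 0 = q & forall u, 0 <= u <= eps / 2 ->
    c' u = cis (th (c u)) /\ W q (c u)].
Proof.
move=> cth thE eps0 eps1 qr [a [s [t [u [[s0 st tu u1] [atq aW es eu]]]]]].
have paral p (v : plane R) : `|p| <= r -> det2 (e p) v = 0 -> det2 (cis (th p)) v = 0.
  move=> /thE[] ->//; rewrite /det2 !planeE /= => h.
  by rewrite -[LHS]opprK -[RHS]oppr0 -h; congr (- _); ring.
have t01 : 0 <= t <= 1 by lra.
have reg v : 0 <= v <= 1 -> 'D_1 a v != 0 by move=> hv; apply: arc_reg; rewrite in_itv.
pose b := dot2 (cis (th q)) ('D_1 a t).
have qr' : `|q| <= r by lra.
have aT : 'D_1 a t = b *: cis (th q).
  apply: line_coord; first exact: enorm_cis.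
  by apply: paral => //; rewrite -atq; exact: We aW _ t01.
have b0 : b != 0.
  by apply/eqP => b0; move: (reg t t01); rewrite aT b0 scale0r eqxx.
(* The end of the arc is chosen by the sign of [b], so that the curve leaves [q] in the direction
   [cis (th q)]. *)
have [z [z0 z1 zb ez]] : exists z, [/\ 0 <= z, z <= 1, 0 < (z - t) * b & eps <= enorm (a z - q)].
  have [bn|bp|b00] := ltgtP b 0.
  - exists s; split=> //; first lra.
    by rewrite nmulr_lgt0// subr_lt0.
  - exists u; split=> //; first lra.
    by rewrite mulr_gt0// subr_gt0.
  - by rewrite b00 eqxx in b0.
have z_t : z - t != 0.
  by apply/eqP => e0; move: zb; rewrite e0 mul0r ltxx.
pose g (v : R) := a (t + v * (z - t)).
pose g' (v : R) := (z - t) *: 'D_1 a (t + v * (z - t)).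
have Cg : C1curve g g' by exact: (C1curve_affine t (z - t) (C1curve_arc a)).
have in01 v : 0 <= v <= 1 -> 0 <= t + v * (z - t) <= 1.
  by move=> /andP[? ?]; apply/andP; split; nra.
have [|c [c' [L [Cc L0 c0 cL cP]]]] := unit_speed Cg.
  by move=> v hv; rewrite scaler_eq0 negb_or z_t reg// in01.
have g0 : g 0 = q by rewrite /g mul0r addr0.
have g1 : g 1 = a z by rewrite /g mul1r addrC subrK.
have Lb : eps / 2 <= L.
  have := curve_displacement (M := 1) Cc L0; rewrite cL c0 g1 g0 subr0 => h.
  have {}h : enorm (a z - q) <= 2 * 1 * L by apply: h => v /cP[-> _].
  lra.
have cr v : 0 <= v <= eps / 2 -> `|c v| <= r.
  move=> /andP[v0 ve]; have := curve_displacement (M := 1) Cc v0.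
  rewrite c0 g0 subr0 => h.
  have {}h : enorm (c v - q) <= 2 * 1 * v.
    apply: h => y /andP[y0 yv]; have [|-> _//] := cP y; lra.
  have := ler_normD (c v - q) q; have := norm_le_enorm (c v - q).
  rewrite subrK; lra.
have cpar v : 0 <= v <= eps / 2 -> [/\ enorm (c' v) = 1, det2 (cis (th (c v))) (c' v) = 0 & W q (c v)].
  move=> hv; have [|c1 [y [k [y01 k0 cy cy']]]] := cP v; first lra.
  have dy : det2 (e (a (t + y * (z - t)))) ('D_1 a (t + y * (z - t))) = 0.
    exact: We aW _ (in01 _ y01).
  split=> //.
    apply: paral; first exact: cr.
    by rewrite cy cy' /g /g' !det2Zr dy !mulr0.
  by rewrite cy; apply: aW; exists (t + y * (z - t)) => //=; rewrite in_itv /= in01.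
exists c, c'; split=> //; first by rewrite c0.
pose phi v := dot2 (cis (th (c v))) (c' v).
have cphi : continuous phi.
  have cc := C1_cont Cc; case: Cc => cc' _.
  have cthc : continuous (fun v => th (c v)) by exact: (cont_comp cth cc).
  by apply: cont_dot2 => //; rewrite /cis; cont.
have phi1 v : 0 <= v <= eps / 2 -> phi v = 1 \/ phi v = -1.
  move=> /cpar[c1 d0 _]; have := lagrange (cis (th (c v))) (c' v).
  rewrite d0 c1 enorm_cis expr0n /= addr0 !expr1n mulr1 -/(phi v) => /eqP.
  rewrite sqrf_eq1 => /orP[] /eqP ->; by [left|right].
have phi0 : phi 0 = 1.
  have [|//|pm] := phi1 0; first lra.
  have [|c1 [y [k [y01 k0 cy cy']]]] := cP 0; first by rewrite lexx.
  have y0 : y = 0.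
    apply: (mulIf z_t); apply: (addrI t).
    apply: (@arc_inj _ a); rewrite ?in_itv /= ?in01//; last by rewrite -/(g y) -cy c0.
    by rewrite lexx ler01.
  exfalso; move: pm; rewrite /phi cy' c0 g0 /g' y0 mul0r addr0 aT /dot2 ?planeE /=.
  have := cos2Dsin2 (th q) => cs h.
  have : k * ((z - t) * b) = -1.
    rewrite -h -[LHS]mulr1 -cs /GRing.scale /=; ring.
  by have := mulr_gt0 k0 zb; lra.
move=> v hv; have [c1 d0 Wv] := cpar v hv; split=> //.
have -> : c' v = phi v *: cis (th (c v)).
  by apply: line_coord d0; exact: enorm_cis.
have [-> |pm] := phi1 v hv; first by rewrite scale1r.
have [v0 v1] := andP hv.
have [|y hy y0] := continuous_IVT (v := 0) cphi v0; first by rewrite phi0 pm; right; lra.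
have yv : 0 <= y <= eps / 2.
  by have [y0' yv] := andP hy; rewrite y0' (le_trans yv).
by case: (phi1 y yv); rewrite y0 => /eqP; rewrite eq_sym ?oppr_eq0 oner_eq0.
Qed.

(** Short pieces of a fixed length [d] are glued. At each junction both tangents equal [cis (th _)],
    so the result is again of class C^1. *)
Lemma long_leaf_curve x (T : R) : 0 <= T -> exists c c', [/\ C1curve c c', c 0 = x &
  forall t, 0 <= t <= T -> [/\ enorm (c' t) = 1, det2 (e (c t)) (c' t) = 0 & W x (c t)]].
Proof.
(* A curve of length at most [T + 1] moves by at most [2 * (T + 1)]; the last summand leaves room
   for the next piece. *)
move=> T0; pose r := `|x| + 2 * (T + 1) + 1.
have r0 : 0 <= r by have := normr_ge0 x; rewrite /r; lra.
have [th cth thE] := line_field_angle ue r0.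
have [eps0 eps00 box] := uniform_box_step W r.
pose eps := Num.min eps0 1.
have eps1 : 0 < eps by rewrite lt_min eps00 ltr01.
have epsle : eps <= 1 by rewrite ge_min lexx orbT.
pose d := eps / 2; have d0 : 0 < d by rewrite divr_gt0.
have d1 : d <= 1 by rewrite /d; lra.
have short q : `|q| + 1 <= r -> exists c c', [/\ C1curve c c', c 0 = q & forall u, 0 <= u <= d ->
    c' u = cis (th (c u)) /\ W q (c u)].
  move=> qr; apply: (short_leaf_curve cth thE eps1 epsle qr).
  have [|a [s [t [u [h1 [h2 h3 h4 h5]]]]]] := box q; first lra.
  exists a, s, t, u; split=> //; split=> //; [apply: le_trans h4|apply: le_trans h5]; by rewrite ge_min lexx.
have disp c c' (a b : R) : C1curve c c' -> 0 <= a -> a <= b -> b <= T + 1 -> c 0 = x ->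
    (forall u, 0 <= u <= b -> c' u = cis (th (c u))) -> `|c a| + 1 <= r.
  move=> Cc a0 ab bT c0 cE; have := curve_displacement (M := 1) Cc a0; rewrite c0 subr0 => h.
  have {}h : enorm (c a - x) <= 2 * 1 * a.
    by apply: h => y /andP[y0 ya]; rewrite cE ?enorm_cis//; lra.
  have := ler_normD (c a - x) x; have := norm_le_enorm (c a - x).
  by rewrite subrK /r; lra.
have main n : n%:R * d <= T + 1 -> exists c c', [/\ C1curve c c', c 0 = x & forall u, 0 <= u <= n%:R * d ->
    c' u = cis (th (c u)) /\ W x (c u)].
  elim: n => [|n IH] nT.
    have [|c [c' [Cc c0 cP]]] := short x; first by rewrite /r; lra.
    by exists c, c'; split=> // u hu; apply: cP; move: hu; rewrite mul0r; lra.
  have nE : n.+1%:R * d = n%:R * d + d by rewrite -natr1 mulrDl mul1r.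
  rewrite nE in nT *; set l := n%:R * d in nT IH *.
  have l0 : 0 <= l by rewrite mulr_ge0// ltW.
  have [|c [c' [Cc c0 cP]]] := IH; first lra.
  have [|h [h' [Ch h0 hP]]] := short (c l).
    apply: (disp c c' l l Cc l0 (lexx l) _ c0); first lra.
    by move=> u /cP[].
  have Ch2 := C1curve_affine (- l) 1 Ch.
  have el : - l + l * 1 = 0 by ring.
  exists (glue l c (fun t => h (- l + t * 1))), (glue l c' (fun t => 1 *: h' (- l + t * 1))); split.
  - apply: C1curve_glue => //; first by rewrite el h0.
    have [-> _] := cP l ltac:(lra).
    by rewrite el scale1r; have [-> _] := hP 0 ltac:(lra); rewrite h0.
  - by rewrite /glue l0.
  move=> u /andP[u0 ul]; rewrite /glue; have [ul'|ul'] := leP u l.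
    by apply: cP; rewrite u0.
  have [|hE hW] := hP (- l + u * 1); first by lra.
  rewrite scale1r; split=> //.
  by have [_ /leaf_eq <-] := cP l ltac:(lra).
pose n := (Num.truncn (T / d)).+1.
have nT : n%:R * d <= T + 1.
  rewrite -natr1 mulrDl mul1r; apply: lerD => //.
  by rewrite -ler_pdivlMr// truncn_le// divr_ge0// ltW.
have Tn : T <= n%:R * d by rewrite -ler_pdivrMr// ltW// truncnS_gt.
have [c [c' [Cc c0 cP]]] := main n nT.
exists c, c'; split=> // t ht; have [|c't Wt] := cP t; first lra.
have cr : `|c t| <= r.
  have : `|c t| + 1 <= r; last lra.
  by apply: (disp c c' t (n%:R * d)) => //; try lra; move=> u /cP[].
by split=> //; rewrite c't ?enorm_cis//; case: (thE _ cr) => ->; rewrite /det2 ?planeE /=; ring.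
Qed.

End LeafCurves.

Lemma max1_upper (R : realType) (D E J : R) : 0 <= J -> E <= D * J -> E <= Num.max 1 D * J.
Proof. by move=> J0 /le_trans; apply; rewrite ler_wpM2r// le_max lexx orbT. Qed.

Lemma max1_lower (R : realType) (D E J : R) : 0 <= E -> J <= D * E -> (Num.max 1 D)^-1 * J <= E.
Proof. by move=> E0 h; rewrite ler_pdivrMl ?lt_max ?ltr01//; exact: max1_upper. Qed.

Lemma ratio_bound (R : realType) (m M C E1 E2 n1 n2 : R) : 0 < m -> m <= n2 ->
  n1 <= M -> 0 <= C -> 0 <= E1 -> 0 <= E2 -> E1 * n2 <= C * (n1 * E2) ->
  E1 <= C * M / m * E2.
Proof.
move=> m0 mn nM C0 E10 E20 h; rewrite mulrAC ler_pdivlMr// -mulrA.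
apply: (le_trans (ler_wpM2l E10 mn)); apply: (le_trans h).
by rewrite ler_wpM2l// ler_wpM2r.
Qed.

Section StableData.
Variable R : realType.
Implicit Types (p v : plane R).
Variables (f : torus R -> torus R) (F : plane R -> plane R) (A : 'M[int]_2).

(** Every point lies on an arc of its leaf, and a tangent vector in [stable_dir] comes with an orbit
    of the lift and a splitting along it. *)
Lemma orbit_splitting (Ws : foliation R) : stable_foliation F Ws -> forall p,
  exists (x : int -> plane R) Eu Es,
  [/\ full_orbit F x, x 0 = p & hyperbolic_splitting (plane_iter F) x Eu Es].
Proof.
move=> tWs p.
have [eps _ n] := box_step Ws p.
have [a [l [t [r [[l0 lt tr r1] [at_p aW _ _]]]]]] := nbhs_singleton n.
have [|x [Eu [Es [ox x0 spl _]]]] := tWs p a aW t.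
  by rewrite in_itv /=; apply/andP; split; lra.
by exists x, Eu, Es; rewrite x0 at_p.
Qed.

Hypothesis lF : is_lift f F.
Hypothesis hA : is_linearization f A.
Hypothesis C1F : Ck 1 [set: plane R] F.
Hypothesis anF : anosov f F.
Hypothesis splF : forall p, exists (x : int -> plane R) Eu Es,
  [/\ full_orbit F x, x 0 = p & hyperbolic_splitting (plane_iter F) x Eu Es].

Lemma stable_field : exists e : plane R -> plane R, [/\ unif_line_field e,
  forall p, fwd_bounded F p (e p) &
  forall p v, fwd_bounded F p v -> exists a, v = a *: e p].
Proof.
exists (es splF); split; first exact: (stable_field_unif lF hA C1F anF splF).
  by move=> p; exact: esP.
by move=> p v; exact: fwd_bounded_es.
Qed.

End StableData.

(** * Growth of derivatives along leaves *)

Section LeafGrowth.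
Variable R : realType.
Implicit Types (p q x v w : plane R).
Variables (f : torus R -> torus R) (F : plane R -> plane R) (A : 'M[int]_2).
Variables Ws Wu : foliation R.
Hypothesis lF : is_lift f F.
Hypothesis hA : is_linearization f A.
Hypothesis C1F : Ck 1 [set: plane R] F.
Hypothesis anF : anosov f F.
Hypothesis splF : forall p, exists (x : int -> plane R) Eu Es,
  [/\ full_orbit F x, x 0 = p & hyperbolic_splitting (plane_iter F) x Eu Es].
Variable es : plane R -> plane R.
Hypothesis ues : unif_line_field es.
Hypothesis esP : forall p, fwd_bounded F p (es p).
Hypothesis es_line : forall p v, fwd_bounded F p v -> exists a, v = a *: es p.
Hypothesis tWs : stable_foliation F Ws.
Hypothesis tWu : unstable_foliation F Wu.
Hypothesis qWs : quasi_preserves_densities F Ws.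
Hypothesis qWu : quasi_preserves_densities F Wu.

Let T := plane_iter F.
Local Opaque plane_iter.
Let TS' n p v : T n.+1 p v = T 1 (iter n F p) (T n p v) := TS C1F n p v.
Let TD' n m p v : T (n + m) p v = T m (iter n F p) (T n p v) := TD C1F n m p v.
Let Tscale n p a v : T n p (a *: v) = a *: T n p v := TscaleE F n p a v.
Let Tadd n p v w : T n p (v + w) = T n p v + T n p w := TaddE F n p v w.

Lemma lift_onto p : exists q, F q = p.
Proof.
have [x [Eu [Es [ox <- _]]]] := splF p.
by exists (x (-1)); rewrite ox addNr.
Qed.

(** A vector killed by the derivative has a bounded forward orbit, so it lies on the stable line;
    but the derivative maps that line onto a line. *)
Lemma T_inj n p v : T n p v = 0 -> v = 0.
Proof.
have T00 m q : T m q 0 = 0 by rewrite -[in LHS](scale0r (0 : plane R)) Tscale scale0r.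
suff T1 q w : T 1 q w = 0 -> w = 0.
  elim: n v => [|n IH] v; first by rewrite /T T0.
  by rewrite TS' => /T1/IH.
have [x [Eu [Es [ox <- spl]]]] := splF q => Tw0.
have bw : fwd_bounded F (x 0) w.
  exists (enorm w) => -[|m]; first by rewrite T0.
  by rewrite -[m.+1]add1n; rewrite [X in enorm X](TD' 1 m) Tw0 T00 enorm0 enorm_ge0.
have Esw := (fwd_boundedP 0 w spl).2 bw.
apply: contrapT => /eqP w0.
have [_ [e e0 EE]] := split_is_line spl 0; rewrite EE in Esw.
have [_ [e' e'0 EE']] := split_is_line spl (0 + 1).
have [b _ bw'] := Esw.
have b0 : b != 0 by apply/eqP => b0; move: w0; rewrite -bw' b0 scale0r eqxx.
have [_ inv _] := spl; have [_ invs] := inv 0.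
have : Es (0 + 1) e' by rewrite EE'; exists 1 => //; rewrite scale1r.
rewrite -invs => -[v']; rewrite EE => -[a _ <-] Ta.
move: e'0; rewrite -Ta.
have -> : a *: e = (a / b) *: w by rewrite -bw' scalerA divfK.
by rewrite [X in X != 0](Tscale 1) Tw0 scaler0 eqxx.
Qed.

Lemma shift_splitting (x : int -> plane R) Eu Es (k : int) : full_orbit F x ->
  hyperbolic_splitting (plane_iter F) x Eu Es ->
  full_orbit F (fun i => x (i + k)) /\
  hyperbolic_splitting (plane_iter F) (fun i => x (i + k)) (fun i => Eu (i + k)) (fun i => Es (i + k)).
Proof.
move=> ox [h1 h2 [c [l [c0 l1 H]]]]; split=> [i|].
  by rewrite ox addrAC.
split=> [i|i|]; first exact: h1.
  by rewrite addrAC; exact: h2.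
by exists c, l; split=> // n i; exact: H.
Qed.

Lemma unstable_push (x : int -> plane R) Eu Es n v : full_orbit F x ->
  hyperbolic_splitting (plane_iter F) x Eu Es -> Eu 0 v ->
  Eu n%:Z (T n (x 0) v) /\ iter n F (x 0) = x n%:Z.
Proof.
move=> ox [_ inv _] Ev; elim: n => [|n [IH1 IH2]]; first by rewrite /T T0.
have e : n.+1%:Z = n%:Z + 1 by rewrite -PoszD addn1.
split; last by rewrite /= IH2 ox e.
rewrite TS' IH2 e; have [<- _] := inv n%:Z.
by exists (T n (x 0) v).
Qed.

Definition rot v : plane R := (- v.2, v.1).

(** The field against which stable leaves are transversal; it is as uniformly continuous as [es]. *)
Definition stable_normal p := rot (es p).

Lemma stable_normal_unif : unif_line_field stable_normal.
Proof.
have [es1 ue] := ues.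
have dr v w : det2 (rot v) (rot w) = det2 v w by rewrite /det2 /rot /=; ring.
split=> [p|h h0]; first by rewrite /enorm /= sqrrN addrC; exact: es1.
by have [d d0 H] := ue h h0; exists d => // p q pq; rewrite /stable_normal dr; exact: H.
Qed.

Lemma stable_normal_det p v : fwd_bounded F p v ->
  `|det2 (stable_normal p) v| = enorm v.
Proof.
have [es1 _] := ues; move=> /es_line[a ->]; rewrite enormZ es1.
have := sq_enorm (es p); rewrite es1 expr1n => e.
rewrite mulr1 -normrN; congr (`|_|).
by rewrite -[RHS]mulr1 e /det2 /stable_normal /rot !planeE /=; ring.
Qed.

Lemma stable_tangent p (a : Defs.arc R) t : arc_set a `<=` Ws p -> 0 <= t <= 1 ->
  fwd_bounded F (a t) ('D_1 a t).
Proof.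
move=> aW ht; have [|x [Eu [Es [ox x0 spl Ev]]]] := tWs aW (t := t).
  by rewrite in_itv.
by rewrite -x0; exact: (fwd_boundedP _ _ spl).1.
Qed.

Lemma arc_reg01 (a : Defs.arc R) t : 0 <= t <= 1 -> 'D_1 a t != 0.
Proof. by move=> ht; apply: arc_reg; rewrite in_itv. Qed.

Lemma stable_growth : exists2 C, 0 < C & forall p (a : Defs.arc R), arc_set a `<=` Ws p ->
    forall k s t, 0 <= s <= 1 -> 0 <= t <= 1 ->
    enorm (T k (a s) ('D_1 a s)) * enorm ('D_1 a t) <=
    C * (enorm ('D_1 a s) * enorm (T k (a t) ('D_1 a t))).
Proof.
apply: (qpd_growth C1F stable_normal_unif qWs) => p a aW k t ht.
rewrite -normr_gt0 stable_normal_det.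
  by rewrite enorm_gt0; apply/eqP => /T_inj/eqP; apply/negP; exact: arc_reg01.
exact: (fwd_bounded_iter C1F k (stable_tangent aW ht)).
Qed.

(** A leaf curve of any length, rescaled to [0, 1], is an arc, and the distortion constant of
    [stable_growth] is the same for all arcs. All norms are compared with the one at [x]. *)
Lemma stable_curve_growth : exists2 C, 1 <= C & forall x k (S : R), 0 < S ->
  exists c c', [/\ C1curve c c', c 0 = x & forall t, 0 <= t <= S ->
    [/\ enorm (c' t) = 1, fwd_bounded F (c t) (c' t),
      C^-1 * enorm (T k x (es x)) <= enorm (T k (c t) (c' t)) &
      enorm (T k (c t) (c' t)) <= C * enorm (T k x (es x))]].
Proof.
have [es1 _] := ues.
have [C C0 HC] := stable_growth; exists (Num.max 1 C) => [|x k S S0].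
  by rewrite le_max lexx.
have tan p (a : Defs.arc R) : arc_set a `<=` Ws p ->
    forall t, 0 <= t <= 1 -> det2 (es (a t)) ('D_1 a t) = 0.
  move=> aW t ht; have [b ->] := es_line (stable_tangent aW ht).
  by rewrite /det2 !planeE; ring.
have [c [c' [Cc c0 cP]]] := long_leaf_curve ues tan x (ltW S0).
have Ca := C1curve_affine 0 S Cc.
have in01 t : 0 <= t <= 1 -> 0 <= 0 + t * S <= S.
  by move=> /andP[t0 t1]; rewrite add0r mulr_ge0 ?(ltW S0)//= ler_piMl// ltW.
have tr t : 0 <= t <= 1 -> det2 (stable_normal (c (0 + t * S))) (S *: c' (0 + t * S)) != 0.
  move=> /in01 /cP[c1 d0 _]; rewrite det2Zr mulf_neq0//; first by rewrite gt_eqF.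
  have bc : fwd_bounded F (c (0 + t * S)) (c' (0 + t * S)).
    by rewrite (line_coord (es1 _) d0); exact: (fwd_bounded_scale _ (esP _)).
  by rewrite -normr_gt0 stable_normal_det// c1.
have [||b [bE bE']] := arc_of_curve Ca.
- by move=> t /tr; apply: contra_neq => ->; rewrite det20.
- exact: (curve_injective stable_normal_unif Ca tr).
have bW : arc_set b `<=` Ws x.
  move=> _ [t /= + <-]; rewrite in_itv /= bE => /in01 ht.
  by have [] := cP _ ht.
have bt t : b t = c (0 + t * S) by rewrite bE.
have bt' t : 'D_1 b t = S *: c' (0 + t * S) := congr1 (fun g : R -> plane R => g t) bE'.
have pos t : 0 <= t <= S -> exists2 u, 0 <= u <= 1 & 0 + u * S = t.
  move=> /andP[t0 t1]; exists (t / S); last by rewrite add0r divfK ?gt_eqF.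
  by rewrite divr_ge0 ?(ltW S0)//= ler_pdivrMr// mul1r.
have cmp s t : 0 <= s <= S -> 0 <= t <= S ->
    enorm (T k (c s) (c' s)) <= C * enorm (T k (c t) (c' t)).
  move=> hs ht; have [[c1s _ _] [c1t _ _]] := (cP s hs, cP t ht).
  have [u hu us] := pos s hs; have [v hv vt] := pos t ht.
  have := HC _ _ bW k u v hu hv; rewrite !bt !bt' us vt.
  rewrite (Tscale k (c s)) (Tscale k (c t)) !enormZ c1s c1t (gtr0_norm S0) !mulr1.
  move: (enorm (T k (c s) (c' s))) (enorm (T k (c t) (c' t))) => a d.
  have -> : S * a * S = (S * S) * a by ring.
  have -> : C * (S * (S * d)) = (S * S) * (C * d) by ring.
  by rewrite ler_pM2l// mulr_gt0.
have S00 : (0 : R) <= 0 <= S by apply/andP; split; [exact: lexx|exact: ltW].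
have J0 : enorm (T k (c 0) (c' 0)) = enorm (T k x (es x)).
  have [c1 d0 _] := cP 0 S00; rewrite c0 in d0 *.
  move: c1; rewrite (line_coord (es1 _) d0) (Tscale k) !enormZ es1 mulr1 => ->.
  by rewrite mul1r.
exists c, c'; split=> // t ht; have [c1 d0 Wt] := cP t ht.
have m0 : 0 < Num.max 1 C by rewrite lt_max ltr01.
have Cm : C <= Num.max 1 C by rewrite le_max lexx orbT.
split=> //.
- by rewrite (line_coord (es1 _) d0); exact: (fwd_bounded_scale _ (esP _)).
- rewrite ler_pdivrMl// -J0; apply: (le_trans (cmp 0 t S00 ht)).
  by rewrite ler_wpM2r ?enorm_ge0.
- rewrite -J0; apply: (le_trans (cmp t 0 ht S00)).
  by rewrite ler_wpM2r ?enorm_ge0.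
Qed.

Lemma stable_rescaled : exists2 C, 1 <= C & forall x k (L : R), 0 < L ->
  exists c c' g g', let J := enorm (T k x (es x)) in
    [/\ C1curve c c', C1curve g g', 0 < J,
       forall t, 0 <= t <= L / J -> enorm (c' t) = 1 /\ `|det2 (stable_normal (c t)) (c' t)| = 1 &
       forall t, 0 <= t <= L -> [/\ g t = iter k F (c (t / J)), enorm (g' t) <= C,
         C^-1 <= `|det2 (stable_normal (g t)) (g' t)| &
         forall j s, 0 <= s <= t -> enorm (iter j F (g t) - iter j F (g s)) <= C * L]].
Proof.
have [K K1 HK] := stable_bound lF hA C1F anF.
have [C C1 HC] := stable_curve_growth.
have C0 : 0 < C by exact: lt_le_trans ltr01 C1.
have K0 : 0 < K by exact: lt_le_trans ltr01 K1.
have [es1 _] := ues.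
(* [C] bounds the rescaled speed, [K] its growth under later iterates, and 2 comes from
   [curve_displacement]. *)
exists (2 * (K * C)); first by have := ler_pM ler01 ler01 K1 C1; rewrite mulr1; lra.
move=> x k L L0.
pose J := enorm (T k x (es x)).
have J0 : 0 < J.
  rewrite enorm_gt0; apply/eqP => /T_inj e; have := es1 x; rewrite e enorm0 => /eqP.
  by rewrite eq_sym oner_eq0.
have [|c [c' [Cc c0 cP]]] := HC x k (L / J); first by rewrite divr_gt0.
have Ca := C1curve_affine 0 J^-1 Cc.
have Cg := C1curve_iter C1F k Ca.
pose g (t : R) := iter k F (c (0 + t * J^-1)).
pose g' (t : R) := T k (c (0 + t * J^-1)) (J^-1 *: c' (0 + t * J^-1)).
have C1g : C1curve g g' := Cg.
have inL t : 0 <= t <= L -> 0 <= 0 + t * J^-1 <= L / J.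
  move=> /andP[t0 tL]; rewrite add0r divr_ge0 ?(ltW J0)//=.
  by rewrite ler_wpM2r// invr_ge0 ltW.
have gE t : g' t = J^-1 *: T k (c (0 + t * J^-1)) (c' (0 + t * J^-1)).
  exact: Tscale.
have CKC : C <= 2 * (K * C).
  have := ler_wpM2r (ltW C0) K1; rewrite mul1r; lra.
have gP t : 0 <= t <= L -> [/\ fwd_bounded F (g t) (g' t), C^-1 <= enorm (g' t) & enorm (g' t) <= C].
  move=> /inL /cP[c1 cb lo hi]; split.
  - rewrite gE; exact: (fwd_bounded_scale _ (fwd_bounded_iter C1F k cb)).
  - rewrite gE enormZ gtr0_norm ?invr_gt0// ler_pdivlMl// mulrC; exact: lo.
  - by rewrite gE enormZ gtr0_norm ?invr_gt0// ler_pdivrMl// [J * C]mulrC; exact: hi.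
exists c, c', g, g'; split=> //.
  by move=> t /cP[c1 cb _ _]; rewrite stable_normal_det.
move=> t ht; have [gb lo hi] := gP t ht; split.
- by rewrite /g add0r.
- exact: le_trans hi CKC.
- rewrite stable_normal_det//; apply: le_trans lo.
  by rewrite lef_pV2 ?posrE// (lt_le_trans C0).
move=> j s /andP[s0 st]; have [t0 tL] := andP ht.
have Cj := C1curve_iter C1F j C1g.
have := curve_displacement (M := K * C) Cj st => h.
apply: le_trans (h _) _ => [u /andP[su ut]|].
  have [|gbu _ hiu] := gP u; first by rewrite (le_trans s0)//= (le_trans ut).
  apply: (le_trans (HK _ _ gbu j)); by rewrite ler_wpM2l// ltW.
by rewrite ler_wpM2l ?mulr_ge0 ?(ltW K0) ?(ltW C0)//; lra.
Qed.

(** Images of unstable vectors are unstable for the shifted orbit, to which [uniform_angle]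
    applies. *)
Lemma unstable_angle : exists2 al, 0 < al & forall p v n,
  unstable_dir F (plane_iter F) p v ->
  al * enorm (T n p v) <= `|det2 (es (iter n F p)) (T n p v)|.
Proof.
have [al al0 H] := uniform_angle lF hA C1F anF.
exists al => // p v n [x [Eu [Es [ox <- spl Ev]]]].
have [Ew orb] := unstable_push n ox spl Ev.
rewrite orb; move: Ew; move: (T n (x 0) v) => w Ew.
have [->|w0] := eqVneq w 0; first by rewrite enorm0 mulr0.
have ew0 : 0 < enorm w by rewrite enorm_gt0.
have [ox' spl'] := shift_splitting n%:Z ox spl.
have : al <= `|det2 (es (x n%:Z)) ((enorm w)^-1 *: w)|.
  have := H _ _ _ ((enorm w)^-1 *: w) (es (x n%:Z)) ox' spl'; rewrite add0r; apply.
  - exact: line_scale (split_is_line spl _).1 Ew.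
  - by rewrite enormZ gtr0_norm ?invr_gt0// mulVf// gt_eqF.
  - exact: esP.
  - by have [] := ues.
by rewrite det2Zr normrM gtr0_norm ?invr_gt0// ler_pdivlMl// [_ * al]mulrC.
Qed.

Lemma unstable_tangent p (a : Defs.arc R) t : arc_set a `<=` Wu p -> 0 <= t <= 1 ->
  unstable_dir F (plane_iter F) (a t) ('D_1 a t).
Proof. by move=> aW ht; apply: tWu aW _ _; rewrite in_itv. Qed.

Lemma unstable_growth : exists2 C, 0 < C & forall p (a : Defs.arc R), arc_set a `<=` Wu p ->
    forall k s t, 0 <= s <= 1 -> 0 <= t <= 1 ->
    enorm (T k (a s) ('D_1 a s)) * enorm ('D_1 a t) <=
    C * (enorm ('D_1 a s) * enorm (T k (a t) ('D_1 a t))).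
Proof.
have [al al0 H] := unstable_angle.
apply: (qpd_growth C1F ues qWu) => p a aW k t ht.
rewrite -normr_gt0; apply: lt_le_trans (H _ _ k (unstable_tangent aW ht)).
by rewrite mulr_gt0// enorm_gt0; apply/eqP => /T_inj/eqP; apply/negP; exact: arc_reg01.
Qed.

(** A single arc through [x] suffices, since its images grow. Only [C] depends on [x], through the
    extreme speeds [m] and [M] of that arc. *)
Lemma unstable_curve : exists2 al, 0 < al & forall x, exists C v g g',
  [/\ 1 <= C, ~ fwd_bounded F x v, C1curve g g' & forall k, let J := enorm (T k x v) in
    0 < J /\ forall t, 0 <= t <= 1 ->
    [/\ C^-1 * J <= enorm (T k (g t) (g' t)), enorm (T k (g t) (g' t)) <= C * J &
        al * enorm (T k (g t) (g' t)) <= `|det2 (es (iter k F (g t))) (T k (g t) (g' t))|]].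
Proof.
have [al al0 Hal] := unstable_angle; have [C C0 HC] := unstable_growth.
exists al => // x.
have [eps _ n] := box_step Wu x.
have [a [l [t0 [r [[l0 lt tr r1] [at_x aW _ _]]]]]] := nbhs_singleton n.
have ht0 : 0 <= t0 <= 1 by apply/andP; split; lra.
have Ca := C1curve_arc a; have [ca' _] := Ca.
have cs : continuous (fun t => enorm ('D_1 a t)) by exact: cont_enorm.
have [||tm tm01 mt] := @EVT_min R (fun t => enorm ('D_1 a t)) 0 1; [by []|exact: continuous_subspaceT|].
have [||tM tM01 Mt] := @EVT_max R (fun t => enorm ('D_1 a t)) 0 1; [by []|exact: continuous_subspaceT|].
rewrite in_itv /= in tm01; rewrite in_itv /= in tM01.
pose m := enorm ('D_1 a tm); pose M := enorm ('D_1 a tM).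
have m0 : 0 < m by rewrite enorm_gt0 arc_reg01.
have mle t : 0 <= t <= 1 -> m <= enorm ('D_1 a t) by move=> ht; apply: mt; rewrite in_itv.
have Mle t : 0 <= t <= 1 -> enorm ('D_1 a t) <= M by move=> ht; apply: Mt; rewrite in_itv.
pose D := C * M / m.
have cmp k s t : 0 <= s <= 1 -> 0 <= t <= 1 ->
    enorm (T k (a s) ('D_1 a s)) <= D * enorm (T k (a t) ('D_1 a t)).
  move=> hs ht; have h1 := HC x a aW k s t hs ht; have h2 := mle t ht; have h3 := Mle s hs.
  have h4 := enorm_ge0 (T k (a s) ('D_1 a s)); have h5 := enorm_ge0 (T k (a t) ('D_1 a t)).
  exact: (ratio_bound m0 h2 h3 (ltW C0) h4 h5 h1).
pose v := 'D_1 a t0.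
have v0 : v != 0 by exact: arc_reg01.
exists (Num.max 1 D), v, a, ('D_1 a); split=> //.
- by rewrite le_max lexx.
- have [y [Eu [Es [oy y0 spl Ev]]]] := unstable_tangent aW ht0.
  rewrite -at_x -y0 => /(fwd_boundedP 0 _ spl) Ev'.
  by move/eqP: v0; apply; exact: (split_uniq spl Ev).
move=> k J; split.
  by rewrite enorm_gt0; apply/eqP => /T_inj/eqP; apply/negP.
have J0 : enorm (T k (a t0) ('D_1 a t0)) = J by rewrite at_x.
move=> t ht; split.
- apply: max1_lower; first exact: enorm_ge0.
  by rewrite -J0; exact: (cmp k t0 t ht0 ht).
- apply: max1_upper; first exact: enorm_ge0.
  by rewrite -J0; exact: (cmp k t t0 ht ht0).
- exact: Hal (unstable_tangent aW ht).
Qed.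

End LeafGrowth.

(** * Comparison with the linear part *)

Section Linear.
Variable R : realType.
Implicit Types (p q m : plane R).
Variables (F : plane R -> plane R) (A : 'M[int]_2) (C0 : R).
Hypothesis near : forall p, enorm (F p - mat_act A p) <= C0.

Lemma sum_geom_bound (x : nat -> R) (mu D : R) : 0 <= mu -> mu != 1 ->
  (forall k, `|x k.+1| <= mu * `|x k| + D) ->
  forall k, `|x k| <= mu ^+ k * `|x 0| + D * ((mu ^+ k - 1) / (mu - 1)).
Proof.
move=> mu0 mu1 H; elim=> [|k IH]; first by rewrite expr0 subrr mul0r mulr0 addr0 mul1r.
apply: (le_trans (H k)).
have m1 : mu - 1 != 0 by rewrite subr_eq0.
have -> : mu ^+ k.+1 * `|x 0| + D * ((mu ^+ k.+1 - 1) / (mu - 1)) =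
    mu * (mu ^+ k * `|x 0| + D * ((mu ^+ k - 1) / (mu - 1))) + D.
  by rewrite exprS; field.
by rewrite lerD2r ler_wpM2l.
Qed.

Lemma sum_geom_lower (x : nat -> R) (mu D : R) : 0 <= mu -> mu != 1 ->
  (forall k, mu * `|x k| - D <= `|x k.+1|) ->
  forall k, mu ^+ k * `|x 0| - D * ((mu ^+ k - 1) / (mu - 1)) <= `|x k|.
Proof.
move=> mu0 mu1 H; elim=> [|k IH]; first by rewrite expr0 subrr mul0r mulr0 subr0 mul1r.
apply: le_trans (H k).
have m1 : mu - 1 != 0 by rewrite subr_eq0.
have -> : mu ^+ k.+1 * `|x 0| - D * ((mu ^+ k.+1 - 1) / (mu - 1)) =
    mu * (mu ^+ k * `|x 0| - D * ((mu ^+ k - 1) / (mu - 1))) - D.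
  by rewrite exprS; field.
by rewrite lerD2r ler_wpM2l.
Qed.

Definition left_eigen (mu : R) m := forall p, dot2 m (mat_act A p) = mu * dot2 m p.

Lemma dot2B m p q : dot2 m (p - q) = dot2 m p - dot2 m q.
Proof. by rewrite /dot2 !planeE; ring. Qed.

Lemma mat_actB p q : mat_act A (p - q) = mat_act A p - mat_act A q.
Proof. by apply: plane_eq; rewrite /mat_act !planeE /=; ring. Qed.

Lemma near_diff p q : enorm (F p - F q - mat_act A (p - q)) <= 2 * C0.
Proof.
have -> : F p - F q - mat_act A (p - q) = (F p - mat_act A p) - (F q - mat_act A q).
  by rewrite mat_actB !opprD !opprK addrACA.
apply: (le_trans (enormD _ _)); rewrite enormN; have := near p; have := near q; lra.
Qed.

Section Functional.
Variables (mu : R) (m : plane R).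
Hypothesis mE : left_eigen mu m.
Let D := enorm m * (2 * C0).

Lemma dot_step p q : `|dot2 m (F p - F q) - mu * dot2 m (p - q)| <= D.
Proof.
rewrite -mE -dot2B; apply: (le_trans (le_dot2 _ _)).
by rewrite ler_wpM2l ?enorm_ge0// near_diff.
Qed.

Let x p q k := dot2 m (iter k F p - iter k F q).

Lemma dot_step_upper p q k : `|x p q k.+1| <= `|mu| * `|x p q k| + D.
Proof.
have := dot_step (iter k F p) (iter k F q); rewrite -normrM => h.
have := ler_normD (x p q k.+1 - mu * x p q k) (mu * x p q k).
rewrite subrK addrC => h2; apply: (le_trans h2); exact: lerD.
Qed.

Lemma dot_step_lower p q k : `|mu| * `|x p q k| - D <= `|x p q k.+1|.
Proof.
have := dot_step (iter k F p) (iter k F q); rewrite -normrM distrC => h.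
have := ler_normD (mu * x p q k - x p q k.+1) (x p q k.+1).
rewrite subrK => h2; rewrite lerBlDr; apply: (le_trans h2).
by rewrite addrC lerD2l.
Qed.

(** An error made at step j is multiplied by [|mu|] at each later step; together the errors amount
    to a perturbation of size [D / (|mu| - 1)] of the initial extent. *)
Lemma expand_upper : 1 < `|mu| -> exists2 C, 0 < C & forall p q k,
  `|dot2 m (iter k F p - iter k F q)| <= `|mu| ^+ k * (`|dot2 m (p - q)| + C).
Proof.
move=> mu1; have D0 : 0 <= D by apply: le_trans (normr_ge0 _) (dot_step 0 0).
have m1 : 0 < `|mu| - 1 by rewrite subr_gt0.
exists (D / (`|mu| - 1) + 1) => [|p q k].
  by have := divr_ge0 D0 (ltW m1); lra.
apply: le_trans (sum_geom_bound (normr_ge0 mu) _ (dot_step_upper p q) k) _; first by rewrite gt_eqF.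
rewrite mulrDr /x /= lerD2l.
have h : 0 < `|mu| ^+ k by rewrite exprn_gt0// (lt_trans ltr01).
have : 0 <= D / (`|mu| - 1) by rewrite divr_ge0// ltW.
set y := D / _ => y0; have -> : D * ((`|mu| ^+ k - 1) / (`|mu| - 1)) = y * (`|mu| ^+ k - 1).
  by rewrite /y; ring.
nra.
Qed.

Lemma expand_lower : 1 < `|mu| -> exists2 C, 0 < C & forall p q k,
  `|mu| ^+ k * (`|dot2 m (p - q)| - C) <= `|dot2 m (iter k F p - iter k F q)|.
Proof.
move=> mu1; have D0 : 0 <= D by apply: le_trans (normr_ge0 _) (dot_step 0 0).
have m1 : 0 < `|mu| - 1 by rewrite subr_gt0.
exists (D / (`|mu| - 1) + 1) => [|p q k].
  by have := divr_ge0 D0 (ltW m1); lra.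
apply: le_trans (sum_geom_lower (normr_ge0 mu) _ (dot_step_lower p q) k); last by rewrite gt_eqF.
rewrite mulrBr /x /= lerD2l lerN2.
have h : 0 < `|mu| ^+ k by rewrite exprn_gt0// (lt_trans ltr01).
have : 0 <= D / (`|mu| - 1) by rewrite divr_ge0// ltW.
set y := D / _ => y0; have -> : D * ((`|mu| ^+ k - 1) / (`|mu| - 1)) = y * (`|mu| ^+ k - 1).
  by rewrite /y; ring.
nra.
Qed.

(** Here the errors are damped and add up to at most [D / (1 - |mu|)] at the final time. *)
Lemma contract : `|mu| < 1 -> exists2 C, 0 < C & forall p q k,
  `|dot2 m (iter k F p - iter k F q)| <= `|mu| ^+ k * `|dot2 m (p - q)| + C /\
  `|mu| ^+ k * `|dot2 m (p - q)| <= `|dot2 m (iter k F p - iter k F q)| + C.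
Proof.
move=> mu1; have D0 : 0 <= D by apply: le_trans (normr_ge0 _) (dot_step 0 0).
have m1 : 0 < 1 - `|mu| by rewrite subr_gt0.
exists (D / (1 - `|mu|) + 1) => [|p q k].
  by have := divr_ge0 D0 (ltW m1); lra.
have ne : `|mu| != 1 by rewrite lt_eqF.
have := sum_geom_bound (normr_ge0 mu) ne (dot_step_upper p q) k.
have := sum_geom_lower (normr_ge0 mu) ne (dot_step_lower p q) k.
have : 0 <= D / (1 - `|mu|) by rewrite divr_ge0// ltW.
have h : 0 <= `|mu| ^+ k by rewrite exprn_ge0.
have -> : D * ((`|mu| ^+ k - 1) / (`|mu| - 1)) = (D / (1 - `|mu|)) * (1 - `|mu| ^+ k).
  have n1 : `|mu| - 1 != 0 by rewrite subr_eq0.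
  have n2 : 1 - `|mu| != 0 by rewrite gt_eqF.
  by field; rewrite ?n1 ?n2.
rewrite /x /=; set y := D / _ => y0; split; nra.
Qed.

End Functional.

End Linear.

(** * Eigenvalues and left eigenvectors of the linear part *)

Section Eigen.
Variable R : realType.
Variable A : 'M[int]_2.
Implicit Types (p q m : plane R).

Let a : R := (A 0 0)%:~R.
Let b : R := (A 0 1)%:~R.
Let c : R := (A 1 0)%:~R.
Let d : R := (A 1 1)%:~R.
Definition tr2 : R := (A 0 0)%:~R + (A 1 1)%:~R.
Definition dt2 : R := (A 0 0)%:~R * (A 1 1)%:~R - (A 0 1)%:~R * (A 1 0)%:~R.

Lemma left_eigenE (mu : R) m : left_eigen A mu m <->
  m.1 * a + m.2 * c = mu * m.1 /\ m.1 * b + m.2 * d = mu * m.2.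
Proof.
split=> [H|[h1 h2] p].
  have := H (1, 0); have := H (0, 1); rewrite /dot2 /mat_act /= -/a -/b -/c -/d.
  by rewrite !mulr0 !mulr1 !addr0 !add0r => -> ->.
rewrite /dot2 /mat_act /= -/a -/b -/c -/d.
transitivity ((m.1 * a + m.2 * c) * p.1 + (m.1 * b + m.2 * d) * p.2); first ring.
by rewrite h1 h2; ring.
Qed.

Lemma left_eigen_char (mu : R) m : m != 0 -> left_eigen A mu m ->
  mu ^+ 2 - tr2 * mu + dt2 = 0.
Proof.
move=> m0 /left_eigenE[h1 h2].
have e1 : (mu ^+ 2 - tr2 * mu + dt2) * m.1 = 0.
  rewrite /tr2 /dt2 -/a -/b -/c -/d.
  transitivity ((mu - d) * (mu * m.1 - m.1 * a - m.2 * c) + c * (mu * m.2 - m.1 * b - m.2 * d)); first ring.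
  by rewrite -h1 -h2; ring.
have e2 : (mu ^+ 2 - tr2 * mu + dt2) * m.2 = 0.
  rewrite /tr2 /dt2 -/a -/b -/c -/d.
  transitivity (b * (mu * m.1 - m.1 * a - m.2 * c) + (mu - a) * (mu * m.2 - m.1 * b - m.2 * d)); first ring.
  by rewrite -h1 -h2; ring.
apply/eqP; move/eqP: e1; move/eqP: e2; rewrite !mulf_eq0 => /orP[//|/eqP m2] /orP[//|/eqP m1].
by move: m0; rewrite (_ : m = 0) ?eqxx//; exact: plane_eq.
Qed.

(** The candidates [(c, mu - a)] and [(mu - d, b)] are the rows of the adjugate of [mu - A]; when
    both tests fail, [(0, 1)] works. *)
Lemma left_eigen_exists (mu : R) : mu ^+ 2 - tr2 * mu + dt2 = 0 ->
  exists2 m, m != 0 & left_eigen A mu m.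
Proof.
rewrite /tr2 /dt2 -/a -/b -/c -/d => h.
have [c0|c0] := eqVneq c 0; last first.
  exists (c, mu - a); first by apply: contra_neq c0 => -[].
  by apply/left_eigenE => /=; split; [ring|lra].
have [mda|mda] := eqVneq mu d; last first.
  exists (mu - d, b); first by apply: contra_neq mda => -[/eqP]; rewrite subr_eq0 => /eqP.
  by apply/left_eigenE => /=; split; lra.
exists (0, 1); first by apply/eqP => -[/eqP]; rewrite oner_eq0.
by apply/left_eigenE => /=; rewrite c0 mda; split; ring.
Qed.

Lemma sum_ord2 (G : 'I_2 -> R) : \sum_j G j = G 0 + G 1.
Proof. by rewrite !big_ord_recl big_ord0 addr0; congr (_ + G _); exact: val_inj. Qed.

Lemma eigenvalue_left (mu : R) : eigenvalue (map_mx intr A) mu <->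
  exists2 m, m != 0 & left_eigen A mu m.
Proof.
split=> [/eigenvalueP[v vE v0]|[m m0 /left_eigenE[h1 h2]]].
  exists (v 0 0, v 0 1).
    apply: contra_neq v0 => -[h1 h2]; apply/rowP => i; rewrite mxE.
    by case: i => -[|[|//]] hi; [rewrite -[RHS]h1|rewrite -[RHS]h2]; congr (v _ _); apply: val_inj.
  apply/left_eigenE; split.
    by have := congr1 (fun w : 'rV[R]_2 => w 0 0) vE; rewrite !mxE sum_ord2 !mxE.
  by have := congr1 (fun w : 'rV[R]_2 => w 0 1) vE; rewrite !mxE sum_ord2 !mxE.
apply/eigenvalueP; exists (\row_j (if j == 0 then m.1 else m.2)).
  apply/rowP => i; rewrite !mxE sum_ord2 !mxE /=.
  case: i => -[|[|//]] hi /=; [move: h1|move: h2]; rewrite /a /b /c /d.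
    by rewrite (_ : Ordinal hi = 0)//; exact: val_inj.
  by rewrite (_ : Ordinal hi = 1)//; exact: val_inj.
apply: contra_neq m0 => e; apply: plane_eq.
  by have := congr1 (fun w : 'rV[R]_2 => w 0 0) e; rewrite !mxE.
by have := congr1 (fun w : 'rV[R]_2 => w 0 1) e; rewrite !mxE.
Qed.

End Eigen.

(** * Asymptotics of the growth rates *)

Section Asymptotics.
Variable R : realType.
Implicit Types (p q m : plane R).
Variables (F : plane R -> plane R) (A : 'M[int]_2) (C0 : R).
Hypothesis near : forall p, enorm (F p - mat_act A p) <= C0.
Variable e : plane R -> plane R.
Hypothesis ue : unif_line_field e.

(* [J k] stands for the norm of the derivative of [iter k F] along a stable
   leaf at a given point: [c] follows the leaf at unit speed, and [g] is its
   image under [iter k F], slowed down to bounded speed. *)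
Definition rescaled_leaf (J : nat -> R) (C : R) := forall k (L : R), 0 < L ->
  exists c c' g g', [/\ C1curve c c', C1curve g g', 0 < J k,
    forall t, 0 <= t <= L / J k -> enorm (c' t) = 1 /\ `|det2 (e (c t)) (c' t)| = 1 &
    forall t, 0 <= t <= L -> [/\ g t = iter k F (c (t / J k)), enorm (g' t) <= C,
      C^-1 <= `|det2 (e (g t)) (g' t)| &
      forall j s, 0 <= s <= t -> enorm (iter j F (g t) - iter j F (g s)) <= C * L]].

Lemma le_backward (x : nat -> R) D k : (forall j, (j < k)%N -> x j <= x j.+1 + D) ->
  x 0%N <= x k + k%:R * D.
Proof.
elim: k => [|k IH] H; first by rewrite mul0r addr0.
have := IH (fun j jk => H j (ltnW jk)); have := H k (leqnn _).
by rewrite -[in X in _ -> _ -> X]natr1 mulrDl mul1r; lra.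
Qed.

(** With [l = s ^+ 8], a linear lower bound for the powers of [s] gives degree 8 for those of [l];
    four degrees are left to absorb [M]. *)
Lemma expr_beats_poly (l M : R) : 1 < l -> exists k, M * (k%:R + 1) ^+ 4 < l ^+ k.
Proof.
move=> l1; pose s := Num.sqrt (Num.sqrt (Num.sqrt l)).
have s1 (x : R) : 1 < x -> 1 < Num.sqrt x.
  by move=> x1; rewrite -[ltLHS]sqrtr1 ltr_sqrt// (lt_trans ltr01).
have s_1 : 1 < s := s1 _ (s1 _ (s1 _ l1)).
have pos (x : R) : 1 < x -> 0 <= x by move=> x1; exact: ltW (lt_trans ltr01 x1).
have s8 : s ^+ 8 = l.
  rewrite (_ : 8 = 2 * 2 * 2)%N// !exprM !sqr_sqrtr ?pos//; [exact: s1|exact: s1 _ (s1 _ l1)].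
pose c := Num.min 1 (s - 1).
have c0 : 0 < c by rewrite lt_min ltr01 subr_gt0.
have [c_1 c_s] : c <= 1 /\ c <= s - 1 by rewrite !ge_min !lexx orbT.
have bern n : c * (n%:R + 1) <= s ^+ n.
  elim: n => [|n IH]; first by rewrite expr0 add0r mulr1.
  have e1 : 1 <= s ^+ n by rewrite exprn_ege1// ltW.
  rewrite exprS -natr1; have : 1 * s ^+ n + c * 1 <= s * s ^+ n.
    rewrite -lerBrDl -mulrBl; apply: ler_pM => //; exact: ltW.
  lra.
pose k := Num.truncn (`|M| / c ^+ 8); exists k.
have kM : `|M| < c ^+ 8 * (k%:R + 1).
  rewrite mulrC -ltr_pdivrMr ?exprn_gt0//.
  by have := truncnS_gt (`|M| / c ^+ 8); rewrite -natr1.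
have k1 : 1 <= k%:R + 1 :> R by rewrite lerDr.
have k4 : 0 < (k%:R + 1) ^+ 4 :> R by rewrite exprn_gt0// (lt_le_trans ltr01).
have -> : l ^+ k = (s ^+ k) ^+ 8 by rewrite -s8 -!exprM mulnC.
apply: lt_le_trans (_ : (c * (k%:R + 1)) ^+ 8 <= _); last first.
  by rewrite lerXn2r ?nnegrE// ?(le_trans _ (bern k))// mulr_ge0 ?(ltW c0)// (le_trans ler01).
rewrite exprMn (_ : 8 = 4 + 4)%N// [(k%:R + 1) ^+ (4 + 4)]exprD mulrA ltr_pM2r//.
apply: le_lt_trans (ler_norm M) _; apply: (lt_le_trans kM).
rewrite ler_pM2l ?exprn_gt0//; exact: ler_eXnr.
Qed.

(** A stable curve whose image by [iter k F] is bounded has length [1 / J k], at least [l ^+ k / c],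
    while both its extents are of order [(k + 1) ^+ 2]. Packing then bounds an exponential by a
    polynomial of degree 4. *)
Lemma no_poly_backward (J : nat -> R) C c l m1 m2 P : 1 <= C -> 0 < c -> 1 < l ->
  rescaled_leaf J C -> (forall k, J k <= c * l ^- k) -> det2 m1 m2 != 0 -> 0 <= P ->
  (forall p q k M, 0 <= M -> enorm (iter k F p - iter k F q) <= M ->
     `|dot2 m1 (p - q)| <= P * (M + 1) * (k%:R + 1) ^+ 2 /\
     `|dot2 m2 (p - q)| <= P * (M + 1) * (k%:R + 1) ^+ 2) -> False.
Proof.
move=> C1 c0 l1 res Jd dm P0 H.
have [B B0 HB] := packing ue ltr01 ltr01 dm.
(* The summand 1 makes [U >= 1], so that [1 + U <= 2 * U]. *)
pose N := P * (C + 1) + 1.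
have N1 : 1 <= N by rewrite lerDr mulr_ge0//; lra.
have [k] := expr_beats_poly (c * B * N ^+ 2 * 4) l1; apply/negP; rewrite -leNgt.
have [d [d' [g [g' [Cd Cg J0 dP gP]]]]] := res k 1 ltr01.
have hk : 1 <= k%:R + 1 :> R by rewrite lerDr.
have k2 : 1 <= (k%:R + 1) ^+ 2 :> R by rewrite exprn_ege1.
pose U := N * (k%:R + 1) ^+ 2.
have := HB d d' (1 / J k) U U Cd; rewrite divr_ge0 ?(ltW J0)// => h.
have {}h : 1 / J k <= B * (1 + U) * (1 + U).
  apply: h => // [t /dP[-> ->]//|s t s0 st tJ].
  have tin : 0 <= t * J k <= 1.
    by apply/andP; split; [rewrite mulr_ge0 ?(ltW J0)// (le_trans s0)|rewrite -ler_pdivlMr].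
  have sin : 0 <= s * J k <= 1.
    by apply/andP; split; [rewrite mulr_ge0 ?(ltW J0)|rewrite -ler_pdivlMr// (le_trans st)].
  have [gt _ _ /(_ 0%N (s * J k))] := gP _ tin; have [gs _ _ _] := gP _ sin.
  rewrite /= gt gs !mulfK ?gt_eqF// mulr1 => disp.
  have {}disp : enorm (iter k F (d t) - iter k F (d s)) <= C.
    by apply: disp; rewrite mulr_ge0 ?(ltW J0)//= ler_pM2r.
  have [|h1 h2] := H _ _ _ _ _ disp; first by lra.
  by split; [apply: (le_trans h1)|apply: (le_trans h2)]; rewrite ler_wpM2r ?(le_trans ler01)// lerDl.
have U1 : 1 <= U by rewrite -[leLHS]mulr1; apply: ler_pM.
have lk : 0 < l ^+ k by rewrite exprn_gt0// (lt_trans ltr01).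
have h2 : l ^+ k <= c * (1 / J k).
  by rewrite mulrA mulr1 ler_pdivlMr// -ler_pdivlMl// mulrC; exact: Jd.
apply: (le_trans h2); have -> : c * B * N ^+ 2 * 4 * (k%:R + 1) ^+ 4 = c * (B * (2 * U) * (2 * U)).
  by rewrite /U; ring.
rewrite ler_pM2l//; apply: (le_trans h).
by apply: ler_pM; [nra|lra|rewrite ler_wpM2l ?(ltW B0)//; lra|lra].
Qed.

Let C00 : 0 <= C0. Proof. exact: le_trans (enorm_ge0 _) (near 0). Qed.

(** In the flag spanned by [u] and [m] the transpose of [A] is triangular with diagonal entries of
    modulus at least 1. Going backwards, the extent along [u] gains a constant per step, and the one
    along [m] an amount linear in [k] per step. *)
Lemma triangular_backward l1 l2 : 1 <= `|l1| -> 1 <= `|l2| ->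
  l1 + l2 = tr2 R A -> l1 * l2 = dt2 R A -> forall m, exists2 P, 0 <= P &
  forall p q k M, 0 <= M -> enorm (iter k F p - iter k F q) <= M ->
     `|dot2 m (p - q)| <= P * (M + 1) * (k%:R + 1) ^+ 2.
Proof.
rewrite /tr2 /dt2.
set a := (A 0 0)%:~R; set b := (A 0 1)%:~R; set c := (A 1 0)%:~R; set d := (A 1 1)%:~R.
move=> h1 h2 ht hd m.
(* [u] is the transpose of [A - l2] applied to [m]: by Cayley-Hamilton it satisfies the eigenvector
   equation for [l1]. *)
pose u : plane R := (m.1 * a + m.2 * c - l2 * m.1, m.1 * b + m.2 * d - l2 * m.2).
have uE : left_eigen A l1 u.
  have l2E : l2 = a + d - l1 by rewrite -ht; ring.
  have {}hd : l1 * (a + d - l1) - (a * d - b * c) = 0 by rewrite -hd l2E subrr.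
  apply/left_eigenE; rewrite -/a -/b -/c -/d /u /= l2E.
  split; apply/eqP; rewrite -subr_eq0; apply/eqP.
    by transitivity ((l1 * (a + d - l1) - (a * d - b * c)) * m.1); [ring|rewrite hd mul0r].
  by transitivity ((l1 * (a + d - l1) - (a * d - b * c)) * m.2); [ring|rewrite hd mul0r].
have mE p : dot2 m (mat_act A p) = l2 * dot2 m p + dot2 u p.
  by rewrite /dot2 /mat_act /u /= -/a -/b -/c -/d; ring.
pose Du := enorm u * (2 * C0); pose D := enorm m * (2 * C0).
have Du0 : 0 <= Du by rewrite mulr_ge0 ?enorm_ge0// mulr_ge0.
have D0 : 0 <= D by rewrite mulr_ge0 ?enorm_ge0// mulr_ge0.
exists (enorm m + enorm u + Du + D); first by rewrite !addr_ge0 ?enorm_ge0.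
move=> p q k M M0 HM.
pose x j := `|dot2 m (iter j F p - iter j F q)|.
pose y j := `|dot2 u (iter j F p - iter j F q)|.
have yk : y k <= enorm u * M by apply: (le_trans (le_dot2 _ _)); rewrite ler_wpM2l ?enorm_ge0.
have xk : x k <= enorm m * M by apply: (le_trans (le_dot2 _ _)); rewrite ler_wpM2l ?enorm_ge0.
have ystep j : y j <= y j.+1 + Du.
  have := dot_step_lower near uE p q j; rewrite -/(y j) -/(y j.+1) -/Du.
  have y0 : 0 <= y j by rewrite /y normr_ge0.
  by have := ler_peMl y0 h1; lra.
have yj j : (j <= k)%N -> y j <= enorm u * M + k%:R * Du.
  move=> jk; have st i : (i < k - j)%N -> y (j + i)%N <= y (j + i.+1)%N + Du.
    by move=> _; rewrite addnS; exact: ystep.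
  have := @le_backward (fun i => y (j + i)%N) Du (k - j) st.
  rewrite addn0 subnKC// => /le_trans; apply.
  by apply: lerD => //; rewrite ler_wpM2r// ler_nat leq_subr.
have xstep j : (j < k)%N -> x j <= x j.+1 + (enorm u * M + k%:R * Du + D).
  move=> /ltnW/yj; pose pj := iter j F p; pose qj := iter j F q.
  have : `|dot2 m (F pj - F qj) - dot2 m (mat_act A (pj - qj))| <= D.
    rewrite -dot2B; apply: (le_trans (le_dot2 _ _)).
    by rewrite ler_wpM2l ?enorm_ge0// (near_diff near).
  rewrite mE /x /y /= -/pj -/qj.
  move: (dot2 m (F pj - F qj)) (dot2 m (pj - qj)) (dot2 u (pj - qj)) => X x0 y0 hX hy.
  have := ler_normD (l2 * x0 + y0 - X) (X - y0); rewrite distrC in hX.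
  have -> : l2 * x0 + y0 - X + (X - y0) = l2 * x0 by ring.
  have := ler_normB X y0; rewrite normrM.
  have : `|x0| <= `|l2| * `|x0| by rewrite ler_peMl.
  lra.
have := le_backward xstep; rewrite /x /= -/(x k) => fin.
apply: (le_trans fin); apply: (le_trans (lerD xk (lexx _))).
have k0 : 0 <= k%:R :> R by [].
have eu := enorm_ge0 u; have em := enorm_ge0 m.
pose W := (M + 1) * (k%:R + 1) ^+ 2.
have [W1 W2 W3 W4] : [/\ M <= W, k%:R * M <= W, k%:R ^+ 2 <= W & k%:R <= W].
  rewrite /W sqrrD expr1n mulr1; have := mulr_ge0 k0 k0; have := mulr_ge0 k0 M0.
  by have := mulr_ge0 (mulr_ge0 k0 k0) M0; rewrite -!expr2; split; nra.
have := ler_wpM2l em W1; have := ler_wpM2l eu W2; have := ler_wpM2l Du0 W3.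
have := ler_wpM2l D0 W4; rewrite -mulrA -/W.
by move: W {W1 W2 W3 W4} => W; lra.
Qed.

(** The two functionals are the real and imaginary parts of a complex left eigenvector
    [(c, lambda - a)]. [A] multiplies the square of its modulus by the determinant, which is at
    least 1. *)
Lemma elliptic_backward : tr2 R A ^+ 2 < 4 * dt2 R A -> 1 <= dt2 R A ->
  exists m1 m2 P, [/\ det2 m1 m2 != 0, 0 <= P &
  forall p q k M, 0 <= M -> enorm (iter k F p - iter k F q) <= M ->
     `|dot2 m1 (p - q)| <= P * (M + 1) * (k%:R + 1) ^+ 2 /\
     `|dot2 m2 (p - q)| <= P * (M + 1) * (k%:R + 1) ^+ 2].
Proof.
rewrite /tr2 /dt2.
set a := (A 0 0)%:~R; set b := (A 0 1)%:~R; set c := (A 1 0)%:~R; set d := (A 1 1)%:~R.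
move=> disc d1.
pose al := (a + d) / 2; pose be := Num.sqrt (a * d - b * c - al ^+ 2).
have pos : 0 < a * d - b * c - al ^+ 2.
  by rewrite /al expr_div_n; lra.
have be2 : be ^+ 2 = a * d - b * c - al ^+ 2 by rewrite sqr_sqrtr// ltW.
have be0 : 0 < be by rewrite sqrtr_gt0.
have c0 : c != 0.
  apply/eqP => c0; move: disc; rewrite c0 mulr0 subr0.
  by have := sqr_ge0 (a - d); rewrite sqrrB sqrrD; lra.
pose mr : plane R := (c, al - a); pose mi : plane R := (0, be).
pose z p : plane R := (dot2 mr p, dot2 mi p).
have zA p : enorm (z p) <= enorm (z (mat_act A p)).
  rewrite -(@ler_pXn2r _ 2)// ?nnegrE ?enorm_ge0//.
  have -> : enorm (z (mat_act A p)) ^+ 2 = (a * d - b * c) * enorm (z p) ^+ 2.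
    rewrite !sq_enorm /z /dot2 /mr /mi /mat_act /= -/a -/b -/c -/d !mul0r !add0r.
    have -> : d = 2 * al - a by rewrite /al; field.
    rewrite !exprMn !be2; have -> : d = 2 * al - a by rewrite /al; field.
    ring.
  by rewrite ler_peMl// sqr_ge0.
have zB p q : z (p - q) = z p - z q by apply: plane_eq; rewrite /z !planeE /= dot2B.
have zle p : enorm (z p) <= (enorm mr + enorm mi) * enorm p.
  apply: (le_trans (enorm_le_l1 _)); rewrite mulrDl; apply: lerD; exact: le_dot2.
pose Z := enorm mr + enorm mi.
have Z0 : 0 <= Z by rewrite addr_ge0 ?enorm_ge0.
pose D := Z * (2 * C0); have D0 : 0 <= D by rewrite mulr_ge0// mulr_ge0.
exists mr, mi, (Z + D); split; [|by rewrite addr_ge0|].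
  by rewrite /det2 /= mulr0 subr0 mulf_neq0// gt_eqF.
move=> p q k M M0 HM.
have main : enorm (z (p - q)) <= (Z + D) * (M + 1) * (k%:R + 1) ^+ 2.
  pose x j := enorm (z (iter j F p - iter j F q)).
  have step j : (j < k)%N -> x j <= x j.+1 + D.
    move=> _; rewrite /x /=; set pj := iter j F p; set qj := iter j F q.
    apply: (le_trans (zA _)).
    have -> : z (mat_act A (pj - qj)) = z (F pj - F qj) - z (F pj - F qj - mat_act A (pj - qj)).
      by rewrite [z (_ - mat_act _ _)]zB subKr.
    apply: (le_trans (enormD _ _)); rewrite enormN lerD2l.
    by apply: (le_trans (zle _)); rewrite ler_wpM2l// (near_diff near).
  have := le_backward step; rewrite /x /= => h; apply: (le_trans h).
  have h2 : enorm (z (iter k F p - iter k F q)) <= Z * M.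
    by apply: (le_trans (zle _)); rewrite ler_wpM2l.
  apply: (le_trans (lerD h2 (lexx _))).
  have k0 : 0 <= k%:R :> R by [].
  move: (k%:R) k0 => K k0.
  have ZM := mulr_ge0 Z0 M0; have DM := mulr_ge0 D0 M0.
  have := mulr_ge0 k0 ZM; have := mulr_ge0 k0 DM; have := mulr_ge0 k0 Z0; have := mulr_ge0 k0 D0.
  have kk := mulr_ge0 k0 k0.
  have := mulr_ge0 kk ZM; have := mulr_ge0 kk DM; have := mulr_ge0 kk Z0; have := mulr_ge0 kk D0.
  rewrite sqrrD expr1n mulr1 !expr2; lra.
by split; apply: le_trans main; [exact: (le_fst_enorm (z _))|exact: (le_snd_enorm (z _))].
Qed.

(** The determinant is an integer. If it vanished, a left null vector [m] would make [dot2 m (F p)]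
    bounded, against surjectivity. *)
Lemma dt2_ge1 : (forall p, exists q, F q = p) -> 1 <= `|dt2 R A|.
Proof.
move=> onto; have dint : dt2 R A = (A 0 0 * A 1 1 - A 0 1 * A 1 0)%:~R.
  by rewrite /dt2 rmorphB !rmorphM.
rewrite dint; apply: norm_intr_ge1; first exact: intr_int.
rewrite -dint; apply/eqP => d0.
have [m m0 mE] := @left_eigen_exists R A 0 ltac:(by rewrite d0; ring).
have [p pE] := onto ((enorm m * C0 / enorm m ^+ 2 + 1) *: m).
have em : 0 < enorm m by rewrite enorm_gt0.
have := le_dot2 m (F p - mat_act A p); rewrite dot2B mE mul0r subr0 pE.
have dz z : dot2 m (z *: m) = z * enorm m ^+ 2.
  by rewrite sq_enorm /dot2 !planeE; ring.
rewrite dz mulrDl divfK ?gt_eqF ?exprn_gt0// mul1r.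
have e2 : 0 < enorm m ^+ 2 by rewrite exprn_gt0.
have := ler_wpM2l (ltW em) (near p); rewrite pE.
have := ler_norm (enorm m * C0 + enorm m ^+ 2).
lra.
Qed.

Lemma saddle (J : nat -> R) C c l : (forall p, exists q, F q = p) ->
  1 <= C -> 0 < c -> 1 < l -> rescaled_leaf J C -> (forall k, J k <= c * l ^- k) ->
  exists mu ms, [/\ 1 < `|mu|, 0 < `|ms|, `|ms| < 1, mu + ms = tr2 R A & mu * ms = dt2 R A].
Proof.
move=> onto C1 c0 l1 res Jd; have d1 := dt2_ge1 onto.
have [disc|disc] := ltP (tr2 R A ^+ 2) (4 * dt2 R A).
  have d0 : 0 < dt2 R A by have := sqr_ge0 (tr2 R A); lra.
  rewrite gtr0_norm// in d1.
  have [m1 [m2 [P [dm P0 H]]]] := elliptic_backward disc d1.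
  by case: (no_poly_backward C1 c0 l1 res Jd dm P0 H).
pose r := Num.sqrt (tr2 R A ^+ 2 - 4 * dt2 R A).
have r2 : r ^+ 2 = tr2 R A ^+ 2 - 4 * dt2 R A by rewrite sqr_sqrtr// subr_ge0.
pose l1' := (tr2 R A + r) / 2; pose l2' := (tr2 R A - r) / 2.
have sE : l1' + l2' = tr2 R A by rewrite /l1' /l2'; field.
have pE : l1' * l2' = dt2 R A.
  have -> : l1' * l2' = (tr2 R A ^+ 2 - r ^+ 2) / 4 by rewrite /l1' /l2'; field.
  by rewrite r2; field.
have prod : 1 <= `|l1'| * `|l2'| by rewrite -normrM pE.
have n1 := normr_ge0 l1'; have n2 := normr_ge0 l2'.
have [s1|b1] := ltP `|l1'| 1.
  by exists l2', l1'; split=> //; [nra|nra|rewrite addrC|rewrite mulrC].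
have [s2|b2] := ltP `|l2'| 1.
  by exists l1', l2'; split=> //; nra.
have [P1 P10 H1] := triangular_backward b1 b2 sE pE (1, 0).
have [P2 P20 H2] := triangular_backward b1 b2 sE pE (0, 1).
case: (@no_poly_backward J C c l (1, 0) (0, 1) (P1 + P2) C1 c0 l1 res Jd).
- by rewrite /det2 /= mulr1 mulr0 subr0 oner_eq0.
- exact: addr_ge0.
move=> p q k M M0 HM.
have M1 : 0 <= M + 1 by lra.
have k2 : 0 <= (k%:R + 1) ^+ 2 :> R by rewrite sqr_ge0.
split; [apply: (le_trans (H1 p q k M M0 HM))|apply: (le_trans (H2 p q k M M0 HM))];
  by rewrite ler_wpM2r// ler_wpM2r// ?lerDl ?lerDr.
Qed.

Section Saddle.
Variables (mu ms : R) (mu_ ms_ : plane R).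
Hypothesis mu1 : 1 < `|mu|.
Hypothesis ms1 : `|ms| < 1.
Hypothesis ms0 : 0 < `|ms|.
Hypothesis muE : left_eigen A mu mu_.
Hypothesis msE : left_eigen A ms ms_.
Hypothesis dm : det2 mu_ ms_ != 0.

(** An extent above the threshold of [expand_lower] grows without bound, so the threshold bounds it;
    the bound does not depend on [M]. *)
Lemma bounded_extent : exists2 Cu, 0 < Cu & forall p q M k,
  (forall j, enorm (iter j F (iter k F p) - iter j F (iter k F q)) <= M) ->
  `|dot2 mu_ (iter k F p - iter k F q)| <= Cu /\ `|dot2 mu_ (p - q)| <= Cu.
Proof.
have [Cu Cu0 H] := expand_lower near muE mu1.
have key p q M : (forall j, enorm (iter j F p - iter j F q) <= M) -> `|dot2 mu_ (p - q)| <= Cu.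
  move=> HM; rewrite leNgt; apply/negP => big.
  have M0 : 0 <= M by exact: le_trans (enorm_ge0 _) (HM 0%N).
  have b0 : 0 < `|dot2 mu_ (p - q)| - Cu by rewrite subr_gt0.
  have [j Hj] := expr_unbounded (enorm mu_ * M / (`|dot2 mu_ (p - q)| - Cu)) mu1.
  move: Hj; rewrite ltr_pdivrMr//; apply/negP; rewrite -leNgt.
  apply: (le_trans (H p q j)); apply: (le_trans (le_dot2 _ _)).
  by rewrite ler_wpM2l ?enorm_ge0.
exists (Cu + Cu) => [|p q M k HM]; first lra.
have h1 := key _ _ _ HM; split; first lra.
have := H p q k; have := exprn_ege1 k (ltW mu1).
move: (`|mu| ^+ k) (`|dot2 mu_ (p - q)|) h1 => E X h1 E1 h2; nra.
Qed.

(** The lower bound packs the curve [c], of length [L / J k], whose contracting extent is at most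
    [E / |ms| ^+ k]. For the upper bound, the image [g] is too long to have a small contracting
    extent, and an extent above the error of [contract] needs [c] to be correspondingly long. *)
Lemma stable_asymptotics (J : nat -> R) C : 1 <= C -> rescaled_leaf J C ->
  exists a b, [/\ 0 < a, 0 < b & forall k, a * `|ms| ^+ k <= J k <= b * `|ms| ^+ k].
Proof.
move=> C1 res; have C00' : 0 < C by exact: lt_le_trans ltr01 C1.
have [Cu Cu0 Hu] := bounded_extent; have [Cs Cs0 Hs] := contract near msE ms1.
have iC0 : 0 < C^-1 by rewrite invr_gt0.
have [B1 B10 HB1] := packing ue C00' iC0 dm.
have [B2 B20 HB2] := packing ue ltr01 ltr01 dm.
(* One more than packing allows for a curve with contracting extent at most [Cs + 1]; that extent
   exceeds the error [Cs] by 1. *)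
pose L := B1 * (1 + Cu) * (1 + (Cs + 1)) + 1.
have L0 : 0 < L.
  have : 0 <= B1 * (1 + Cu) * (1 + (Cs + 1)) by rewrite !mulr_ge0 ?(ltW B10)//; lra.
  by rewrite /L; lra.
have ems : 0 < enorm ms_.
  by rewrite enorm_gt0; apply: contra_neq dm => ->; rewrite det20.
pose E := enorm ms_ * (C * L) + Cs.
have E0 : 0 < E by rewrite addr_gt0// !mulr_gt0.
pose D := B2 * (1 + Cu) * (1 + E).
have D0 : 0 < D by rewrite !mulr_gt0//; lra.
exists (L / D), (2 * L * enorm ms_); split.
- by rewrite divr_gt0.
- by rewrite !mulr_gt0.
move=> k; have [c [c' [g [g' [Cc Cg J0 cP gP]]]]] := res k L L0.
have mk0 : 0 < `|ms| ^+ k by rewrite exprn_gt0.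
have inJ t : 0 <= t <= L -> 0 <= t / J k <= L / J k.
  by move=> /andP[t0 tL]; rewrite divr_ge0 ?(ltW J0)//= ler_pM2r ?invr_gt0.
have inL t : 0 <= t <= L / J k -> 0 <= t * J k <= L.
  by move=> /andP[t0 tL]; rewrite mulr_ge0 ?(ltW J0)//= -ler_pdivlMr.
have ext s t : 0 <= s -> s <= t -> t <= L / J k ->
    [/\ `|dot2 mu_ (g (t * J k) - g (s * J k))| <= Cu, `|dot2 mu_ (c t - c s)| <= Cu &
      `|ms| ^+ k * `|dot2 ms_ (c t - c s)| <= E].
  move=> s0 st tL; have ht := inL t ltac:(lra); have hs := inL s ltac:(lra).
  have [gt _ _ disp] := gP _ ht; have [gs _ _ _] := gP _ hs.
  have st' : 0 <= s * J k <= t * J k.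
    by rewrite mulr_ge0 ?(ltW J0)//= ler_pM2r.
  have HM j := disp j _ st'.
  have h0 := HM 0%N; rewrite /= in h0.
  have et : t * J k / J k = t by rewrite mulfK// gt_eqF.
  have es : s * J k / J k = s by rewrite mulfK// gt_eqF.
  rewrite et in gt; rewrite es in gs.
  have HM2 j : enorm (iter j F (iter k F (c t)) - iter j F (iter k F (c s))) <= C * L.
    by have := HM j; rewrite gt gs.
  have [h1 h2] := Hu _ _ _ _ HM2.
  rewrite gt gs; split=> //.
  have [_ h3] := Hs (c t) (c s) k; apply: (le_trans h3); rewrite lerD2r.
  by apply: (le_trans (le_dot2 _ _)); rewrite ler_pM2l//; exact: (HM2 0%N).
apply/andP; split.
  have h := HB2 c c' (L / J k) Cu (E / `|ms| ^+ k) Cc (divr_ge0 (ltW L0) (ltW J0)).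
  have {}h : L / J k <= B2 * (1 + Cu) * (1 + E / `|ms| ^+ k).
    apply: h => [t /cP[-> ->]//|s t s0 st tL].
    have [_ h1 h2] := ext s t s0 st tL; split=> //.
    by rewrite ler_pdivlMr// mulrC.
  have h2 : L / J k <= D / `|ms| ^+ k.
    apply: (le_trans h); rewrite /D -[leRHS]mulrA ler_pM2l ?mulr_gt0//; last by lra.
    rewrite [leRHS]mulrDl mul1r lerD2r invf_ge1// exprn_ile1//; exact: ltW.
  move: h2; rewrite ler_pdivrMr// mulrAC ler_pdivlMr// => h2.
  by rewrite mulrAC ler_pdivrMr// [J k * _]mulrC.
have [s [t [s0 st tL big]]] : exists s t, [/\ 0 <= s, s <= t, t <= L & Cs + 1 < `|dot2 ms_ (g t - g s)|].
  apply: contrapT => neg.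
  have := HB1 g g' L Cu (Cs + 1) Cg (ltW L0) => h.
  have {}h : L <= B1 * (1 + Cu) * (1 + (Cs + 1)).
    apply: h => [t /gP[_ h1 h2 _]//|s t s0 st tL]; split.
      have [|||h _ _] := ext (s / J k) (t / J k).
      - by rewrite divr_ge0// ltW.
      - by rewrite ler_pM2r// invr_gt0.
      - by rewrite ler_pM2r// invr_gt0.
      by move: h; rewrite !divfK// gt_eqF.
    rewrite leNgt; apply/negP => big; apply: neg; by exists s, t.
  by rewrite /L in h; lra.
have ht : 0 <= t <= L by rewrite (le_trans s0).
have hs : 0 <= s <= L by rewrite s0 (le_trans st).
have [gt _ _ _] := gP _ ht; have [gs _ _ _] := gP _ hs.
have [up _] := Hs (c (t / J k)) (c (s / J k)) k; rewrite -gt -gs in up.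
have sJ : s / J k <= t / J k by rewrite ler_pM2r ?invr_gt0.
have disp := curve_displacement (M := 1) Cc sJ.
have {}disp : enorm (c (t / J k) - c (s / J k)) <= 2 * (L / J k).
  apply: le_trans (disp _) _ => [u hu|].
    have [t0 t1] := andP (inJ t ht); have [s2 s3] := andP (inJ s hs).
    have [|-> _//] := cP u; have [u0 u1] := andP hu.
    by rewrite (le_trans s2 u0) (le_trans u1 t1).
  rewrite mulr1 ler_pM2l// -mulrBl ler_pM2r ?invr_gt0//; lra.
have up2 : `|dot2 ms_ (c (t / J k) - c (s / J k))| <= enorm ms_ * (2 * (L / J k)).
  by apply: (le_trans (le_dot2 _ _)); rewrite ler_pM2l.
have h1 : 1 <= `|ms| ^+ k * (enorm ms_ * (2 * (L / J k))).
  have := ler_wpM2l (ltW mk0) up2; lra.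
have e1 : `|ms| ^+ k * (enorm ms_ * (2 * (L / J k))) = 2 * L * enorm ms_ * `|ms| ^+ k / J k by ring.
by move: h1; rewrite e1 ler_pdivlMr// mul1r.
Qed.

Definition growing_curve (J : nat -> R) (al C : R) := exists g, forall k, 0 < J k /\
  exists g', C1curve (fun t => iter k F (g t)) g' /\
  forall t, 0 <= t <= 1 -> [/\ C^-1 * J k <= enorm (g' t), enorm (g' t) <= C * J k &
    al * enorm (g' t) <= `|det2 (e (iter k F (g t))) (g' t)|].

(** The contracting extent of all the images stays below [V], so [J k] is at most a constant times
    the expanding extent. In the other direction the displacement is at most a constant times
    [J k]. *)
Lemma unstable_asymptotics (J : nat -> R) al C : 0 < al -> 1 <= C -> growing_curve J al C ->
  (forall M, exists k, M < J k) ->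
  exists a b k0, [/\ 0 < a, 0 < b & forall k, (k0 <= k)%N -> a * `|mu| ^+ k <= J k <= b * `|mu| ^+ k].
Proof.
move=> al0 C1 [g H] unb; have C00' : 0 < C by exact: lt_le_trans ltr01 C1.
have [Cl Cl0 Hl] := expand_lower near muE mu1.
have [Cu Cu0 Hu] := expand_upper near muE mu1.
have [Cs Cs0 Hs] := contract near msE ms1.
have al'0 : 0 < al / C by rewrite divr_gt0.
have [B B0 HB] := packing ue C00' al'0 dm.
have em : 0 < enorm mu_.
  rewrite enorm_gt0; apply: contra_neq dm => ->; by rewrite /det2 /= !mul0r subrr.
have disp k s t : 0 <= s -> s <= t -> t <= 1 ->
    enorm (iter k F (g t) - iter k F (g s)) <= 2 * (C * J k).
  move=> s0 st t1; have [J0 [g' [Cg gP]]] := H k.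
  have := curve_displacement (M := C * J k) Cg st => h.
  apply: le_trans (h _) _ => [u hu|].
    have [|//] := gP u; have [u0 u1] := andP hu.
    by rewrite (le_trans s0 u0) (le_trans u1 t1).
  rewrite ler_piMr ?mulr_ge0 ?(ltW C00') ?(ltW J0)//; lra.
pose E := 2 * (C * J 0).
have E0 : 0 <= E by have [J0 _] := H 0%N; rewrite !mulr_ge0// ltW.
pose V := enorm ms_ * E + Cs.
have V0 : 0 <= V by rewrite /V addr_ge0 ?(ltW Cs0)// mulr_ge0// enorm_ge0.
have Vext k s t : 0 <= s -> s <= t -> t <= 1 ->
    `|dot2 ms_ (iter k F (g t) - iter k F (g s))| <= V.
  move=> s0 st t1; have [h _] := Hs (g t) (g s) k; apply: (le_trans h); rewrite lerD2r.
  have d0 := disp 0%N s t s0 st t1; rewrite /= in d0.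
  apply: le_trans (_ : `|dot2 ms_ (g t - g s)| <= _).
    by rewrite ler_piMl// exprn_ile1// ltW.
  by apply: (le_trans (le_dot2 _ _)); rewrite ler_wpM2l ?enorm_ge0.
have pack k U : (forall s t, 0 <= s -> s <= t -> t <= 1 ->
      `|dot2 mu_ (iter k F (g t) - iter k F (g s))| <= U) ->
    J k <= B * (1 + U) * (1 + V).
  move=> HU; have [J0 [g' [Cg gP]]] := H k.
  have Cr := C1curve_affine 0 (J k)^-1 Cg.
  have in1 t : 0 <= t <= J k -> 0 <= 0 + t * (J k)^-1 <= 1.
    by move=> /andP[t0 tJ]; rewrite add0r divr_ge0 ?(ltW J0)//= ler_pdivrMr// mul1r.
  apply: (HB _ _ _ _ _ Cr (ltW J0)) => [t /in1/gP[lo hi an]|s t s0 st tJ].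
    have iJ : 0 < (J k)^-1 by rewrite invr_gt0.
    rewrite enormZ det2Zr normrM (gtr0_norm iJ); split.
      by rewrite ler_pdivrMl// [J k * C]mulrC.
    rewrite ler_pdivlMl//; apply: le_trans an.
    by rewrite mulrCA ler_pM2l// mulrC.
  have ht : 0 <= 0 + t * (J k)^-1 <= 1 by apply: in1; rewrite tJ andbT (le_trans s0).
  have hs : 0 <= 0 + s * (J k)^-1 <= 1 by apply: in1; rewrite s0 (le_trans st).
  have st' : 0 + s * (J k)^-1 <= 0 + t * (J k)^-1 by rewrite lerD2l ler_pM2r ?invr_gt0.
  have [[hs0 hs1] [ht0 ht1]] := (andP hs, andP ht).
  by split; [exact: HU|exact: Vext].
(* Since [J] is unbounded, some image is too long for an expanding extent of at most [Cl + 1];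
   beyond this threshold the extent grows like [|mu| ^+ (k - k0)]. *)
have [k0 big] := unb (B * (1 + (Cl + 1)) * (1 + V)).
have [s [t [s0 st t1 ext]]] : exists s t, [/\ 0 <= s, s <= t, t <= 1 &
    Cl + 1 < `|dot2 mu_ (iter k0 F (g t) - iter k0 F (g s))|].
  apply: contrapT => neg; move: big; apply/negP; rewrite -leNgt; apply: pack => s t s0 st t1.
  by rewrite leNgt; apply/negP => ext; apply: neg; exists s, t.
have mun k : 0 < `|mu| ^+ k by rewrite exprn_gt0// (lt_trans ltr01).
exists (`|mu| ^- k0 / (2 * C * enorm mu_)), (B * (1 + (enorm mu_ * E + Cu)) * (1 + V)), k0; split.
- by rewrite divr_gt0 ?invr_gt0// !mulr_gt0.
- have := mulr_ge0 (ltW em) E0 => h; rewrite !mulr_gt0//; lra.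
move=> k k0k; apply/andP; split.
  have := Hl (iter k0 F (g t)) (iter k0 F (g s)) (k - k0)%N.
  rewrite -!iterD subnK// => low.
  have d := disp k s t s0 st t1.
  have up : `|dot2 mu_ (iter k F (g t) - iter k F (g s))| <= enorm mu_ * (2 * (C * J k)).
    by apply: (le_trans (le_dot2 _ _)); rewrite ler_pM2l.
  have one : `|mu| ^+ (k - k0) <= enorm mu_ * (2 * (C * J k)).
    apply: (le_trans _ (le_trans low up)); rewrite ler_peMr ?(ltW (mun _))//.
    move: ext; lra.
  have -> : `|mu| ^- k0 / (2 * C * enorm mu_) * `|mu| ^+ k = `|mu| ^+ (k - k0) / (2 * C * enorm mu_).
    rewrite -{1}(subnK k0k) exprD; field.
    by rewrite !gt_eqF// normr_gt0 -normr_gt0 (lt_trans ltr01).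
  rewrite ler_pdivrMr ?mulr_gt0//; apply: (le_trans one).
  by rewrite le_eqVlt; apply/orP; left; apply/eqP; ring.
have -> : B * (1 + (enorm mu_ * E + Cu)) * (1 + V) * `|mu| ^+ k =
    B * ((1 + (enorm mu_ * E + Cu)) * `|mu| ^+ k) * (1 + V) by ring.
apply: (le_trans (pack k (`|mu| ^+ k * (enorm mu_ * E + Cu)) _)) => [s' t' s0' st' t1'|].
  apply: (le_trans (Hu _ _ _)); rewrite ler_pM2l// lerD2r.
  have d0 := disp 0%N s' t' s0' st' t1'; rewrite /= in d0.
  by apply: (le_trans (le_dot2 _ _)); rewrite ler_pM2l.
apply: ler_wpM2r; first by rewrite addr_ge0.
rewrite ler_pM2l// [leRHS]mulrDl mul1r [X in _ <= _ + X]mulrC lerD2r.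
by rewrite exprn_ege1// ltW.
Qed.

End Saddle.

End Asymptotics.

(** * Lyapunov exponents *)

Section Exponents.
Variable R : realType.
Implicit Types (p v : plane R).

Lemma exponent_cvg (a b nu : R) (u : nat -> R) k0 : 0 < a -> 0 < b -> 0 < nu ->
  (forall k, (k0 <= k)%N -> a * nu ^+ k <= u k <= b * nu ^+ k) ->
  (fun n : nat => ln (u n) / n%:R) @ \oo --> ln nu.
Proof.
move=> a0 b0 nu0 H; apply/cvgrPdist_le => e e0.
pose K := `|ln a| + `|ln b|; have K0 : 0 <= K by rewrite addr_ge0.
near=> n.
have n0 : 0 < n%:R :> R by rewrite ltr0n; near: n; exact: nbhs_infty_gt.
have /H/andP[lo hi] : (k0 <= n)%N by near: n; exact: nbhs_infty_ge.
have Kn : K <= e * n%:R.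
  rewrite -ler_pdivrMl// mulrC; apply: le_trans (ltW (truncnS_gt _)) _.
  by rewrite ler_nat; near: n; exact: nbhs_infty_ge.
have nun : 0 < nu ^+ n by rewrite exprn_gt0.
have an : 0 < a * nu ^+ n by rewrite mulr_gt0.
have bn : 0 < b * nu ^+ n by rewrite mulr_gt0.
have un : 0 < u n by exact: lt_le_trans an lo.
have lo' : ln a + ln nu * n%:R <= ln (u n).
  have := lo; rewrite -ler_ln ?posrE// lnM ?posrE// lnXn//.
  by rewrite mulr_natr.
have hi' : ln (u n) <= ln b + ln nu * n%:R.
  have := hi; rewrite -ler_ln ?posrE// lnM ?posrE// lnXn//.
  by rewrite mulr_natr.
have -> : ln nu - ln (u n) / n%:R = (ln nu * n%:R - ln (u n)) / n%:R.
  by field; rewrite gt_eqF.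
rewrite normrM [`|n%:R^-1|]gtr0_norm ?invr_gt0// ler_pdivrMr//; apply: le_trans Kn.
have := ler_norm (ln b); have := lerNnormlW (lexx `|ln a|).
have := normr_ge0 (ln a); have := normr_ge0 (ln b).
rewrite /K ler_norml; move: lo' hi'; move: (ln nu * _) (ln (u n)) => X Y h1 h2 h3 h4 h5 h6.
by apply/andP; split; lra.
Unshelve. all: by end_near. Qed.

Lemma saddle_eigenvectors (A : 'M[int]_2) (mu ms : R) : 1 < `|mu| -> `|ms| < 1 ->
  mu + ms = tr2 R A -> mu * ms = dt2 R A ->
  exists mu_ ms_, [/\ left_eigen A mu mu_, left_eigen A ms ms_ & det2 mu_ ms_ != 0].
Proof.
move=> mu1 ms1 ht hd.
have [mu_ mu0 muE] : exists2 m, m != 0 & left_eigen A mu m.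
  by apply: left_eigen_exists; rewrite -ht -hd; ring.
have [ms_ ms0 msE] : exists2 m, m != 0 & left_eigen A ms m.
  by apply: left_eigen_exists; rewrite -ht -hd; ring.
exists mu_, ms_; split=> //; apply/eqP => d0.
have em : enorm mu_ != 0 by rewrite enorm_eq0.
pose w := (enorm mu_)^-1 *: mu_.
have w1 : enorm w = 1 by rewrite enormZ normfV ger0_norm ?enorm_ge0// mulVf.
have dw : det2 w ms_ = 0.
  by rewrite /det2 !planeE -!mulrA -mulrBr -/(det2 mu_ ms_) d0 mulr0.
have wE p : dot2 w (mat_act A p) = mu * dot2 w p.
  have dZ q : dot2 w q = (enorm mu_)^-1 * dot2 mu_ q by rewrite /dot2 !planeE; ring.
  by rewrite !dZ muE mulrCA.
have ms_E := line_coord w1 dw.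
have dm p : dot2 ms_ p = dot2 w ms_ * dot2 w p.
  by rewrite {1}ms_E /dot2 !planeE /GRing.scale /=; ring.
have := msE ms_; rewrite [LHS]dm wE mulrCA -dm => /eqP.
rewrite -subr_eq0 -mulrBl mulf_eq0 => /orP[|].
  by rewrite subr_eq0 => /eqP e; move: mu1; rewrite e ltNge (ltW ms1).
have -> : dot2 ms_ ms_ = enorm ms_ ^+ 2 by rewrite sq_enorm /dot2; ring.
by rewrite sqrf_eq0 enorm_eq0 (negbTE ms0).
Qed.

(** Each of the two sets has exactly one element, so [xget] returns it. *)
Lemma saddle_lambda (A : 'M[int]_2) (mu ms : R) : 1 < `|mu| -> `|ms| < 1 ->
  mu + ms = tr2 R A -> mu * ms = dt2 R A ->
  lambda_u R A = ln `|mu| /\ lambda_s R A = ln `|ms|.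
Proof.
move=> mu1 ms1 ht hd.
have ch z : eigenvalue (map_mx intr A) z -> z = mu \/ z = ms.
  move=> /eigenvalue_left[m m0 /(left_eigen_char m0)].
  rewrite -ht -hd => h; have : (z - mu) * (z - ms) == 0 by apply/eqP; rewrite -h; ring.
  by rewrite mulf_eq0 !subr_eq0 => /orP[] /eqP ->; [left|right].
have eig z : z ^+ 2 - tr2 R A * z + dt2 R A = 0 -> eigenvalue (map_mx intr A) z.
  by move=> /left_eigen_exists h; exact/eigenvalue_left.
split; congr (ln `|_|); apply: xget_subset1.
- by split=> //; apply: eig; rewrite -ht -hd; ring.
- move=> y z [/ch hy y1] [/ch hz z1].
  have ne w : w = mu \/ w = ms -> 1 < `|w| -> w = mu.
    by case=> // -> ; rewrite ltNge (ltW ms1).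
  by rewrite (ne y hy y1) (ne z hz z1).
- by split=> //; apply: eig; rewrite -ht -hd; ring.
- move=> y z [/ch hy y1] [/ch hz z1].
  have ne w : w = mu \/ w = ms -> `|w| < 1 -> w = ms.
    by case=> // ->; rewrite ltNge (ltW mu1).
  by rewrite (ne y hy y1) (ne z hz z1).
Qed.

Variables (f : torus R -> torus R) (F : plane R -> plane R) (A : 'M[int]_2).
Hypothesis lF : is_lift f F.
Hypothesis hA : is_linearization f A.
Hypothesis C1F : Ck 1 [set: plane R] F.
Hypothesis anF : anosov f F.
Hypothesis splF : forall p, exists (x : int -> plane R) Eu Es,
  [/\ full_orbit F x, x 0 = p & hyperbolic_splitting (plane_iter F) x Eu Es].
Variable es : plane R -> plane R.
Hypothesis ues : unif_line_field es.
Hypothesis esP : forall p, fwd_bounded F p (es p).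
Hypothesis es_line : forall p v, fwd_bounded F p v -> exists a, v = a *: es p.

Let T := plane_iter F.
Local Opaque plane_iter.

(** A full orbit through [x] needs a past, which is obtained by projecting an orbit of the lift. *)
Lemma torus_splitting (x : torus R) : exists X Eu Es, [/\ full_orbit f X, X 0 = x &
  hyperbolic_splitting (tangent_iter F) X Eu Es].
Proof.
have [y [_ [_ [oy y0 _]]]] := splF (repr x).
have oX : full_orbit f (fun i => torus_pi (y i)).
  by move=> i; rewrite -lF.2 oy.
have [_ /(_ _ oX)[Eu [Es spl]]] := anF.
exists (fun i => torus_pi (y i)), Eu, Es; split=> //.
by rewrite y0 torus_pi_repr.
Qed.

Lemma tangent_iterD n (x : torus R) v w :
  tangent_iter F n x (v + w) = tangent_iter F n x v + tangent_iter F n x w.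
Proof. exact: TaddE. Qed.

Lemma unstable_dir_unbounded (x : torus R) v : unstable_dir f (tangent_iter F) x v ->
  v != 0 -> ~ fwd_bounded F (repr x) v.
Proof.
move=> [X [Eu [Es [oX <- spl Ev]]]] v0 [M HM].
have Esv := bounded_stable tangent_iterD spl (M := M) HM.
by move/eqP: v0; apply; exact: (split_uniq spl Ev).
Qed.

Lemma stable_dir_bounded (x : torus R) v : stable_dir f (tangent_iter F) x v ->
  fwd_bounded F (repr x) v.
Proof.
by move=> [X [Eu [Es [oX <- spl Ev]]]]; have [M HM] := stable_bounded spl Ev; exists M.
Qed.

(** An unstable direction on the torus may come from a past other than that of the lifted orbit.
    Modulo the stable line all vectors are proportional, so any two vectors with unbounded forward
    orbits grow at the same rate. *)
Lemma unbounded_growth p v w (a b nu : R) k0 : 0 < a -> 0 < b -> 1 < nu ->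
  ~ fwd_bounded F p v -> ~ fwd_bounded F p w ->
  (forall k, (k0 <= k)%N -> a * nu ^+ k <= enorm (T k p v) <= b * nu ^+ k) ->
  exists a' b' k1, [/\ 0 < a', 0 < b' &
    forall k, (k1 <= k)%N -> a' * nu ^+ k <= enorm (T k p w) <= b' * nu ^+ k].
Proof.
move=> a0 b0 nu1 nv nw H; have [es1 _] := ues.
have [K K1 HK] := stable_bound lF hA C1F anF.
have dv : det2 (es p) v != 0.
  apply/eqP => /(line_coord (es1 p)) vE; apply: nv; rewrite vE.
  exact: (fwd_bounded_scale _ (esP p)).
have wE := cramer w dv.
set be := det2 w v / _ in wE; set al := _ / _ in wE.
have al0 : al != 0.
  apply/eqP => e; apply: nw; rewrite wE e scale0r addr0.
  exact: (fwd_bounded_scale _ (esP p)).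
have al1 : 0 < `|al| by rewrite normr_gt0.
have TE k : T k p w = be *: T k p (es p) + al *: T k p v.
  by rewrite [in LHS]wE; exact: etrans (TaddE F k p _ _) (congr2 +%R (TscaleE F k p _ _) (TscaleE F k p _ _)).
have Tes k : enorm (be *: T k p (es p)) <= `|be| * K.
  rewrite enormZ ler_wpM2l//; have := HK _ _ (esP p) k; by rewrite es1 mulr1.
have up k : enorm (T k p w) <= `|be| * K + `|al| * enorm (T k p v).
  rewrite TE -enormZ; apply: (le_trans (enormD _ _)); exact: lerD.
have lo k : `|al| * enorm (T k p v) - `|be| * K <= enorm (T k p w).
  rewrite -enormZ; have := enormB (al *: T k p v) (- (be *: T k p (es p))).
  rewrite opprK enormN [al *: _ + _]addrC -TE; have := Tes k.
  move: (enorm (al *: _)) (enorm (be *: _)) (enorm (T k p w)) (`|be| * K) => X Y Z W; lra.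
have bK : 0 <= `|be| * K by rewrite mulr_ge0// (le_trans ler01).
have [k2 big] := expr_unbounded (`|be| * K / (`|al| * a / 2)) nu1.
exists (`|al| * a / 2), (`|be| * K + `|al| * b), (maxn k0 k2); split.
- by rewrite divr_gt0// mulr_gt0.
- by rewrite ltr_wpDl// mulr_gt0.
move=> k; rewrite geq_max => /andP[/H/andP[h1 h2] k2k].
have nk : 1 <= nu ^+ k by rewrite exprn_ege1// ltW.
have big2 : `|be| * K <= `|al| * a / 2 * nu ^+ k.
  rewrite -ler_pdivrMl ?divr_gt0 ?mulr_gt0// mulrC; apply: (le_trans (ltW big)).
  by apply: ler_weXn2l => //; exact: ltW.
have h1' := ler_wpM2l (ltW al1) h1; have h2' := ler_wpM2l (ltW al1) h2.
have := up k; have := lo k.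
move: (enorm (T k p v)) (enorm (T k p w)) h1' h2' => X Y h1' h2' l u.
apply/andP; split; first by move: l h1' big2; lra.
have : `|be| * K <= `|be| * K * nu ^+ k by rewrite ler_peMr.
by move: u h2'; lra.
Qed.

Variables Ws Wu : foliation R.
Hypothesis tWs : stable_foliation F Ws.
Hypothesis tWu : unstable_foliation F Wu.
Hypothesis qWs : quasi_preserves_densities F Ws.
Hypothesis qWu : quasi_preserves_densities F Wu.

Lemma stable_profile : exists2 C, 1 <= C & forall p,
  rescaled_leaf F (stable_normal es) (fun k => enorm (T k p (es p))) C.
Proof.
have [C C1 H] := stable_rescaled lF hA C1F anF splF ues esP es_line tWs qWs.
by exists C => // p k L L0; exact: H.
Qed.

Lemma linearization_saddle : exists mu ms : R,
  [/\ 1 < `|mu|, 0 < `|ms|, `|ms| < 1, mu + ms = tr2 R A & mu * ms = dt2 R A].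
Proof.
have [C0 near] := lift_near_linear lF hA.
have [C C1 prof] := stable_profile.
have [y [Eu [Es [oy y0 spl]]]] := splF 0.
have [_ _ [c [l [c0 l1 H]]]] := spl.
have Ese : Es 0 (es 0) by apply/(fwd_boundedP 0 _ spl); rewrite y0; exact: esP.
have Jd k : enorm (T k 0 (es 0)) <= c * l ^- k.
  have [_ /(_ _ Ese)] := H k 0; rewrite y0; have [-> _] := ues; by rewrite mulr1.
exact: (saddle near (stable_normal_unif ues) (lift_onto splF) C1 c0 l1 (prof 0) Jd).
Qed.

Lemma exponents (x : torus R) :
  lyapunov_exponent (tangent_iter F) (unstable_dir f (tangent_iter F)) x (lambda_u R A) /\
  lyapunov_exponent (tangent_iter F) (stable_dir f (tangent_iter F)) x (lambda_s R A).
Proof.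
have [mu [ms [mu1 ms0 ms1 ht hd]]] := linearization_saddle.
have [-> ->] := saddle_lambda mu1 ms1 ht hd.
have [mu_ [ms_ [muE msE dm]]] := saddle_eigenvectors mu1 ms1 ht hd.
have [C0 near] := lift_near_linear lF hA.
have [X [Eu [Es [oX X0 spl]]]] := torus_splitting x.
have mu0 : 0 < `|mu| by exact: lt_trans ltr01 mu1.
have [[eu eu0 EuE] [e e0 EsE]] := split_is_line spl 0.
split; split.
- exists eu => //; exists X, Eu, Es; split=> //; rewrite EuE.
  by exists 1 => //; rewrite scale1r.
- move=> w /unstable_dir_unbounded nw /nw {}nw.
  have [al al0 Hu] := unstable_curve lF hA C1F anF splF ues esP tWu qWu.
  have [C [v [g [g' [C1 nv Cg grow]]]]] := Hu (repr x).
  have gr : growing_curve F es (fun k => enorm (T k (repr x) v)) al C.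
    exists g => k; have [J0 gP] := grow k; split=> //.
    by exists (fun t => T k (g t) (g' t)); split; [exact: C1curve_iter|].
  have unb M : exists k, M < enorm (T k (repr x) v).
    apply: contrapT => neg; apply: nv; exists M => n; rewrite leNgt; apply/negP => h.
    by apply: neg; exists n.
  have [a [b [k0 [a0 b0 H]]]] := unstable_asymptotics near ues mu1 ms1 muE msE dm al0 C1 gr unb.
  have [a' [b' [k1 [a'0 b'0 H']]]] := unbounded_growth a0 b0 mu1 nv nw H.
  exact: exponent_cvg a'0 b'0 mu0 H'.
- exists e => //; exists X, Eu, Es; split=> //; rewrite EsE.
  by exists 1 => //; rewrite scale1r.
- move=> w /stable_dir_bounded/es_line[z wE] w0.
  have [C C1 prof] := stable_profile.
  have [a [b [a0 b0 H]]] := stable_asymptotics near (stable_normal_unif ues) mu1 ms1 ms0 muE msE dm C1 (prof (repr x)).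
  have z0 : 0 < `|z|.
    by rewrite normr_gt0; apply: contra_neq w0 => e'; rewrite wE e' scale0r.
  apply: (@exponent_cvg (`|z| * a) (`|z| * b) _ _ 0%N) => // [||k _].
  + exact: mulr_gt0.
  + exact: mulr_gt0.
  have -> : enorm (tangent_iter F k x w) = `|z| * enorm (T k (repr x) (es (repr x))).
    by rewrite -enormZ wE; congr enorm; exact: TscaleE.
  by rewrite -!mulrA !ler_pM2l.
Qed.

End Exponents.

Theorem theorem3 (R : realType) (f : torus R -> torus R)
    (F : plane R -> plane R) (A : 'M[int]_2) (Ws Wu : foliation R) :
  is_lift f F ->
  smooth F ->
  anosov f F ->
  is_linearization f A ->
  stable_foliation F Ws ->
  unstable_foliation F Wu ->
  quasi_preserves_densities F Ws ->
  quasi_preserves_densities F Wu ->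
  UBD Ws ->
  UBD Wu ->
  forall x : torus R,
    lyapunov_exponent (tangent_iter F)
      (unstable_dir f (tangent_iter F)) x (lambda_u R A) /\
    lyapunov_exponent (tangent_iter F)
      (stable_dir f (tangent_iter F)) x (lambda_s R A).
Proof.
move=> lF sF anF hA tWs tWu qWs qWu _ _ x.
have C1F := sF 1%N; have splF := orbit_splitting tWs.
have [e [ue eP e_line]] := stable_field lF hA C1F anF splF.
exact: (exponents lF hA C1F anF splF ue eP e_line tWs tWu qWs qWu).
Qed.
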